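(* Let $\alpha\in(0,1)$. Let $H\in C^2(\mathbb{R}^2;\mathbb{R})$ be radial, $H(p)=h(|p|)$, with $h(s)=1+\frac{A}{s^\gamma}+\frac{\tilde h(s)}{s^{\gamma+\beta}}$ for all large $s$, where $A>0$, $\gamma>1$, $\beta\ge0$, $\tilde h\in C^2((0,+\infty);\mathbb{R})$, and: if $\beta>1$, $\tilde h$ is bounded; if $\beta\in(0,1]$, $\tilde h(s)=B+o(s^{\beta-1})$ for some $B\in\mathbb{R}$; if $\beta=0$, $\tilde h(s)=B+o(s^{-1})$ with $B>-A$; and $|h''(s)|\le C s^{-(\gamma+1+\min\{1,\beta\})}$ for some $C>0$ and all large $s$. Then there exist $\bar n\ge2$, $\bar M>0$, a sequence $(R_n)\subset\mathbb{R}$ and a sequence $(\phi_n)$ with $\phi_n\in C^{2,\alpha}$ and $\phi_n$ periodic of period $2\pi\frac{n}{n-1}$, such that for every $n\ge\bar n$: $R_n=(r_nn)^{1/(\gamma+2)}$ with $r_n\in(r_0,r_1)$ for some $0<r_0<r_1$ (independent of $n$); $\|\phi_n\|_{C^{2,\alpha}}\le\bar M n^{-\gamma/(\gamma+2)}$; and $\mathcal{K}(U_{n,R_n}+\phi_n\mathbf{N}_{n,R_n})=H(U_{n,R_n}+\phi_n\mathbf{N}_{n,R_n})$ on $\mathbb{R}$.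
   Context: Identify $\mathbb{R}^2$ with $\mathbb{C}$ ($ip$ is rotation by $\pi/2$, $e^{i\theta}=(\cos\theta,\sin\theta)$). For $n\in\mathbb{N}$, $R>0$: $U_{n,R}(t)=Re^{it/n}+e^{it}$ and $\mathbf{N}_{n,R}=\frac{i\dot U_{n,R}}{|\dot U_{n,R}|}$. For a regular $C^2$ curve $U$, $\mathcal{K}(U)=\frac{i\dot U\cdot\ddot U}{|\dot U|^3}$. The norm $\|\phi\|_{C^{2,\alpha}}$ of a periodic function is the $C^{2,\alpha}$ norm computed over one period (sup norms of $\phi,\phi',\phi''$ plus the $\alpha$-Hölder seminorm of $\phi''$). *)

(* Defs.v *)
From Stdlib Require Import Reals Lra.
From Coquelicot Require Import Coquelicot.
Open Scope R_scope.

Definition D1 (f : R -> R -> R) : R -> R -> R := fun x y => Derive (fun u => f u y) x.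
Definition D2 (f : R -> R -> R) : R -> R -> R := fun x y => Derive (fun v => f x v) y.

Definition C1_R2 (f : R -> R -> R) : Prop :=
  (forall x y, ex_derive (fun u => f u y) x /\ ex_derive (fun v => f x v) y) /\
  (forall x y, continuity_2d_pt f x y /\ continuity_2d_pt (D1 f) x y
               /\ continuity_2d_pt (D2 f) x y).

Definition C2_R2 (f : R -> R -> R) : Prop :=
  C1_R2 f /\ C1_R2 (D1 f) /\ C1_R2 (D2 f).

Definition C2_pos (g : R -> R) : Prop :=
  forall s, 0 < s ->
    ex_derive g s /\ ex_derive (Derive g) s /\ continuous (Derive_n g 2) s.

Definition C2alpha (alpha : R) (phi : R -> R) : Prop :=
  (forall t, ex_derive phi t /\ ex_derive (Derive phi) t
             /\ continuous (Derive_n phi 2) t) /\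
  exists K, forall x y,
    Rabs (Derive_n phi 2 x - Derive_n phi 2 y) <= K * Rpower (Rabs (x - y)) alpha.

Definition periodic (T : R) (phi : R -> R) : Prop := forall t, phi (t + T) = phi t.

Definition sup_period (T : R) (g : R -> R) : Rbar :=
  Lub_Rbar (fun v => exists x, 0 <= x <= T /\ v = Rabs (g x)).

Definition holder_period (T alpha : R) (g : R -> R) : Rbar :=
  Lub_Rbar (fun v => exists x z, 0 <= x <= T /\ 0 <= z <= T /\ x <> z /\
              v = Rabs (g x - g z) / Rpower (Rabs (x - z)) alpha).

Definition C2alpha_norm (T alpha : R) (phi : R -> R) : Rbar :=
  Rbar_plus (Rbar_plus (Rbar_plus (sup_period T phi) (sup_period T (Derive phi)))
                       (sup_period T (Derive_n phi 2)))
            (holder_period T alpha (Derive_n phi 2)).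

(* The curve U_{n,R}(t) = R e^{it/n} + e^{it}, componentwise *)
Definition U1 (n : nat) (Rr : R) (t : R) : R := Rr * cos (t / INR n) + cos t.
Definition U2 (n : nat) (Rr : R) (t : R) : R := Rr * sin (t / INR n) + sin t.

(* N_{n,R} = i U' / |U'|, with i(a,b) = (-b,a) *)
Definition speed (x y : R -> R) (t : R) : R :=
  sqrt (Derive x t ^ 2 + Derive y t ^ 2).
Definition N1 (n : nat) (Rr : R) (t : R) : R :=
  - Derive (U2 n Rr) t / speed (U1 n Rr) (U2 n Rr) t.
Definition N2 (n : nat) (Rr : R) (t : R) : R :=
  Derive (U1 n Rr) t / speed (U1 n Rr) (U2 n Rr) t.

(* curvature K(V) = (i V' . V'') / |V'|^3 of a planar curve V = (x,y) *)
Definition curvature (x y : R -> R) (t : R) : R :=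
  (Derive x t * Derive_n y 2 t - Derive y t * Derive_n x 2 t) / (speed x y t) ^ 3.

Definition regular_C2 (x y : R -> R) : Prop :=
  forall t, ex_derive x t /\ ex_derive (Derive x) t /\ ex_derive y t
            /\ ex_derive (Derive y) t /\ 0 < Derive x t ^ 2 + Derive y t ^ 2.

(* Main.v *)
(* Write V = U + phi N, let w = |U'| - kappa phi with kappa the rotation rate of U', and let p be the
   slope of V' in the frame (U'/|U'|, N), so that phi' = w p. Then K(V) = H(V) is the first-order
   system for (phi, p) whose second equation is p' = w H(V) (1 + p^2)^(3/2) - kappa (1 + p^2); its
   coefficients depend on t only through sigma = (1 - 1/n) t, evenly and 2 pi-periodically.
   Start from phi(0) = p(0) = 0 and shoot in R. If p vanishes at the half period T/2, reflecting the
   solution at 0 and at T/2 makes it T-periodic. By Gronwall phi and p are O(R^-gamma), and since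
   gamma > 1 the quadratic terms are negligible at the order R^-(gamma+1), at which projecting the
   linearisation phi'' + phi = H(U) - K(U) on cos sigma gives
   p(T/2) = - (pi/2) (2 R/n - a gamma R^-(gamma+1)) + o(R^-(gamma+1)), where h - 1 ~ a s^-gamma. With
   R^(gamma+2) = r n this changes sign at r = a gamma / 2, and the intermediate value theorem applies.
   The C^{2,alpha} bound holds because phi'' is Lipschitz with constant O(R^-gamma). *)
Require Import Defs.
From Stdlib Require Import Reals Lra Lia IndefiniteDescription FunctionalExtensionality.
From Coquelicot Require Import Coquelicot.
Open Scope R_scope.

(** * Planar systems of ordinary differential equations *)

(** The period tends to 2 pi, so phi'' + phi is nearly degenerate: cos sigma and sin sigma are
    almost in its kernel. Evenness excludes the sine, phi(0) = 0 fixes the coefficient of the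
    cosine, which the equation leaves free, and R is the parameter that pays for the missing range.
    The largest forcing, the constant h(R) - 1 of order R^-gamma, sets the size of phi but
    integrates to zero against cos sigma over half a period; this is why the outcome is decided one
    order lower. The term 2 R/n arises because |U'| and kappa deviate from 1 by +e cos sigma and -e
    cos sigma, with e = R/n. Every constant has to be uniform in n, in R and in the rescaled
    problem, which is the reason for the calculus of bounded Lipschitz functions with one small
    parameter q of order R^-gamma. The derivative of h enters only through a bound O(s^-gamma); the
    variation of h along U, needed to precision o(R^-(gamma+1)), is read off from values of h. *)

Lemma deriv_nonneg_le (f df : R -> R) (a b : R) :
  a <= b -> (forall x, a <= x <= b -> is_derive f x (df x)) ->
  (forall x, a <= x <= b -> 0 <= df x) -> f a <= f b.
Proof.
  intros Hab Hd Hp.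
  destruct (MVT_gen f a b df) as [c [Hc He]].
  - intros x Hx; rewrite Rmin_left, Rmax_right in Hx by lra. apply Hd; lra.
  - intros x Hx; rewrite Rmin_left, Rmax_right in Hx by lra.
    apply continuity_pt_filterlim. apply (ex_derive_continuous (V := R_NormedModule)).
    exists (df x). apply Hd; lra.
  - rewrite Rmin_left, Rmax_right in Hc by lra.
    specialize (Hp c Hc). nra.
Qed.

Lemma deriv_dominated (f df g dg : R -> R) (a b : R) :
  a <= b -> (forall x, a <= x <= b -> is_derive f x (df x)) ->
  (forall x, a <= x <= b -> is_derive g x (dg x)) ->
  (forall x, a <= x <= b -> Rabs (df x) <= dg x) -> Rabs (f b - f a) <= g b - g a.
Proof.
  intros Hab Hf Hg Hd.
  assert (H1 : g a - f a <= g b - f b).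
  { apply (deriv_nonneg_le (fun x => g x - f x) (fun x => dg x - df x)); auto.
    - intros x Hx. apply (is_derive_minus (V := R_NormedModule)); auto.
    - intros x Hx. specialize (Hd x Hx). apply Rabs_le_between in Hd. lra. }
  assert (H2 : g a + f a <= g b + f b).
  { apply (deriv_nonneg_le (fun x => g x + f x) (fun x => dg x + df x)); auto.
    - intros x Hx. apply (is_derive_plus (V := R_NormedModule)); auto.
    - intros x Hx. specialize (Hd x Hx). apply Rabs_le_between in Hd. lra. }
  apply Rabs_le; lra.
Qed.

Lemma deriv_bounded_lipschitz (f df : R -> R) (M : R) (P : R -> Prop) :
  (forall x y z, P x -> P y -> x <= z <= y -> P z) ->
  (forall x, P x -> is_derive f x (df x)) ->
  (forall x, P x -> Rabs (df x) <= M) ->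
  forall x y, P x -> P y -> Rabs (f x - f y) <= M * Rabs (x - y).
Proof.
  intros Hc Hd HM.
  assert (Hle : forall x y, P x -> P y -> x <= y -> Rabs (f y - f x) <= M * (y - x)).
  { intros x y Px Py Hxy.
    replace (M * (y - x)) with (M * y - M * x) by ring.
    apply (deriv_dominated f df (fun t => M * t) (fun _ => M)); auto.
    - intros z Hz; apply Hd; eauto.
    - intros z Hz; auto_derive; auto; ring.
    - intros z Hz; apply HM; eauto. }
  intros x y Px Py. destruct (Rle_dec x y) as [Hxy | Hxy].
  - rewrite Rabs_minus_sym, (Rabs_minus_sym x y), (Rabs_pos_eq (y - x)) by lra. auto.
  - rewrite (Rabs_pos_eq (x - y)) by lra. apply Hle; auto; lra.
Qed.

Lemma is_derive_reflect (f : R -> R) (T t l : R) :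
  is_derive f (T - t) l -> is_derive (fun s => f (T - s)) t (- l).
Proof.
  intros H. replace (- l) with (scal (-1) l) by (unfold scal; simpl; unfold mult; simpl; ring).
  apply (is_derive_comp f (fun s => T - s)); auto.
  auto_derive; auto; ring.
Qed.

Lemma Derive_eta (f : R -> R) (t l : R) : is_derive f t l -> Derive (fun r : R => f r) t = l.
Proof. apply is_derive_unique. Qed.

(** With the weight exp (k |t|), integrating from 0 gains a factor 1/k. A large k then makes the
    Picard map a contraction on the whole line at once. *)
Lemma deriv_exp_weight (F dF : R -> R) (c k : R) :
  0 <= c -> F 0 = 0 -> (forall t, is_derive F t (dF t)) ->
  (forall t, Rabs (dF t) <= c * k * exp (k * Rabs t)) ->
  forall t, Rabs (F t) <= c * exp (k * Rabs t).
Proof.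
  intros Hc HF0.
  assert (Hpos : forall G dG : R -> R, G 0 = 0 -> (forall t, is_derive G t (dG t)) ->
    (forall t, Rabs (dG t) <= c * k * exp (k * Rabs t)) ->
    forall t, 0 <= t -> Rabs (G t) <= c * exp (k * t)).
  { intros G dG HG0 HdG HG t Ht.
    replace (G t) with (G t - G 0) by (rewrite HG0; ring).
    apply Rle_trans with (c * exp (k * t) - c * exp (k * 0)).
    - apply (deriv_dominated G dG (fun t => c * exp (k * t)) (fun t => c * k * exp (k * t))); auto.
      + intros x _. auto_derive; auto; ring.
      + intros x Hx. specialize (HG x). rewrite (Rabs_pos_eq x) in HG by lra. exact HG.
    - rewrite Rmult_0_r, exp_0. lra. }
  intros Hd HB t. destruct (Rle_dec 0 t) as [Ht | Ht].
  - rewrite (Rabs_pos_eq t Ht). apply (Hpos F dF); auto.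
  - rewrite (Rabs_left t) by lra.
    replace (F t) with ((fun s => F (0 - s)) (- t)) by (f_equal; ring).
    apply (Hpos (fun s => F (0 - s)) (fun s => - dF (0 - s))); [ | | | lra].
    + rewrite Rminus_0_r; exact HF0.
    + intros s. apply is_derive_reflect; auto.
    + intros s. rewrite Rabs_Ropp. eapply Rle_trans; [apply HB|].
      replace (0 - s) with (- s) by ring. rewrite Rabs_Ropp. lra.
Qed.

Lemma half_pow_pos k : 0 < (1/2)^k.
Proof. apply pow_lt; lra. Qed.

Lemma le_of_half_pow (a b c : R) : (forall k, a <= b + c * (1/2)^k) -> a <= b.
Proof.
  intros H.
  apply (is_lim_seq_le (fun _ => a) (fun k => b + c * (1/2)^k) a b); auto.
  - apply is_lim_seq_const.
  - replace (Finite b) with (Rbar_plus b (Rbar_mult c 0)) by (simpl; f_equal; ring).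
    apply is_lim_seq_plus'; [apply is_lim_seq_const|].
    apply (is_lim_seq_scal_l (fun k => (1/2)^k) c 0).
    apply is_lim_seq_geom. rewrite Rabs_pos_eq; lra.
Qed.

Lemma geometric_limit (u : nat -> R) (a : R) :
  (forall k, Rabs (u (S k) - u k) <= a * (1/2)^k) ->
  exists l, forall k, Rabs (u k - l) <= 2 * a * (1/2)^k.
Proof.
  intros H.
  (* The intervals [lo k, hi k] are nested because 2 a (1/2)^k is the tail of the geometric series;
     the limit is the supremum of their lower ends. *)
  set (lo := fun k => u k - 2 * a * (1/2)^k). set (hi := fun k => u k + 2 * a * (1/2)^k).
  assert (Ha : 0 <= a).
  { specialize (H O). simpl in H. generalize (Rabs_pos (u 1%nat - u O)). lra. }
  assert (Hstep : forall k, lo k <= lo (S k) /\ hi (S k) <= hi k).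
  { intros k. unfold lo, hi. simpl. specialize (H k). apply Rabs_le_between in H. split; lra. }
  assert (Hlo : forall k m, lo k <= lo (m + k)%nat).
  { intros k m; induction m; simpl; [lra|]. generalize (Hstep (m + k)%nat). lra. }
  assert (Hhi : forall k m, hi (m + k)%nat <= hi k).
  { intros k m; induction m; simpl; [lra|]. generalize (Hstep (m + k)%nat). lra. }
  assert (Hlh : forall k, lo k <= hi k).
  { intros k. unfold lo, hi. generalize (half_pow_pos k). nra. }
  assert (Hall : forall k j, lo k <= hi j).
  { intros k j. generalize (Hlo k j) (Hhi j k) (Hlh (j + k)%nat).
    rewrite (Nat.add_comm k j). lra. }
  destruct (completeness (fun x => exists k, x = lo k)) as [l [Hl1 Hl2]].
  - exists (hi O). intros x [k ->]. auto.
  - exists (lo O). exists O; auto.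
  - exists l. intros k.
    assert (lo k <= l) by (apply Hl1; exists k; auto).
    assert (l <= hi k) by (apply Hl2; intros x [j ->]; auto).
    unfold lo, hi in *. apply Rabs_le. lra.
Qed.

(** * Global existence by Picard iteration *)

Definition lip3 (L : R) (F : R -> R -> R -> R) : Prop :=
  forall t x y t' x' y',
    Rabs (F t x y - F t' x' y') <= L * (Rabs (t - t') + Rabs (x - x') + Rabs (y - y')).

Lemma continuous_of_lipschitz (f : R -> R) (M : R) :
  (forall x y, Rabs (f x - f y) <= M * Rabs (x - y)) -> forall x, continuous f x.
Proof.
  intros H x. apply continuity_pt_filterlim. intros eps Heps.
  assert (HM : 0 <= M).
  { specialize (H 1 0). replace (1 - 0) with 1 in H by ring. rewrite Rabs_R1 in H.
    generalize (Rabs_pos (f 1 - f 0)). lra. }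
  exists (eps / (M + 1)). split; [apply Rdiv_lt_0_compat; lra|].
  intros y [_ Hy]. simpl in *. unfold R_dist in *.
  eapply Rle_lt_trans; [apply H|].
  apply Rle_lt_trans with ((M + 1) * Rabs (y - x)); [generalize (Rabs_pos (y - x)); nra|].
  apply (Rmult_lt_compat_l (M + 1)) in Hy; [|lra].
  replace ((M + 1) * (eps / (M + 1))) with eps in Hy by (field; lra). exact Hy.
Qed.

Lemma is_derive_primitive (f : R -> R) :
  (forall t, continuous f t) -> forall t, is_derive (fun u => RInt f 0 u) t (f t).
Proof.
  intros Hc t. apply (is_derive_RInt f (fun u => RInt f 0 u) 0 t); auto.
  exists (mkposreal 1 Rlt_0_1). intros y _.
  apply (RInt_correct f 0 y), ex_RInt_continuous; auto.
Qed.

Fixpoint picard (F1 F2 : R -> R -> R -> R) (k : nat) : (R -> R) * (R -> R) :=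
  match k with
  | O => (fun _ => 0, fun _ => 0)
  | S k => let z := picard F1 F2 k in
      (fun t => RInt (fun s => F1 s (fst z s) (snd z s)) 0 t,
       fun t => RInt (fun s => F2 s (fst z s) (snd z s)) 0 t)
  end.

Lemma comp_lip3_continuous (F : R -> R -> R -> R) (L M : R) (x y : R -> R) :
  0 <= L -> lip3 L F ->
  (forall s t, Rabs (x s - x t) <= M * Rabs (s - t)) ->
  (forall s t, Rabs (y s - y t) <= M * Rabs (s - t)) ->
  forall t, continuous (fun s => F s (x s) (y s)) t.
Proof.
  intros HL HF Hx Hy. apply continuous_of_lipschitz with (L * (1 + M + M)).
  intros s t. eapply Rle_trans; [apply HF|].
  rewrite Rmult_assoc. apply Rmult_le_compat_l; auto.
  specialize (Hx s t). specialize (Hy s t). lra.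
Qed.

Lemma ode_exists (F1 F2 : R -> R -> R -> R) (L M : R) :
  0 < L -> lip3 L F1 -> lip3 L F2 ->
  (forall t x y, Rabs (F1 t x y) <= M) -> (forall t x y, Rabs (F2 t x y) <= M) ->
  exists x y : R -> R, x 0 = 0 /\ y 0 = 0 /\
    (forall t, is_derive x t (F1 t (x t) (y t))) /\
    (forall t, is_derive y t (F2 t (x t) (y t))).
Proof.
  intros HL HF1 HF2 HM1 HM2.
  assert (HM : 0 <= M) by (eapply Rle_trans; [apply Rabs_pos | apply (HM1 0 0 0)]).
  set (X := fun k => fst (picard F1 F2 k)). set (Y := fun k => snd (picard F1 F2 k)).
  assert (Lip : forall f df : R -> R, (forall t, is_derive f t (df t)) ->
     (forall t, Rabs (df t) <= M) -> forall s t, Rabs (f s - f t) <= M * Rabs (s - t)).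
  { intros f df Hd Hb s t. apply (deriv_bounded_lipschitz f df M (fun _ => True)); auto. }
  assert (HX0 : forall k, X k 0 = 0).
  { destruct k; simpl; auto. unfold X; simpl. apply (RInt_point (V := R_CompleteNormedModule)). }
  assert (HY0 : forall k, Y k 0 = 0).
  { destruct k; simpl; auto. unfold Y; simpl. apply (RInt_point (V := R_CompleteNormedModule)). }
  assert (HLip : forall k, (forall s t, Rabs (X k s - X k t) <= M * Rabs (s - t)) /\
                           (forall s t, Rabs (Y k s - Y k t) <= M * Rabs (s - t))).
  { induction k as [|k [IHx IHy]].
    - split; intros s t; unfold X, Y; simpl; rewrite Rminus_0_r, Rabs_R0;
        apply Rmult_le_pos; auto; apply Rabs_pos.
    - split; [apply (Lip _ (fun s => F1 s (X k s) (Y k s))) | apply (Lip _ (fun s => F2 s (X k s) (Y k s)))];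
        auto; intros t.
      + apply (is_derive_primitive (fun s => F1 s (X k s) (Y k s))).
        apply comp_lip3_continuous with L M; auto; lra.
      + apply (is_derive_primitive (fun s => F2 s (X k s) (Y k s))).
        apply comp_lip3_continuous with L M; auto; lra. }
  assert (HdX : forall k t, is_derive (X (S k)) t (F1 t (X k t) (Y k t))).
  { intros k t. apply (is_derive_primitive (fun s => F1 s (X k s) (Y k s))).
    destruct (HLip k). apply comp_lip3_continuous with L M; auto; lra. }
  assert (HdY : forall k t, is_derive (Y (S k)) t (F2 t (X k t) (Y k t))).
  { intros k t. apply (is_derive_primitive (fun s => F2 s (X k s) (Y k s))).
    destruct (HLip k). apply comp_lip3_continuous with L M; auto; lra. }
  (* Two components with Lipschitz constant L give a factor 2 L, and the weight with k = 4 L divides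
     it by 4 L, so each iteration halves the error. C is such that C * (4 * L) = M bounds the first
     step. *)
  set (C := M / (4 * L)).
  assert (HC : 0 <= C) by (apply Rdiv_le_0_compat; lra).
  set (W := fun t => exp (4 * L * Rabs t)).
  assert (HW : forall t, 1 <= W t).
  { intros t. unfold W. rewrite <- exp_0. 
    destruct (Rle_lt_or_eq_dec 0 (4 * L * Rabs t)) as [Hl | He].
    - apply Rmult_le_pos; [lra | apply Rabs_pos].
    - left; apply exp_increasing; auto.
    - rewrite <- He; lra. }
  assert (Hcauchy : forall k t, Rabs (X (S k) t - X k t) <= C * (1/2)^k * W t /\
                                Rabs (Y (S k) t - Y k t) <= C * (1/2)^k * W t).
  { assert (Hlast : forall k (F : R -> R -> R -> R), lip3 L F ->
       (forall t, Rabs (X (S k) t - X k t) <= C * (1/2)^k * W t /\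
                  Rabs (Y (S k) t - Y k t) <= C * (1/2)^k * W t) ->
       forall t, Rabs (F t (X (S k) t) (Y (S k) t) - F t (X k t) (Y k t))
                 <= C * (1/2)^(S k) * (4 * L) * W t).
    { intros k F HF IH t. eapply Rle_trans; [apply HF|].
      rewrite Rminus_diag, Rabs_R0. destruct (IH t) as [I1 I2].
      replace (C * (1/2)^(S k) * (4 * L) * W t)
        with (L * (0 + C * (1/2)^k * W t + C * (1/2)^k * W t)) by (simpl; field).
      apply Rmult_le_compat_l; lra. }
    induction k as [|k IH]; intros t.
    - unfold X at 2, Y at 2. simpl (fst _). simpl (snd _). rewrite !Rminus_0_r.
      simpl pow. rewrite Rmult_1_r.
      split; [apply (deriv_exp_weight (X 1%nat) (fun t => F1 t (X O t) (Y O t)))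
             |apply (deriv_exp_weight (Y 1%nat) (fun t => F2 t (X O t) (Y O t)))]; auto;
      intros s; unfold C; replace (M / (4 * L) * (4 * L)) with M by (field; lra);
      specialize (HW s); unfold W in HW; eapply Rle_trans; try apply HM1; try apply HM2; nra.
    - generalize (half_pow_pos (S k)); intros Hp.
      split.
      + apply (deriv_exp_weight (fun t => X (S (S k)) t - X (S k) t)
          (fun t => F1 t (X (S k) t) (Y (S k) t) - F1 t (X k t) (Y k t))).
        * apply Rmult_le_pos; lra.
        * rewrite !HX0; ring.
        * intros s. apply (is_derive_minus (V := R_NormedModule)); apply HdX.
        * intros s. apply (Hlast k F1); auto.
      + apply (deriv_exp_weight (fun t => Y (S (S k)) t - Y (S k) t)
          (fun t => F2 t (X (S k) t) (Y (S k) t) - F2 t (X k t) (Y k t))).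
        * apply Rmult_le_pos; lra.
        * rewrite !HY0; ring.
        * intros s. apply (is_derive_minus (V := R_NormedModule)); apply HdY.
        * intros s. apply (Hlast k F2); auto. }
  assert (Hlim : forall Z : nat -> R -> R,
     (forall k t, Rabs (Z (S k) t - Z k t) <= C * (1/2)^k * W t) ->
     exists z : R -> R, forall k t, Rabs (Z k t - z t) <= 2 * C * (1/2)^k * W t).
  { intros Z HZ.
    destruct (functional_choice (fun t l => forall k, Rabs (Z k t - l) <= 2 * (C * W t) * (1/2)^k))
      as [z Hz].
    - intros t. apply geometric_limit. intros k. specialize (HZ k t).
      replace (C * W t * (1/2)^k) with (C * (1/2)^k * W t) by ring. exact HZ.
    - exists z. intros k t. specialize (Hz t k).
      replace (2 * C * (1/2)^k * W t) with (2 * (C * W t) * (1/2)^k) by ring. exact Hz. }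
  destruct (Hlim X (fun k t => proj1 (Hcauchy k t))) as [x Hx].
  destruct (Hlim Y (fun k t => proj2 (Hcauchy k t))) as [y Hy].
  assert (Hlipz : forall (Z : nat -> R -> R) z,
     (forall k t, Rabs (Z k t - z t) <= 2 * C * (1/2)^k * W t) ->
     (forall k s t, Rabs (Z k s - Z k t) <= M * Rabs (s - t)) ->
     forall s t, Rabs (z s - z t) <= M * Rabs (s - t)).
  { intros Z z Hz HZ s t. apply le_of_half_pow with (2 * C * W s + 2 * C * W t).
    intros k. generalize (Hz k s) (Hz k t) (HZ k s t). intros A1 A2 A3.
    replace (z s - z t) with ((Z k s - Z k t) + - (Z k s - z s) + (Z k t - z t)) by ring.
    eapply Rle_trans; [apply Rabs_triang|].
    eapply Rle_trans; [apply Rplus_le_compat_r, Rabs_triang|]. rewrite Rabs_Ropp. lra. }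
  assert (Lx := Hlipz X x Hx (fun k => proj1 (HLip k))).
  assert (Ly := Hlipz Y y Hy (fun k => proj2 (HLip k))).
  assert (Hfix : forall (F : R -> R -> R -> R) Z z, lip3 L F ->
     (forall k t, Rabs (Z k t - z t) <= 2 * C * (1/2)^k * W t) -> (forall k, Z k 0 = 0) ->
     (forall k t, is_derive (Z (S k)) t (F t (X k t) (Y k t))) ->
     forall t, z t = RInt (fun s => F s (x s) (y s)) 0 t).
  { intros F Z z HF Hz HZ0 HdZ t.
    assert (Hc : forall t, continuous (fun s => F s (x s) (y s)) t).
    { apply comp_lip3_continuous with L M; auto; lra. }
    assert (Hdiff : forall k, Rabs (Z (S k) t - RInt (fun s => F s (x s) (y s)) 0 t)
                              <= C * (1/2)^k * W t).
    { intros k. generalize (half_pow_pos k); intros Hp.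
      apply (deriv_exp_weight (fun t => Z (S k) t - RInt (fun s => F s (x s) (y s)) 0 t)
         (fun t => F t (X k t) (Y k t) - F t (x t) (y t))).
      - apply Rmult_le_pos; lra.
      - rewrite HZ0. rewrite (RInt_point (V := R_CompleteNormedModule)).
        unfold zero; simpl; ring.
      - intros s. apply (is_derive_minus (V := R_NormedModule)); [apply HdZ|].
        apply (is_derive_primitive (fun s => F s (x s) (y s))); auto.
      - intros s. eapply Rle_trans; [apply HF|].
        rewrite Rminus_diag, Rabs_R0. generalize (Hx k s) (Hy k s). intros I1 I2.
        fold (W s).
        replace (C * (1/2)^k * (4 * L) * W s)
          with (L * (0 + 2 * C * (1/2)^k * W s + 2 * C * (1/2)^k * W s)) by ring.
        apply Rmult_le_compat_l; lra. }
    apply Rminus_diag_uniq. apply Rabs_eq_0. apply Rle_antisym; [|apply Rabs_pos].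
    apply le_of_half_pow with (2 * C * W t).
    intros k. specialize (Hdiff k). specialize (Hz (S k) t). simpl in Hz.
    replace (z t - RInt (fun s => F s (x s) (y s)) 0 t) with
      (- (Z (S k) t - z t) + (Z (S k) t - RInt (fun s => F s (x s) (y s)) 0 t)) by ring.
    eapply Rle_trans; [apply Rabs_triang|]. rewrite Rabs_Ropp. lra. }
  assert (Ex := Hfix F1 X x HF1 Hx HX0 HdX). assert (Ey := Hfix F2 Y y HF2 Hy HY0 HdY).
  exists x, y. split; [|split; [|split]].
  - rewrite Ex. apply (RInt_point (V := R_CompleteNormedModule)).
  - rewrite Ey. apply (RInt_point (V := R_CompleteNormedModule)).
  - intros t. apply (is_derive_ext (fun t => RInt (fun s => F1 s (x s) (y s)) 0 t)).
    { intros s; symmetry; apply Ex. }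
    apply (is_derive_primitive (fun s => F1 s (x s) (y s))).
    apply comp_lip3_continuous with L M; auto; lra.
  - intros t. apply (is_derive_ext (fun t => RInt (fun s => F2 s (x s) (y s)) 0 t)).
    { intros s; symmetry; apply Ey. }
    apply (is_derive_primitive (fun s => F2 s (x s) (y s))).
    apply comp_lip3_continuous with L M; auto; lra.
Qed.

(** The energy x^2 + y^2 is used because |x| + |y| is not differentiable. Adding b^2 absorbs the
    inhomogeneous term, so that (x^2 + y^2 + b^2) exp (- K t) is nonincreasing for K = 4 L + 2;
    taking the square root halves the exponent to 2 L + 1. *)
Lemma gronwall_system (x y dx dy : R -> R) (b L : R) :
  0 <= b -> 0 <= L -> x 0 = 0 -> y 0 = 0 ->
  (forall t, 0 <= t -> is_derive x t (dx t)) -> (forall t, 0 <= t -> is_derive y t (dy t)) ->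
  (forall t, 0 <= t -> Rabs (dx t) <= b + L * (Rabs (x t) + Rabs (y t))) ->
  (forall t, 0 <= t -> Rabs (dy t) <= b + L * (Rabs (x t) + Rabs (y t))) ->
  forall t, 0 <= t -> Rabs (x t) <= b * exp ((2 * L + 1) * t) /\
                      Rabs (y t) <= b * exp ((2 * L + 1) * t).
Proof.
  intros Hb HL Hx0 Hy0 Hx Hy Hdx Hdy t Ht.
  set (K := 4 * L + 2). set (E := fun t => x t ^ 2 + y t ^ 2).
  assert (Hmon : - (E t + b^2) * exp (- K * t) >= - (E 0 + b^2) * exp (- K * 0)).
  { apply Rle_ge.
    apply (deriv_nonneg_le (fun t => - (E t + b^2) * exp (- K * t))
      (fun t => exp (- K * t) * (K * (E t + b^2) - 2 * (x t * dx t + y t * dy t)))); auto.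
    - intros s Hs. unfold E. specialize (Hx s ltac:(lra)). specialize (Hy s ltac:(lra)).
      auto_derive.
      + repeat split; try (eexists; eassumption).
      + rewrite (Derive_eta x _ _ Hx), (Derive_eta y _ _ Hy). ring.
    - intros s Hs. apply Rmult_le_pos; [left; apply exp_pos|].
      specialize (Hdx s ltac:(lra)). specialize (Hdy s ltac:(lra)).
      assert (A1 : x s * dx s <= Rabs (x s) * Rabs (dx s))
        by (rewrite <- Rabs_mult; apply Rle_abs).
      assert (A2 : y s * dy s <= Rabs (y s) * Rabs (dy s))
        by (rewrite <- Rabs_mult; apply Rle_abs).
      assert (A3 : E s = Rabs (x s) ^ 2 + Rabs (y s) ^ 2)
        by (unfold E; rewrite !pow2_abs; reflexivity).
      generalize (Rabs_pos (x s)) (Rabs_pos (y s)). rewrite A3. unfold K.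
      set (u := Rabs (x s)) in *. set (v := Rabs (y s)) in *. intros Hu Hv.
      assert (B1 : u * Rabs (dx s) <= u * (b + L * (u + v))) by (apply Rmult_le_compat_l; lra).
      assert (B2 : v * Rabs (dy s) <= v * (b + L * (u + v))) by (apply Rmult_le_compat_l; lra).
      assert (B3 : 0 <= (4 * L + 2) * (u^2 + v^2 + b^2) - 2 * ((u + v) * (b + L * (u + v)))).
      { replace ((4 * L + 2) * (u^2 + v^2 + b^2) - 2 * ((u + v) * (b + L * (u + v))))
          with (2 * L * (u - v)^2 + 4 * L * b^2 + (u - b)^2 + (v - b)^2 + u^2 + v^2) by ring.
        generalize (pow2_ge_0 (u - v)) (pow2_ge_0 (u - b)) (pow2_ge_0 (v - b))
          (pow2_ge_0 u) (pow2_ge_0 v) (pow2_ge_0 b). nra. }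
      lra. }
  assert (E0 : E 0 = 0) by (unfold E; rewrite Hx0, Hy0; ring).
  rewrite E0, Rmult_0_r, exp_0 in Hmon.
  assert (HE : E t <= (b * exp ((2 * L + 1) * t))^2).
  { replace ((b * exp ((2 * L + 1) * t))^2) with (b^2 * exp (K * t)).
    2:{ rewrite Rpow_mult_distr. f_equal. unfold K. simpl. rewrite Rmult_1_r, <- exp_plus.
        f_equal; ring. }
    assert (Hp : exp (- K * t) * exp (K * t) = 1)
      by (rewrite <- exp_plus, <- exp_0; f_equal; ring).
    generalize (exp_pos (- K * t)) (exp_pos (K * t)). intros P1 P2.
    assert (E t + b^2 <= b^2 * exp (K * t)).
    { apply Rmult_le_reg_r with (exp (- K * t)); auto.
      replace (b^2 * exp (K * t) * exp (- K * t)) with (b^2 * (exp (- K * t) * exp (K * t))) by ring.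
      rewrite Hp. lra. }
    generalize (pow2_ge_0 b). lra. }
  assert (Hbe : 0 <= b * exp ((2 * L + 1) * t)) by (apply Rmult_le_pos; auto; left; apply exp_pos).
  unfold E in HE.
  split; rewrite <- (Rabs_pos_eq (b * exp ((2 * L + 1) * t))) by auto;
  apply Rsqr_le_abs_0; unfold Rsqr; generalize (pow2_ge_0 (x t)) (pow2_ge_0 (y t)); nra.
Qed.

(** The difference of two solutions satisfies [gronwall_system] with b = 0, forward from a and,
    after reversing time, backward. *)
Lemma ode_unique (F1 F2 : R -> R -> R -> R) (L a : R) (x y x' y' : R -> R) :
  0 <= L -> lip3 L F1 -> lip3 L F2 ->
  (forall t, is_derive x t (F1 t (x t) (y t))) -> (forall t, is_derive y t (F2 t (x t) (y t))) ->
  (forall t, is_derive x' t (F1 t (x' t) (y' t))) ->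
  (forall t, is_derive y' t (F2 t (x' t) (y' t))) ->
  x a = x' a -> y a = y' a -> forall t, x t = x' t /\ y t = y' t.
Proof.
  intros HL HF1 HF2 Hx Hy Hx' Hy' Hxa Hya.
  assert (Hz : forall F, lip3 L F -> forall t u v u' v',
    Rabs (F t u v - F t u' v') <= 0 + L * (Rabs (u - u') + Rabs (v - v'))).
  { intros F HF t u v u' v'. eapply Rle_trans; [apply HF|].
    rewrite Rminus_diag, Rabs_R0. lra. }
  assert (Hfin : forall u v, Rabs (u - v) <= 0 -> u = v).
  { intros u v Huv. apply Rminus_diag_uniq, Rabs_eq_0, Rle_antisym; auto. apply Rabs_pos. }
  assert (Hshift : forall (f df : R -> R) s, is_derive f (a + s) (df (a + s)) ->
     is_derive (fun r => f (a + r)) s (df (a + s))).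
  { intros f df s Hf. replace (df (a + s)) with (scal 1 (df (a + s)))
      by (unfold scal; simpl; unfold mult; simpl; ring).
    apply (is_derive_comp f (fun r => a + r)); auto. auto_derive; auto; ring. }
  intros t. destruct (Rle_dec a t) as [Hat | Hat].
  - destruct (gronwall_system (fun s => x (a + s) - x' (a + s)) (fun s => y (a + s) - y' (a + s))
      (fun s => F1 (a + s) (x (a + s)) (y (a + s)) - F1 (a + s) (x' (a + s)) (y' (a + s)))
      (fun s => F2 (a + s) (x (a + s)) (y (a + s)) - F2 (a + s) (x' (a + s)) (y' (a + s)))
      0 L) with (t := t - a) as [H1 H2]; try lra.
    + rewrite Rplus_0_r; lra.
    + rewrite Rplus_0_r; lra.
    + intros s _. apply (is_derive_minus (V := R_NormedModule)).
      * apply (Hshift x (fun r => F1 r (x r) (y r))); auto.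
      * apply (Hshift x' (fun r => F1 r (x' r) (y' r))); auto.
    + intros s _. apply (is_derive_minus (V := R_NormedModule)).
      * apply (Hshift y (fun r => F2 r (x r) (y r))); auto.
      * apply (Hshift y' (fun r => F2 r (x' r) (y' r))); auto.
    + intros s _. apply Hz; auto.
    + intros s _. apply Hz; auto.
    + rewrite Rmult_0_l in H1, H2. replace (a + (t - a)) with t in * by ring. auto.
  - destruct (gronwall_system (fun s => x (a - s) - x' (a - s)) (fun s => y (a - s) - y' (a - s))
      (fun s => - F1 (a - s) (x (a - s)) (y (a - s)) - - F1 (a - s) (x' (a - s)) (y' (a - s)))
      (fun s => - F2 (a - s) (x (a - s)) (y (a - s)) - - F2 (a - s) (x' (a - s)) (y' (a - s)))
      0 L) with (t := a - t) as [H1 H2]; try lra.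
    + rewrite Rminus_0_r; lra.
    + rewrite Rminus_0_r; lra.
    + intros s _. apply (is_derive_minus (V := R_NormedModule)); apply is_derive_reflect; auto.
    + intros s _. apply (is_derive_minus (V := R_NormedModule)); apply is_derive_reflect; auto.
    + intros s _. rewrite <- Rabs_Ropp.
      match goal with |- Rabs ?u <= _ => match u with - (- ?p - - ?q) => 
        replace u with (p - q) by ring end end. apply Hz; auto.
    + intros s _. rewrite <- Rabs_Ropp.
      match goal with |- Rabs ?u <= _ => match u with - (- ?p - - ?q) => 
        replace u with (p - q) by ring end end. apply Hz; auto.
    + rewrite Rmult_0_l in H1, H2. replace (a - (a - t)) with t in * by ring. auto.
Qed.

(** By the symmetry of the right-hand side, (x (T - t), - y (T - t)) is again a solution. It agrees
    with (x, y) at T / 2 because y vanishes there, and uniqueness concludes. *)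
Lemma ode_reflection (F1 F2 : R -> R -> R -> R) (L T : R) (x y : R -> R) :
  0 <= L -> lip3 L F1 -> lip3 L F2 ->
  (forall t u v, F1 (T - t) u (- v) = - F1 t u v) ->
  (forall t u v, F2 (T - t) u (- v) = F2 t u v) ->
  (forall t, is_derive x t (F1 t (x t) (y t))) -> (forall t, is_derive y t (F2 t (x t) (y t))) ->
  y (T / 2) = 0 -> forall t, x (T - t) = x t /\ y (T - t) = - y t.
Proof.
  intros HL HF1 HF2 S1 S2 Hx Hy H0 t.
  destruct (ode_unique F1 F2 L (T / 2) x y (fun s => x (T - s)) (fun s => - y (T - s)))
    with (t := t) as [E1 E2]; auto.
  - intros s. rewrite <- (Ropp_involutive (F1 s _ _)).
    apply is_derive_reflect. rewrite <- S1, Ropp_involutive. apply Hx.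
  - intros s. replace (F2 s (x (T - s)) (- y (T - s))) with (- - F2 (T - s) (x (T - s)) (y (T - s))).
    + apply (is_derive_opp (V := R_NormedModule)). apply is_derive_reflect. apply Hy.
    + rewrite Ropp_involutive, <- (S2 s), Ropp_involutive. reflexivity.
  - f_equal; lra.
  - replace (T - T / 2) with (T / 2) by lra. rewrite H0; ring.
  - split; [auto | rewrite E2; ring].
Qed.

(** * Bounded Lipschitz functions and the normal-graph equation *)

(* Here [nu = 1/n], [e = R/n], [c = cos sigma], [s = sin sigma] with [sigma = (1 - nu) t]:
   [vel = |U'|], [kap] is the rotation rate of U', [rad = |U + f N|], [(G1, G2)] is the right-hand side
   of the system for [(f, p)], and [dwid] is the time derivative of [wid] along it. *)
Definition vsq (c e : R) : R := 1 + 2 * e * c + e * e.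
Definition vel (c e : R) : R := sqrt (vsq c e).
Definition kap (nu c e : R) : R := (1 + e * (1 + nu) * c + e * e * nu) / vsq c e.
Definition wid (nu c e f : R) : R := vel c e - kap nu c e * f.
Definition rad (c s e r f : R) : R :=
  sqrt ((r - e * (f / vel c e) + (1 - f / vel c e) * c) ^ 2 + ((1 - f / vel c e) * s) ^ 2).
Definition G1 (nu c e f p : R) : R := wid nu c e f * p.
Definition G2 (h : R -> R) (nu c s e r f p : R) : R :=
  wid nu c e f * h (rad c s e r f) * (sqrt (1 + p * p) * (1 + p * p)) - kap nu c e * (1 + p * p).
Definition dwid (nu c s e f p : R) : R :=
  - ((1 - nu) * e * s / vel c e)
  - (1 - nu) * (1 - nu) * e * s * (1 - e * e) / (vsq c e * vsq c e) * f
  - kap nu c e * G1 nu c e f p.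

(** One constant serves both as sup bound and as Lipschitz constant, so products stay in the class
    at the cost of a factor 2. The index set is abstract: it is instantiated with time along a
    trajectory and with the quadruples (t, x, y, r). *)
Definition bl {X : Type} (P : X -> Prop) (d : X -> X -> R) (K : R) (f : X -> R) : Prop :=
  (forall x, P x -> Rabs (f x) <= K) /\
  (forall x y, P x -> P y -> Rabs (f x - f y) <= K * d x y).

Section BoundedLipschitz.
Context {X : Type} (P : X -> Prop) (d : X -> X -> R) (Hd : forall x y, 0 <= d x y).
Implicit Types f g : X -> R.

Lemma bl_le K K' f : bl P d K f -> K <= K' -> bl P d K' f.
Proof.
  intros [H1 H2] HK. split.
  - intros x Px. specialize (H1 x Px). lra.
  - intros x y Px Py. specialize (H2 x y Px Py). specialize (Hd x y). nra.
Qed.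

Lemma bl_ext K f g : bl P d K f -> (forall x, P x -> f x = g x) -> bl P d K g.
Proof.
  intros [H1 H2] He. split; intros; rewrite <- !He; auto.
Qed.

Lemma bl_const k K : Rabs k <= K -> bl P d K (fun _ => k).
Proof.
  intros H. split; auto. intros x y _ _. rewrite Rminus_diag, Rabs_R0.
  apply Rmult_le_pos; auto. generalize (Rabs_pos k); lra.
Qed.

Lemma bl_plus K1 K2 f g : bl P d K1 f -> bl P d K2 g -> bl P d (K1 + K2) (fun x => f x + g x).
Proof.
  intros [F1 F2] [G1 G2]. split.
  - intros x Px. specialize (F1 x Px). specialize (G1 x Px).
    eapply Rle_trans; [apply Rabs_triang|]. lra.
  - intros x y Px Py. specialize (F2 x y Px Py). specialize (G2 x y Px Py).
    replace (f x + g x - (f y + g y)) with ((f x - f y) + (g x - g y)) by ring.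
    eapply Rle_trans; [apply Rabs_triang|]. lra.
Qed.

Lemma bl_opp K f : bl P d K f -> bl P d K (fun x => - f x).
Proof.
  intros [F1 F2]. split.
  - intros x Px. rewrite Rabs_Ropp; auto.
  - intros x y Px Py. replace (- f x - - f y) with (- (f x - f y)) by ring.
    rewrite Rabs_Ropp; auto.
Qed.

Lemma bl_mult K1 K2 f g : bl P d K1 f -> bl P d K2 g -> bl P d (2 * K1 * K2) (fun x => f x * g x).
Proof.
  intros [F1 F2] [G1 G2]. split.
  - intros x Px. specialize (F1 x Px). specialize (G1 x Px). rewrite Rabs_mult.
    generalize (Rabs_pos (f x)) (Rabs_pos (g x)). intros.
    apply Rle_trans with (K1 * K2); [apply Rmult_le_compat; auto|].
    assert (0 <= K1 * K2) by (apply Rmult_le_pos; lra). lra.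
  - intros x y Px Py. specialize (F2 x y Px Py). specialize (G2 x y Px Py).
    specialize (F1 x Px). specialize (G1 y Py). specialize (Hd x y).
    replace (f x * g x - f y * g y) with (f x * (g x - g y) + (f x - f y) * g y) by ring.
    eapply Rle_trans; [apply Rabs_triang|]. rewrite !Rabs_mult.
    generalize (Rabs_pos (f x)) (Rabs_pos (g y)) (Rabs_pos (g x - g y)) (Rabs_pos (f x - f y)).
    intros.
    replace (2 * K1 * K2 * d x y) with (K1 * (K2 * d x y) + (K1 * d x y) * K2) by ring.
    apply Rplus_le_compat; apply Rmult_le_compat; auto.
Qed.

Lemma bl_inv m K f : 0 < m -> (forall x, P x -> m <= f x) -> bl P d K f ->
  bl P d (/ m + K / (m * m)) (fun x => / f x).
Proof.
  intros Hm Hf [F1 F2].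
  assert (Hi : forall x, P x -> 0 < / f x <= / m).
  { intros x Px. specialize (Hf x Px). split; [apply Rinv_0_lt_compat; lra|].
    apply Rinv_le_contravar; lra. }
  assert (Hm' : 0 < / m) by (apply Rinv_0_lt_compat; lra).
  split.
  - intros x Px. specialize (Hi x Px). specialize (F1 x Px). generalize (Rabs_pos (f x)).
    intros. rewrite Rabs_pos_eq by lra.
    assert (0 <= K / (m * m)) by (apply Rdiv_le_0_compat; nra). lra.
  - intros x y Px Py. specialize (F2 x y Px Py).
    assert (Ix := Hi x Px). assert (Iy := Hi y Py).
    assert (Mx := Hf x Px). assert (My := Hf y Py).
    replace (/ f x - / f y) with ((f y - f x) * (/ f x * / f y)) by (field; lra).
    rewrite Rabs_mult, (Rabs_minus_sym (f y)), (Rabs_pos_eq (/ f x * / f y)) by nra.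
    apply Rle_trans with (K * d x y * (/ m * / m)).
    + apply Rmult_le_compat; auto; [apply Rabs_pos | nra|].
      apply Rmult_le_compat; lra.
    + specialize (Hd x y). replace ((/ m + K / (m * m)) * d x y)
        with (/ m * d x y + K * d x y * (/ m * / m)) by (field; lra). nra.
Qed.

(** The lower bound 1/4 gives sqrt (f x) + sqrt (f y) >= 1, so the square root does not increase
    differences. *)
Lemma bl_sqrt K f : (forall x, P x -> 1 / 4 <= f x) -> bl P d K f ->
  bl P d (K + 1) (fun x => sqrt (f x)).
Proof.
  intros Hf [F1 F2].
  assert (Hs : forall x, P x -> 1/2 <= sqrt (f x) /\ sqrt (f x) * sqrt (f x) = f x).
  { intros x Px. specialize (Hf x Px). split; [|apply sqrt_sqrt; lra].
    rewrite <- (sqrt_square (1/2)) by lra. apply sqrt_le_1_alt. lra. }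
  split.
  - intros x Px. destruct (Hs x Px) as [S1 S2]. specialize (F1 x Px).
    rewrite Rabs_pos_eq by lra. apply Rabs_le_between in F1. nra.
  - intros x y Px Py. destruct (Hs x Px) as [S1 S2]. destruct (Hs y Py) as [T1 T2].
    specialize (F2 x y Px Py). specialize (Hd x y).
    assert (Rabs (f x - f y) = Rabs (sqrt (f x) - sqrt (f y)) * (sqrt (f x) + sqrt (f y))).
    { assert (E : (sqrt (f x) - sqrt (f y)) * (sqrt (f x) + sqrt (f y))
                  = sqrt (f x) * sqrt (f x) - sqrt (f y) * sqrt (f y)) by ring.
      replace (f x - f y) with ((sqrt (f x) - sqrt (f y)) * (sqrt (f x) + sqrt (f y))) by lra.
      rewrite Rabs_mult, (Rabs_pos_eq (sqrt (f x) + sqrt (f y))) by lra. reflexivity. }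
    generalize (Rabs_pos (sqrt (f x) - sqrt (f y))). nra.
Qed.

End BoundedLipschitz.

(** * Bounds on the geometric coefficients *)

Lemma vsq_bounds c e : -1 <= c <= 1 -> - (1/16) <= e <= 1/16 -> 7/8 <= vsq c e <= 5/4.
Proof. intros. unfold vsq. split; nra. Qed.

Lemma vel_bounds c e : -1 <= c <= 1 -> - (1/16) <= e <= 1/16 ->
  15/16 <= vel c e <= 17/16 /\ vel c e * vel c e = vsq c e.
Proof.
  intros Hc He. generalize (vsq_bounds c e Hc He). intros Hv.
  assert (H : vel c e * vel c e = vsq c e) by (apply sqrt_sqrt; lra).
  assert (0 <= vel c e) by apply sqrt_pos.
  split; auto.
  assert (225/256 <= vsq c e <= 289/256).
  { unfold vsq. destruct (Rle_dec 0 e) as [E | E].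
    - assert (- e <= e * c <= e) by (split; nra). split; nra.
    - assert (e <= e * c <= - e) by (split; nra). split; nra. }
  split; nra.
Qed.

Lemma kap_bounds nu c e : 0 <= nu <= 1 -> -1 <= c <= 1 -> - (1/16) <= e <= 1/16 ->
  3/4 <= kap nu c e <= 5/4.
Proof.
  intros Hn Hc He. generalize (vsq_bounds c e Hc He). intros Hv. 
  assert (Hk : kap nu c e * vsq c e = 1 + e * (1 + nu) * c + e * e * nu)
    by (unfold kap; field; lra).
  assert (-(1/16) <= e * c <= 1/16) by (split; nra).
  assert (0 <= e * e <= 1/256) by (split; nra).
  assert (-(1/16) <= e * c * nu <= 1/16) by (split; nra).
  assert (0 <= e * e * nu <= 1/256) by (split; nra).
  unfold vsq in *. split; nra.
Qed.

(** Positivity of [wid] is what keeps the normal graph a regular curve. *)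
Lemma wid_bounds nu c e f : 0 <= nu <= 1 -> -1 <= c <= 1 -> - (1/16) <= e <= 1/16 ->
  -(1/2) <= f <= 1/2 -> 1/4 <= wid nu c e f <= 2.
Proof.
  intros. generalize (vel_bounds c e ltac:(auto) ltac:(auto)) (kap_bounds nu c e ltac:(auto) ltac:(auto) ltac:(auto)).
  intros. unfold wid. split; nra.
Qed.

Lemma norm_lipschitz a b a' b' :
  Rabs (sqrt (a ^ 2 + b ^ 2) - sqrt (a' ^ 2 + b' ^ 2)) <= Rabs (a - a') + Rabs (b - b').
Proof.
  assert (Hone : forall a b a' b', sqrt (a ^ 2 + b ^ 2) <= sqrt (a' ^ 2 + b' ^ 2) + (Rabs (a - a') + Rabs (b - b'))).
  { clear. intros a b a' b'.
    generalize (Cmod_triangle (a', b') (a - a', b - b')%R).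
    unfold Cplus, Cmod; simpl fst; simpl snd.
    replace (a' + (a - a')) with a by ring. replace (b' + (b - b')) with b by ring.
    intros H. eapply Rle_trans; [exact H|]. apply Rplus_le_compat_l.
    generalize (Rabs_pos (a - a')) (Rabs_pos (b - b')). intros Ha Hb.
    rewrite <- (sqrt_square (Rabs (a - a') + Rabs (b - b'))) by lra.
    apply sqrt_le_1_alt. rewrite <- (pow2_abs (a - a')), <- (pow2_abs (b - b')). nra. }
  generalize (Hone a b a' b') (Hone a' b' a b).
  rewrite (Rabs_minus_sym a' a), (Rabs_minus_sym b' b). intros. apply Rabs_le. lra.
Qed.

Lemma rad_lower c s e r f : -1 <= c <= 1 -> - (1/16) <= e <= 1/16 -> -(1/2) <= f <= 1/2 ->
  10 <= r -> r / 2 <= rad c s e r f.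
Proof.
  intros Hc He Hf Hr. destruct (vel_bounds c e Hc He) as [Hv _].
  unfold rad. set (g := f / vel c e).
  assert (Hg : g * vel c e = f) by (unfold g; field; lra).
  assert (-1 <= g <= 1) by (split; nra).
  assert (- (1/16) <= e * g <= 1/16) by (split; nra).
  assert (-2 <= (1 - g) * c <= 2) by (split; nra).
  rewrite <- (sqrt_pow2 (r / 2)) by lra. apply sqrt_le_1_alt.
  generalize (pow2_ge_0 ((1 - g) * s)). nra.
Qed.

(** The half-line starts at r0 / 2 because, by [rad_lower], the perturbed curve stays at least that
    far from the origin. A single q suffices since h - 1 and h' are both O(s^-gamma). *)
Definition near_one (h : R -> R) (q r0 : R) : Prop :=
  forall s s', r0 / 2 <= s -> r0 / 2 <= s' ->
    Rabs (h s - 1) <= q /\ Rabs (h s - h s') <= q * Rabs (s - s').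


(** The profile and all the variables are bundled so that [ubl] and [usm] below are properties of
    functions of the state, with constants that cannot depend on [vh], [vnu] or [vr]. *)
Record state : Type := State { vh : R -> R; vnu : R; vc : R; vs : R; ve : R; vr : R; vf : R; vp : R }.

(** [ve], [vf] and [vp] are the small variables. The radius [vr] is unbounded, so only a lower bound
    and a Lipschitz constant are recorded for it; [vh] and [vnu] are constant along the family. *)
Record admissible {X : Type} (P : X -> Prop) (d : X -> X -> R) (q r0 : R) (E : X -> state) : Prop := {
  ad_d : forall x y, 0 <= d x y;
  ad_q : 0 <= q <= 1/2;
  ad_nu : exists nu, 0 <= nu <= 1 /\ forall x, vnu (E x) = nu;
  ad_r0 : 10 <= r0;
  ad_h : exists h, near_one h q r0 /\ forall x, vh (E x) = h;
  ad_c : bl P d 1 (fun x => vc (E x));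
  ad_s : bl P d 1 (fun x => vs (E x));
  ad_e : bl P d q (fun x => ve (E x));
  ad_f : bl P d q (fun x => vf (E x));
  ad_p : bl P d q (fun x => vp (E x));
  ad_e16 : forall x, P x -> - (1/16) <= ve (E x) <= 1/16;
  ad_r : forall x, P x -> r0 <= vr (E x);
  ad_rlip : forall x y, P x -> P y -> Rabs (vr (E x) - vr (E y)) <= d x y
}.

Definition in_range (w : state) : Prop :=
  0 <= vnu w <= 1 /\ -1 <= vc w <= 1 /\ -1 <= vs w <= 1 /\ - (1/16) <= ve w <= 1/16 /\
  10 <= vr w /\ -(1/2) <= vf w <= 1/2 /\ -(1/2) <= vp w <= 1/2.

Lemma admissible_range {X : Type} (P : X -> Prop) d q r0 (E : X -> state) :
  admissible P d q r0 E -> forall x, P x -> in_range (E x).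
Proof.
  intros [_ Hq [nu [Hnu Hn]] Hr0 _ Hc Hs _ Hf Hp He Hr _] x Px. unfold in_range. rewrite Hn.
  split; [auto|]. split; [|split; [|split; [|split; [|split]]]]; auto.
  - apply Rabs_le_between, (proj1 Hc x Px).
  - apply Rabs_le_between, (proj1 Hs x Px).
  - specialize (Hr x Px). lra.
  - apply Rabs_le_between. generalize (proj1 Hf x Px). lra.
  - apply Rabs_le_between. generalize (proj1 Hp x Px). lra.
Qed.

(* [ubl F]: F is bounded and Lipschitz with a universal constant along any admissible family of
   states; [usm F]: moreover both constants are O(q). *)
Definition ubl (F : state -> R) : Prop :=
  exists K, 0 <= K /\ forall (X : Type) (P : X -> Prop) d q r0 (E : X -> state),
    admissible P d q r0 E -> bl P d K (fun x => F (E x)).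
Definition usm (F : state -> R) : Prop :=
  exists C, 0 <= C /\ forall (X : Type) (P : X -> Prop) d q r0 (E : X -> state),
    admissible P d q r0 E -> bl P d (C * q) (fun x => F (E x)).

Lemma usm_ubl F : usm F -> ubl F.
Proof.
  intros [C [HC H]]. exists C. split; auto. intros X P d q r0 E A.
  apply bl_le with (C * q); [apply A | apply (H X P d q r0 E A) |].
  generalize (ad_q _ _ _ _ _ A). nra.
Qed.

Lemma usm_ext F G : usm F -> (forall w, in_range w -> F w = G w) -> usm G.
Proof.
  intros [K [HK H]] He. exists K. split; auto. intros X P d q r0 E A.
  apply bl_ext with (fun x => F (E x)); [apply (H X P d q r0 E A)|].
  intros x Px. apply He, (admissible_range _ _ _ _ _ A x Px).
Qed.

Lemma ubl_const k : ubl (fun _ => k).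
Proof.
  exists (Rabs k). split; [apply Rabs_pos|]. intros X P d q r0 E A.
  apply bl_const; [apply A | apply Rle_refl].
Qed.

Lemma ubl_nu : ubl vnu.
Proof.
  exists 1. split; [lra|]. intros X P d q r0 E A. destruct (ad_nu _ _ _ _ _ A) as [nu [Hnu Hn]].
  apply bl_ext with (fun _ => nu); [|intros; symmetry; auto].
  apply bl_const; [apply A | rewrite Rabs_pos_eq; lra].
Qed.

Lemma ubl_c : ubl vc.
Proof. exists 1. split; [lra|]. intros X P d q r0 E A. apply A. Qed.

Lemma ubl_s : ubl vs.
Proof. exists 1. split; [lra|]. intros X P d q r0 E A. apply A. Qed.

Lemma usm_e : usm ve.
Proof. exists 1. split; [lra|]. intros X P d q r0 E A. rewrite Rmult_1_l. apply A. Qed.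

Lemma usm_f : usm vf.
Proof. exists 1. split; [lra|]. intros X P d q r0 E A. rewrite Rmult_1_l. apply A. Qed.

Lemma usm_p : usm vp.
Proof. exists 1. split; [lra|]. intros X P d q r0 E A. rewrite Rmult_1_l. apply A. Qed.

Lemma ubl_plus F G : ubl F -> ubl G -> ubl (fun w => F w + G w).
Proof.
  intros [K [HK H]] [K' [HK' H']]. exists (K + K'). split; [lra|]. intros X P d q r0 E A.
  apply bl_plus; eauto.
Qed.

Lemma ubl_opp F : ubl F -> ubl (fun w => - F w).
Proof.
  intros [K [HK H]]. exists K. split; [lra|]. intros X P d q r0 E A. apply bl_opp; eauto.
Qed.

Lemma ubl_minus F G : ubl F -> ubl G -> ubl (fun w => F w - G w).
Proof. intros HF HG. apply ubl_plus; auto. apply ubl_opp; auto. Qed.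

Lemma ubl_mult F G : ubl F -> ubl G -> ubl (fun w => F w * G w).
Proof.
  intros [K [HK H]] [K' [HK' H']]. exists (2 * K * K'). split.
  - assert (0 <= K * K') by (apply Rmult_le_pos; auto). lra.
  - intros X P d q r0 E A. apply bl_mult; eauto. apply A.
Qed.

Lemma ubl_inv F m : 0 < m -> (forall w, in_range w -> m <= F w) -> ubl F -> ubl (fun w => / F w).
Proof.
  intros Hm HF [K [HK H]]. exists (/ m + K / (m * m)). split.
  - assert (0 < / m) by (apply Rinv_0_lt_compat; auto).
    assert (0 <= K / (m * m)) by (apply Rdiv_le_0_compat; nra). lra.
  - intros X P d q r0 E A. apply bl_inv; eauto; [apply A|].
    intros x Px. apply HF, (admissible_range _ _ _ _ _ A x Px).
Qed.

Lemma ubl_div F G m : 0 < m -> (forall w, in_range w -> m <= G w) -> ubl F -> ubl G ->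
  ubl (fun w => F w / G w).
Proof. intros Hm HG HF HG'. apply ubl_mult; auto. apply ubl_inv with m; auto. Qed.

Lemma ubl_sqrt F : (forall w, in_range w -> 1/4 <= F w) -> ubl F -> ubl (fun w => sqrt (F w)).
Proof.
  intros HF [K [HK H]]. exists (K + 1). split; [lra|].
  intros X P d q r0 E A. apply bl_sqrt; eauto; [apply A|].
  intros x Px. apply HF, (admissible_range _ _ _ _ _ A x Px).
Qed.

Lemma usm_plus F G : usm F -> usm G -> usm (fun w => F w + G w).
Proof.
  intros [K [HK H]] [K' [HK' H']]. exists (K + K'). split; [lra|]. intros X P d q r0 E A.
  rewrite Rmult_plus_distr_r. apply bl_plus; eauto.
Qed.

Lemma usm_opp F : usm F -> usm (fun w => - F w).
Proof.
  intros [K [HK H]]. exists K. split; [lra|]. intros X P d q r0 E A. apply bl_opp; eauto.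
Qed.

Lemma usm_minus F G : usm F -> usm G -> usm (fun w => F w - G w).
Proof. intros HF HG. apply usm_plus; auto. apply usm_opp; auto. Qed.

Lemma usm_mult_l F G : usm F -> ubl G -> usm (fun w => F w * G w).
Proof.
  intros [K [HK H]] [K' [HK' H']]. exists (2 * K * K'). split.
  - assert (0 <= K * K') by (apply Rmult_le_pos; auto). lra.
  - intros X P d q r0 E A. replace (2 * K * K' * q) with (2 * (K * q) * K') by ring.
    apply bl_mult; eauto. apply A.
Qed.

Lemma usm_mult_r F G : ubl F -> usm G -> usm (fun w => F w * G w).
Proof.
  intros HF HG. apply usm_ext with (fun w => G w * F w); [|intros; ring].
  apply usm_mult_l; auto.
Qed.

Lemma ubl_vsq : ubl (fun w => vsq (vc w) (ve w)).
Proof.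
  unfold vsq. generalize ubl_c (usm_ubl _ usm_e). intros.
  repeat (apply ubl_plus || apply ubl_mult || apply ubl_const || assumption).
Qed.

Lemma ubl_vel : ubl (fun w => vel (vc w) (ve w)).
Proof.
  apply ubl_sqrt; [|apply ubl_vsq].
  intros w (_ & Hc & _ & He & _). generalize (vsq_bounds _ _ Hc He). lra.
Qed.

Lemma ubl_kap : ubl (fun w => kap (vnu w) (vc w) (ve w)).
Proof.
  unfold kap. apply ubl_div with (7/8); [lra | | | apply ubl_vsq].
  - intros w (_ & Hc & _ & He & _). generalize (vsq_bounds _ _ Hc He). lra.
  - generalize ubl_c (usm_ubl _ usm_e) ubl_nu. intros.
    repeat (apply ubl_plus || apply ubl_mult || apply ubl_const || assumption).
Qed.

Lemma ubl_wid : ubl (fun w => wid (vnu w) (vc w) (ve w) (vf w)).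
Proof.
  apply ubl_minus; [apply ubl_vel|]. apply ubl_mult; [apply ubl_kap | apply usm_ubl, usm_f].
Qed.

(** The factorisation v^2 - 1 = e (2 c + e) exhibits the small factor e. *)
Lemma usm_vel : usm (fun w => vel (vc w) (ve w) - 1).
Proof.
  apply usm_ext with (fun w => ve w * ((2 * vc w + ve w) / (vel (vc w) (ve w) + 1))).
  - apply usm_mult_l; [apply usm_e|]. apply ubl_div with 1; [lra | | |].
    + intros w (_ & Hc & _ & He & _). generalize (vel_bounds _ _ Hc He). lra.
    + generalize ubl_c (usm_ubl _ usm_e). intros.
      repeat (apply ubl_plus || apply ubl_mult || apply ubl_const || assumption).
    + apply ubl_plus; [apply ubl_vel | apply ubl_const].
  - intros w (_ & Hc & _ & He & _). destruct (vel_bounds _ _ Hc He) as [H1 H2].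
    unfold vsq in H2. set (v := vel _ _) in *.
    replace (ve w * ((2 * vc w + ve w) / (v + 1))) with ((2 * ve w * vc w + ve w * ve w) / (v + 1))
      by (field; lra).
    replace (2 * ve w * vc w + ve w * ve w) with ((v - 1) * (v + 1)) by lra. field; lra.
Qed.

Lemma usm_kap : usm (fun w => kap (vnu w) (vc w) (ve w) - 1).
Proof.
  apply usm_ext with (fun w => ve w * (((vnu w - 1) * (vc w + ve w)) / vsq (vc w) (ve w))).
  - apply usm_mult_l; [apply usm_e|]. apply ubl_div with (7/8); [lra | | | apply ubl_vsq].
    + intros w (_ & Hc & _ & He & _). generalize (vsq_bounds _ _ Hc He). lra.
    + generalize ubl_c (usm_ubl _ usm_e) ubl_nu. intros.
      repeat (apply ubl_plus || apply ubl_minus || apply ubl_mult || apply ubl_const || assumption).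
  - intros w (_ & Hc & _ & He & _). generalize (vsq_bounds _ _ Hc He). intros H.
    unfold kap. assert (vsq (vc w) (ve w) <> 0) by lra. unfold vsq in *. field. auto.
Qed.

(** The factor q comes from [near_one]; it remains to see that [rad] is Lipschitz with a universal
    constant. The unbounded [vr] enters the first component additively, so it is split off from the
    terms covered by [ubl]. *)
Lemma usm_h : usm (fun w => vh w (rad (vc w) (vs w) (ve w) (vr w) (vf w)) - 1).
Proof.
  assert (Hg : ubl (fun w => vf w / vel (vc w) (ve w))).
  { apply ubl_div with (15/16); [lra | | apply usm_ubl, usm_f | apply ubl_vel].
    intros w (_ & Hc & _ & He & _). generalize (vel_bounds _ _ Hc He). lra. }
  assert (He := usm_ubl _ usm_e). assert (Hc := ubl_c). assert (Hs := ubl_s).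
  assert (H1 : ubl (fun w => - (ve w * (vf w / vel (vc w) (ve w)))
                     + (1 - vf w / vel (vc w) (ve w)) * vc w)).
  { apply ubl_plus; [apply ubl_opp, ubl_mult; auto|].
    apply ubl_mult; auto. apply ubl_minus; auto. apply ubl_const. }
  assert (H2 : ubl (fun w => (1 - vf w / vel (vc w) (ve w)) * vs w)).
  { apply ubl_mult; auto. apply ubl_minus; auto. apply ubl_const. }
  clear Hg He Hc Hs. destruct H1 as [K1 [HK1 H1]]. destruct H2 as [K2 [HK2 H2]].
  exists (1 + K1 + K2). split; [lra|]. intros X P d q r0 E A.
  specialize (H1 X P d q r0 E A). specialize (H2 X P d q r0 E A).
  assert (Hr := admissible_range _ _ _ _ _ A).
  destruct (ad_h _ _ _ _ _ A) as [h [Hh Eh]]. assert (Hq := ad_q _ _ _ _ _ A).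
  assert (Hl : forall x, P x -> r0 / 2 <= rad (vc (E x)) (vs (E x)) (ve (E x)) (vr (E x)) (vf (E x))).
  { intros x Px. assert (B := ad_r _ _ _ _ _ A x Px). destruct (Hr x Px) as (_ & B1 & _ & B2 & B3 & B4 & _).
    generalize (rad_lower _ (vs (E x)) _ _ _ B1 B2 B4 B3). lra. }
  split.
  - intros x Px. rewrite Eh. destruct (Hh _ _ (Hl x Px) (Hl x Px)) as [B _].
    assert (0 <= K1 * q) by nra. assert (0 <= K2 * q) by nra. lra.
  - intros x y Px Py. rewrite !Eh.
    destruct (Hh _ _ (Hl x Px) (Hl y Py)) as [_ B].
    match goal with |- Rabs (?a - 1 - (?b - 1)) <= _ => replace (a - 1 - (b - 1)) with (a - b) by ring end.
    eapply Rle_trans; [exact B|].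
    replace ((1 + K1 + K2) * q * d x y) with (q * ((1 + K1 + K2) * d x y)) by ring.
    apply Rmult_le_compat_l; [lra|]. unfold rad. eapply Rle_trans; [apply norm_lipschitz|].
    assert (C1 := proj2 H1 x y Px Py). assert (C2 := proj2 H2 x y Px Py).
    assert (C3 := ad_rlip _ _ _ _ _ A x y Px Py). simpl in C1, C2.
    apply Rle_trans with (Rabs (vr (E x) - vr (E y)) + K1 * d x y + K2 * d x y); [|lra].
    apply Rplus_le_compat; [|exact C2].
    eapply Rle_trans; [|apply Rplus_le_compat_l, C1].
    eapply Rle_trans; [|apply Rabs_triang]. right. f_equal. ring.
Qed.

Lemma usm_G1 : usm (fun w => G1 (vnu w) (vc w) (ve w) (vf w) (vp w)).
Proof. apply usm_mult_r; [apply ubl_wid | apply usm_p]. Qed.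

Lemma ubl_pp : ubl (fun w => 1 + vp w * vp w).
Proof.
  assert (Hp := usm_ubl _ usm_p). apply ubl_plus; [apply ubl_const | apply ubl_mult; auto].
Qed.

Lemma ubl_sp : ubl (fun w => sqrt (1 + vp w * vp w)).
Proof. apply ubl_sqrt; [|apply ubl_pp]. intros w _. generalize (Rle_0_sqr (vp w)). unfold Rsqr. lra. Qed.

Lemma usm_G2 :
  usm (fun w => G2 (vh w) (vnu w) (vc w) (vs w) (ve w) (vr w) (vf w) (vp w)).
Proof.
  (* At e = f = p = 0 and h = 1 the two terms of [G2] both equal 1 and cancel. The rewriting groups
     the deviations so that every summand carries a small factor: vel - 1, kap - 1, f, h - 1 or p,
     with sqrt (1 + p^2) - 1 = p^2 / (sqrt (1 + p^2) + 1). *)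
  apply usm_ext with (fun w =>
    (vel (vc w) (ve w) - 1) - (kap (vnu w) (vc w) (ve w) - 1) - kap (vnu w) (vc w) (ve w) * vf w
    + wid (vnu w) (vc w) (ve w) (vf w) *
      ((vh w (rad (vc w) (vs w) (ve w) (vr w) (vf w)) - 1) * (sqrt (1 + vp w * vp w) * (1 + vp w * vp w))
       + (vp w * (vp w / (sqrt (1 + vp w * vp w) + 1)) + vp w * (sqrt (1 + vp w * vp w) * vp w)))
    - vp w * (kap (vnu w) (vc w) (ve w) * vp w)).
  - assert (Hp := usm_ubl _ usm_p). assert (H1 := ubl_kap). assert (H2 := ubl_wid).
    assert (H3 := ubl_pp). assert (H4 := ubl_sp). assert (Hp' := usm_p).
    apply usm_minus; [apply usm_plus; [apply usm_minus; [apply usm_minus|]|]|].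
    + apply usm_vel.
    + apply usm_kap.
    + apply usm_mult_r; auto. apply usm_f.
    + apply usm_mult_r; auto. apply usm_plus; [|apply usm_plus].
      * apply usm_mult_l; [apply usm_h|]. apply ubl_mult; auto.
      * apply usm_mult_l; auto. apply ubl_div with 1; [lra | | auto |].
        -- intros w _. generalize (sqrt_pos (1 + vp w * vp w)). lra.
        -- apply ubl_plus; auto. apply ubl_const.
      * apply usm_mult_l; auto. apply ubl_mult; auto.
    + apply usm_mult_l; auto. apply ubl_mult; auto.
  - intros w _. unfold G2, wid. set (S := sqrt (1 + vp w * vp w)).
    assert (HS : S * S = 1 + vp w * vp w).
    { apply sqrt_sqrt. generalize (Rle_0_sqr (vp w)). unfold Rsqr. lra. }
    assert (0 <= S) by apply sqrt_pos.
    replace (vp w * (vp w / (S + 1))) with (S - 1).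
    + replace (vp w * (S * vp w)) with (S * (vp w * vp w)) by ring.
      replace (vp w * (kap (vnu w) (vc w) (ve w) * vp w))
        with (kap (vnu w) (vc w) (ve w) * (vp w * vp w)) by ring.
      replace (vp w * vp w) with (S * S - 1) by lra. ring.
    + replace (vp w * (vp w / (S + 1))) with ((vp w * vp w) / (S + 1)) by (field; lra).
      replace (vp w * vp w) with ((S - 1) * (S + 1)) by lra. field. lra.
Qed.

(** Since phi' = wid p, this is phi'' along the system. The Lipschitz half of [usm] is what controls
    the Hoelder seminorm of phi''. *)
Lemma usm_second_derivative :
  usm (fun w => dwid (vnu w) (vc w) (vs w) (ve w) (vf w) (vp w) * vp w
    + wid (vnu w) (vc w) (ve w) (vf w) * G2 (vh w) (vnu w) (vc w) (vs w) (ve w) (vr w) (vf w) (vp w)).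
Proof.
  apply usm_plus.
  - apply usm_mult_r; [|apply usm_p].
    assert (Hf := usm_ubl _ usm_f). assert (He := usm_ubl _ usm_e).
    assert (Hn := ubl_nu). assert (Hs := ubl_s).
    assert (H1 : ubl (fun w => 1 - vnu w)) by (apply ubl_minus; auto; apply ubl_const).
    unfold dwid. apply ubl_minus; [apply ubl_minus|].
    + apply ubl_opp. apply ubl_div with (15/16); [lra | | | apply ubl_vel].
      * intros w (_ & Hc & _ & Hee & _). generalize (vel_bounds _ _ Hc Hee). lra.
      * repeat (apply ubl_mult; auto).
    + apply ubl_mult; auto. apply ubl_div with ((7/8) * (7/8)); [lra | | |].
      * intros w (_ & Hc & _ & Hee & _). generalize (vsq_bounds _ _ Hc Hee). nra.
      * repeat (apply ubl_mult; auto). apply ubl_minus; [apply ubl_const|]. apply ubl_mult; auto.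
      * apply ubl_mult; apply ubl_vsq.
    + apply ubl_mult; [apply ubl_kap | apply usm_ubl, usm_G1].
  - apply usm_mult_r; [apply ubl_wid | apply usm_G2].
Qed.

(** * Solutions of the clamped system *)

Definition clamp (x : R) : R := Rmax (- (1/2)) (Rmin x (1/2)).

Lemma clamp_bound x : Rabs (clamp x) <= 1/2.
Proof.
  unfold clamp. apply Rabs_le. unfold Rmax, Rmin. repeat destruct Rle_dec; lra.
Qed.

Lemma clamp_lipschitz x y : Rabs (clamp x - clamp y) <= Rabs (x - y).
Proof.
  unfold clamp, Rmax, Rmin, Rabs.
  repeat destruct Rle_dec; repeat destruct Rcase_abs; lra.
Qed.

(** Oddness lets the clamped system keep the reflection symmetry of the original one. *)
Lemma clamp_opp x : clamp (- x) = - clamp x.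
Proof. unfold clamp, Rmax, Rmin. repeat destruct Rle_dec; lra. Qed.

Lemma clamp_id x : Rabs x <= 1/2 -> clamp x = x.
Proof.
  intros H. apply Rabs_le_between in H. unfold clamp, Rmax, Rmin. repeat destruct Rle_dec; lra.
Qed.

Lemma cos_lipschitz x y : Rabs (cos x - cos y) <= Rabs (x - y).
Proof.
  rewrite <- (Rmult_1_l (Rabs (x - y))).
  apply (deriv_bounded_lipschitz cos (fun t => - sin t) 1 (fun _ => True)); auto.
  - intros t _. auto_derive; auto; ring.
  - intros t _. generalize (SIN_bound t). intros; apply Rabs_le; lra.
Qed.

Lemma sin_lipschitz x y : Rabs (sin x - sin y) <= Rabs (x - y).
Proof.
  rewrite <- (Rmult_1_l (Rabs (x - y))).
  apply (deriv_bounded_lipschitz sin cos 1 (fun _ => True)); auto.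
  - intros t _. auto_derive; auto; ring.
  - intros t _. generalize (COS_bound t). intros; apply Rabs_le; lra.
Qed.

Definition state_at (h : R -> R) (nu r t f p : R) : state :=
  State h nu (cos ((1 - nu) * t)) (sin ((1 - nu) * t)) (r * nu) r f p.

Definition G1s (w : state) : R := G1 (vnu w) (vc w) (ve w) (vf w) (vp w).
Definition G2s (w : state) : R := G2 (vh w) (vnu w) (vc w) (vs w) (ve w) (vr w) (vf w) (vp w).
Definition G3s (w : state) : R :=
  dwid (vnu w) (vc w) (vs w) (ve w) (vf w) (vp w) * vp w
  + wid (vnu w) (vc w) (ve w) (vf w) * G2s w.

(* Clamping makes the right-hand side bounded and globally Lipschitz; the solutions that matter
   never reach the clamp. *)
Definition F1 h nu r t x y := G1s (state_at h nu r t (clamp x) (clamp y)).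
Definition F2 h nu r t x y := G2s (state_at h nu r t (clamp x) (clamp y)).

Lemma near_one_le h q q' r0 : near_one h q r0 -> q <= q' -> near_one h q' r0.
Proof.
  intros H Hq s s' Hs Hs'. destruct (H s s' Hs Hs') as [H1 H2]. split; [lra|].
  generalize (Rabs_pos (s - s')). nra.
Qed.

Lemma angle_lipschitz nu s t : 0 <= nu <= 1 ->
  Rabs ((1 - nu) * s - (1 - nu) * t) <= Rabs (s - t).
Proof.
  intros Hn. rewrite <- Rmult_minus_distr_l, Rabs_mult, (Rabs_pos_eq (1 - nu)) by lra.
  generalize (Rabs_pos (s - t)). nra.
Qed.

Lemma parameter_lipschitz (G : state -> R) : usm G -> exists L, 0 < L /\
  forall h nu r0, 0 <= nu <= 1 -> 10 <= r0 -> near_one h (1/2) r0 ->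
  forall r r', r0 <= r -> r0 <= r' -> r * nu <= 1/16 -> r' * nu <= 1/16 ->
  forall t x y t' x' y',
    Rabs (G (state_at h nu r t (clamp x) (clamp y))) <= L /\
    Rabs (G (state_at h nu r t (clamp x) (clamp y)) - G (state_at h nu r' t' (clamp x') (clamp y')))
    <= L * (Rabs (t - t') + Rabs (x - x') + Rabs (y - y') + Rabs (r - r')).
Proof.
  intros HG. destruct (usm_ubl _ HG) as [K [HK H]]. exists (2 * K + 1). split; [lra|].
  intros h nu r0 Hnu Hr0 Hh r r' Hr Hr' Hre Hre' t x y t' x' y'.
  (* No smallness is available here, so q takes its largest admissible value 1/2; the factor 2 in d
     makes the coordinates Lipschitz with constant 1/2. *)
  set (d := fun z z' : R * R * R * R =>
    2 * (Rabs (fst (fst (fst z)) - fst (fst (fst z'))) + Rabs (snd (fst (fst z)) - snd (fst (fst z')))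
         + Rabs (snd (fst z) - snd (fst z')) + Rabs (snd z - snd z'))).
  set (P := fun z : R * R * R * R => r0 <= snd z /\ snd z * nu <= 1/16).
  assert (B : bl P d K (fun z => G (state_at h nu (snd z) (fst (fst (fst z)))
                 (clamp (snd (fst (fst z)))) (clamp (snd (fst z)))))).
  { assert (Hpos : forall a b c e, 0 <= Rabs a + Rabs b + Rabs c + Rabs e).
    { intros. generalize (Rabs_pos a) (Rabs_pos b) (Rabs_pos c) (Rabs_pos e). lra. }
    apply (H _ P d (1/2) r0). constructor.
    - intros z z'. unfold d. apply Rmult_le_pos; [lra | apply Hpos].
    - lra.
    - exists nu; split; auto.
    - auto.
    - exists h; split; auto.
    - split; simpl.
      + intros z _. generalize (COS_bound ((1 - nu) * fst (fst (fst z)))). intros; apply Rabs_le; lra.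
      + intros z z' _ _. eapply Rle_trans; [apply cos_lipschitz|].
        eapply Rle_trans; [apply angle_lipschitz; auto|]. unfold d.
        generalize (Hpos 0 (snd (fst (fst z)) - snd (fst (fst z'))) (snd (fst z) - snd (fst z')) (snd z - snd z')).
        rewrite Rabs_R0. generalize (Rabs_pos (fst (fst (fst z)) - fst (fst (fst z')))). lra.
    - split; simpl.
      + intros z _. generalize (SIN_bound ((1 - nu) * fst (fst (fst z)))). intros; apply Rabs_le; lra.
      + intros z z' _ _. eapply Rle_trans; [apply sin_lipschitz|].
        eapply Rle_trans; [apply angle_lipschitz; auto|]. unfold d.
        generalize (Hpos 0 (snd (fst (fst z)) - snd (fst (fst z'))) (snd (fst z) - snd (fst z')) (snd z - snd z')).
        rewrite Rabs_R0. generalize (Rabs_pos (fst (fst (fst z)) - fst (fst (fst z')))). lra.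
    - split; simpl.
      + intros z [P1 P2]. rewrite Rabs_pos_eq; [lra|]. apply Rmult_le_pos; lra.
      + intros z z' _ _. rewrite <- Rmult_minus_distr_r, Rabs_mult, (Rabs_pos_eq nu) by lra.
        unfold d.
        generalize (Hpos (fst (fst (fst z)) - fst (fst (fst z'))) (snd (fst (fst z)) - snd (fst (fst z'))) (snd (fst z) - snd (fst z')) 0).
        rewrite Rabs_R0. generalize (Rabs_pos (snd z - snd z')). nra.
    - split; simpl.
      + intros z _. apply clamp_bound.
      + intros z z' _ _. eapply Rle_trans; [apply clamp_lipschitz|]. unfold d.
        generalize (Hpos (fst (fst (fst z)) - fst (fst (fst z'))) 0 (snd (fst z) - snd (fst z')) (snd z - snd z')).
        rewrite Rabs_R0. lra.
    - split; simpl.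
      + intros z _. apply clamp_bound.
      + intros z z' _ _. eapply Rle_trans; [apply clamp_lipschitz|]. unfold d.
        generalize (Hpos (fst (fst (fst z)) - fst (fst (fst z'))) (snd (fst (fst z)) - snd (fst (fst z'))) 0 (snd z - snd z')).
        rewrite Rabs_R0. lra.
    - simpl. intros z [P1 P2]. split; [|auto]. 
      apply Rle_trans with 0; [lra|]. apply Rmult_le_pos; lra.
    - simpl. intros z [P1 P2]. auto.
    - simpl. intros z z' _ _. unfold d.
      generalize (Hpos (fst (fst (fst z)) - fst (fst (fst z'))) (snd (fst (fst z)) - snd (fst (fst z'))) (snd (fst z) - snd (fst z')) 0).
      rewrite Rabs_R0. generalize (Rabs_pos (snd z - snd z')). lra. }
  destruct B as [B1 B2].
  specialize (B1 (t, x, y, r) (conj Hr Hre)).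
  specialize (B2 (t, x, y, r) (t', x', y', r') (conj Hr Hre) (conj Hr' Hre')).
  unfold d in B2. simpl in B1, B2. split; [lra|].
  eapply Rle_trans; [exact B2|].
  generalize (Rabs_pos (t - t')) (Rabs_pos (x - x')) (Rabs_pos (y - y')) (Rabs_pos (r - r')). nra.
Qed.

(** Bootstrap: once f and p are bounded by q and q-Lipschitz in time, the states along the
    trajectory are admissible, so every [usm] quantity is O(q) and O(q)-Lipschitz in time. *)
Lemma time_bl (G : state -> R) : usm G -> exists C, 0 <= C /\
  forall h nu q r0 r (f p : R -> R), 0 <= nu <= 1 -> 0 <= q <= 1/2 -> 10 <= r0 <= r ->
  near_one h q r0 -> r * nu <= 1/16 -> r * nu <= q ->
  bl (fun _ => True) (fun s t => Rabs (s - t)) q f ->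
  bl (fun _ => True) (fun s t => Rabs (s - t)) q p ->
  bl (fun _ => True) (fun s t => Rabs (s - t)) (C * q) (fun t => G (state_at h nu r t (f t) (p t))).
Proof.
  intros [C [HC H]]. exists C. split; auto.
  intros h nu q r0 r f p Hnu Hq Hr Hh Hre Hrq Hf Hp.
  assert (0 <= r * nu) by (apply Rmult_le_pos; lra).
  apply (H R (fun _ => True) (fun s t => Rabs (s - t)) q r0 (fun t => state_at h nu r t (f t) (p t))).
  constructor; simpl.
  - intros; apply Rabs_pos.
  - auto.
  - exists nu; auto.
  - lra.
  - exists h; auto.
  - split; simpl.
    + intros t _. generalize (COS_bound ((1 - nu) * t)). intros; apply Rabs_le; lra.
    + intros s t _ _. rewrite Rmult_1_l. eapply Rle_trans; [apply cos_lipschitz|].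
      apply angle_lipschitz; auto.
  - split; simpl.
    + intros t _. generalize (SIN_bound ((1 - nu) * t)). intros; apply Rabs_le; lra.
    + intros s t _ _. rewrite Rmult_1_l. eapply Rle_trans; [apply sin_lipschitz|].
      apply angle_lipschitz; auto.
  - apply bl_const; [intros; apply Rabs_pos|]. rewrite Rabs_pos_eq; auto.
  - exact Hf.
  - exact Hp.
  - intros _ _. lra.
  - intros _ _. lra.
  - intros s t _ _. rewrite Rminus_diag, Rabs_R0. apply Rabs_pos.
Qed.

Definition solves h nu r (x y : R -> R) : Prop :=
  x 0 = 0 /\ y 0 = 0 /\ (forall t, is_derive x t (F1 h nu r t (x t) (y t))) /\
  (forall t, is_derive y t (F2 h nu r t (x t) (y t))).

(** Gronwall estimates hold on a bounded interval only; reflection and translation carry them from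
    half a period to the whole line. *)
Lemma periodic_cover (T : R) (Q : R -> Prop) : 0 < T ->
  (forall t, 0 <= t <= T / 2 -> Q t) -> (forall t, Q (- t) -> Q t) ->
  (forall t, Q t -> Q (t + T)) -> forall t, Q t.
Proof.
  intros HT H0 Hs Hp.
  assert (H : forall n t, 0 <= t <= T / 2 + INR n * T -> Q t).
  { induction n as [|n IH]; intros t Ht.
    - simpl in Ht. apply H0; lra.
    - rewrite S_INR in Ht. destruct (Rle_dec t (T / 2)); [apply H0; lra|].
      replace t with ((t - T) + T) by ring. apply Hp.
      destruct (Rle_dec 0 (t - T)); [apply IH; lra|]. apply Hs. apply H0; lra. }
  assert (H' : forall t, 0 <= t -> Q t).
  { intros t Ht. destruct (INR_unbounded (t / T)) as [n Hn]. apply (H n).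
    apply (Rmult_lt_compat_r T) in Hn; auto. 
    replace (t / T * T) with t in Hn by (field; lra). lra. }
  intros t. destruct (Rle_dec 0 t); auto. apply Hs, H'; lra.
Qed.

(* [r0] is the lower end of the shooting interval, so that [q] can be taken independent of [r]. *)
Definition regime (h : R -> R) (nu q r0 r : R) : Prop :=
  0 < nu <= 1/2 /\ 0 <= q <= 1/2 /\ 10 <= r0 <= r /\ near_one h q r0 /\ r * nu <= 1/16 /\ r * nu <= q.

(** L is chosen before h, nu, r0 and r, which makes the Gronwall constants independent of n. The
    Lipschitz dependence on r yields the continuity of the shooting map. *)
Definition F_uniformly_lipschitz (L : R) : Prop :=
  forall h nu r0, 0 <= nu <= 1 -> 10 <= r0 -> near_one h (1/2) r0 ->
  forall r r', r0 <= r -> r0 <= r' -> r * nu <= 1/16 -> r' * nu <= 1/16 ->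
  forall t x y t' x' y',
    (Rabs (F1 h nu r t x y) <= L /\ Rabs (F2 h nu r t x y) <= L) /\
    Rabs (F1 h nu r t x y - F1 h nu r' t' x' y')
      <= L * (Rabs (t - t') + Rabs (x - x') + Rabs (y - y') + Rabs (r - r')) /\
    Rabs (F2 h nu r t x y - F2 h nu r' t' x' y')
      <= L * (Rabs (t - t') + Rabs (x - x') + Rabs (y - y') + Rabs (r - r')).

Lemma F_lipschitz : exists L, 0 < L /\ F_uniformly_lipschitz L.
Proof.
  destruct (parameter_lipschitz G1s usm_G1) as [L1 [P1 H1]].
  destruct (parameter_lipschitz G2s usm_G2) as [L2 [P2 H2]].
  exists (L1 + L2). split; [lra|]. intros h nu r0 A1 A2 A3 r r' A4 A5 A6 A7 t x y t' x' y'.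
  destruct (H1 h nu r0 A1 A2 A3 r r' A4 A5 A6 A7 t x y t' x' y') as [B1 B2].
  destruct (H2 h nu r0 A1 A2 A3 r r' A4 A5 A6 A7 t x y t' x' y') as [B3 B4].
  unfold F1, F2. split; [split; lra|].
  generalize (Rabs_pos (t - t')) (Rabs_pos (x - x')) (Rabs_pos (y - y')) (Rabs_pos (r - r')).
  intros. rewrite !Rmult_plus_distr_r.
  assert (D : 0 <= Rabs (t - t') + Rabs (x - x') + Rabs (y - y') + Rabs (r - r')) by lra.
  assert (0 <= L1 * (Rabs (t - t') + Rabs (x - x') + Rabs (y - y') + Rabs (r - r'))) by (apply Rmult_le_pos; lra).
  assert (0 <= L2 * (Rabs (t - t') + Rabs (x - x') + Rabs (y - y') + Rabs (r - r'))) by (apply Rmult_le_pos; lra).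
  split; lra.
Qed.

Lemma regime_lip3 h nu q r0 r L : regime h nu q r0 r ->
  F_uniformly_lipschitz L ->
  (lip3 L (F1 h nu r) /\ lip3 L (F2 h nu r)) /\
  (forall t x y, Rabs (F1 h nu r t x y) <= L) /\ (forall t x y, Rabs (F2 h nu r t x y) <= L).
Proof.
  intros (A1 & A2 & A3 & A4 & A5 & A6) H.
  assert (H' := H h nu r0 ltac:(lra) ltac:(lra) (near_one_le _ _ (1/2) _ A4 ltac:(lra))
    r r ltac:(lra) ltac:(lra) A5 A5).
  rewrite Rminus_diag, Rabs_R0 in H'.
  split; [split|split].
  - intros t x y t' x' y'. destruct (H' t x y t' x' y') as (_ & B & _). rewrite Rplus_0_r in B. exact B.
  - intros t x y t' x' y'. destruct (H' t x y t' x' y') as (_ & _ & B). rewrite Rplus_0_r in B. exact B.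
  - intros t x y. apply (H' t x y t x y).
  - intros t x y. apply (H' t x y t x y).
Qed.

Lemma solution_exists h nu q r0 r : regime h nu q r0 r -> exists xy, solves h nu r (fst xy) (snd xy).
Proof.
  intros A. destruct F_lipschitz as [L [HL H]].
  destruct (regime_lip3 _ _ _ _ _ L A H) as ((B1 & B2) & B3 & B4).
  destruct (ode_exists (F1 h nu r) (F2 h nu r) L L HL B1 B2 B3 B4) as (x & y & Hxy).
  exists (x, y). exact Hxy.
Qed.

Lemma solution_depends_continuously h nu q r0 : exists K, 0 <= K /\
  forall r r' x y x' y', regime h nu q r0 r -> regime h nu q r0 r' ->
  solves h nu r x y -> solves h nu r' x' y' ->
  forall t, 0 <= t -> Rabs (y t - y' t) <= K * exp (K * t) * Rabs (r - r').
Proof.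
  destruct F_lipschitz as [L [HL H]]. exists (2 * L + 1). split; [lra|].
  intros r r' x y x' y' (A1 & A2 & A3 & A4 & A5 & A6) (_ & _ & A3' & _ & A5' & _)
    (X0 & Y0 & DX & DY) (X0' & Y0' & DX' & DY') t Ht.
  assert (H' := H h nu r0 ltac:(lra) ltac:(lra) (near_one_le _ _ (1/2) _ A4 ltac:(lra))
    r r' ltac:(lra) ltac:(lra) A5 A5').
  destruct (gronwall_system (fun t => x t - x' t) (fun t => y t - y' t)
    (fun t => F1 h nu r t (x t) (y t) - F1 h nu r' t (x' t) (y' t))
    (fun t => F2 h nu r t (x t) (y t) - F2 h nu r' t (x' t) (y' t))
    (L * Rabs (r - r')) L) with (t := t) as [_ B]; auto; try lra.
  - apply Rmult_le_pos; [lra | apply Rabs_pos].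
  - intros s _. apply (is_derive_minus (V := R_NormedModule)); auto.
  - intros s _. apply (is_derive_minus (V := R_NormedModule)); auto.
  - intros s _. destruct (H' s (x s) (y s) s (x' s) (y' s)) as (_ & B & _).
    rewrite Rminus_diag, Rabs_R0 in B. lra.
  - intros s _. destruct (H' s (x s) (y s) s (x' s) (y' s)) as (_ & _ & B).
    rewrite Rminus_diag, Rabs_R0 in B. lra.
  - eapply Rle_trans; [exact B|].
    assert (0 <= Rabs (r - r') * exp ((2 * L + 1) * t))
      by (apply Rmult_le_pos; [apply Rabs_pos | left; apply exp_pos]).
    nra.
Qed.

Lemma bl_zero q : 0 <= q -> bl (fun _ : R => True) (fun s t => Rabs (s - t)) q (fun _ => 0).
Proof. intros. apply bl_const; [intros; apply Rabs_pos | rewrite Rabs_R0; auto]. Qed.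

Lemma clamp_0 : clamp 0 = 0.
Proof. apply clamp_id. rewrite Rabs_R0; lra. Qed.

(** At x = y = 0 the right-hand side is O(q) by [time_bl] applied to the zero trajectory; the rest
    is the Lipschitz bound. *)
Lemma F_growth : exists C L, 0 <= C /\ 0 < L /\ forall h nu q r0 r, regime h nu q r0 r ->
  forall t x y, Rabs (F1 h nu r t x y) <= C * q + L * (Rabs x + Rabs y) /\
                Rabs (F2 h nu r t x y) <= C * q + L * (Rabs x + Rabs y).
Proof.
  destruct F_lipschitz as [L [HL H]].
  destruct (time_bl G1s usm_G1) as [C1 [HC1 B1]]. destruct (time_bl G2s usm_G2) as [C2 [HC2 B2]].
  exists (C1 + C2), L. split; [lra|]. split; [auto|].
  intros h nu q r0 r A t x y.
  destruct (regime_lip3 _ _ _ _ _ L A H) as ((L1 & L2) & _).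
  destruct A as (A1 & A2 & A3 & A4 & A5 & A6).
  assert (Z := bl_zero q ltac:(lra)).
  assert (D1 := proj1 (B1 h nu q r0 r _ _ ltac:(lra) A2 A3 A4 A5 A6 Z Z) t I).
  assert (D2 := proj1 (B2 h nu q r0 r _ _ ltac:(lra) A2 A3 A4 A5 A6 Z Z) t I).
  specialize (L1 t x y t 0 0). specialize (L2 t x y t 0 0).
  unfold F1 at 2 in L1. unfold F2 at 2 in L2. rewrite clamp_0 in L1, L2. simpl in D1, D2.
  rewrite !Rminus_diag, Rabs_R0, !Rminus_0_r in L1, L2.
  assert (0 <= C1 * q) by nra. assert (0 <= C2 * q) by nra.
  split.
  - apply Rabs_le_between in D1. apply Rabs_le_between in L1. apply Rabs_le. lra.
  - apply Rabs_le_between in D2. apply Rabs_le_between in L2. apply Rabs_le. lra.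
Qed.

(** The interval [0, 8] contains every half period: nu <= 1/2 gives T <= 4 PI <= 16. *)
Lemma solution_small : exists C, 0 <= C /\ forall h nu q r0 r x y, regime h nu q r0 r ->
  solves h nu r x y -> forall t, 0 <= t <= 8 -> Rabs (x t) <= C * q /\ Rabs (y t) <= C * q.
Proof.
  destruct F_growth as (C & L & HC & HL & H). exists (C * exp ((2 * L + 1) * 8)). split.
  { apply Rmult_le_pos; auto. left; apply exp_pos. }
  intros h nu q r0 r x y A (X0 & Y0 & DX & DY) t Ht.
  assert (Hq : 0 <= C * q) by (destruct A as (_ & A & _); nra).
  destruct (gronwall_system x y (fun t => F1 h nu r t (x t) (y t)) (fun t => F2 h nu r t (x t) (y t))
    (C * q) L) with (t := t) as [B1 B2]; auto; try lra.
  - intros s _. apply (H h nu q r0 r A).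
  - intros s _. apply (H h nu q r0 r A).
  - assert (E : exp ((2 * L + 1) * t) <= exp ((2 * L + 1) * 8)).
    { assert ((2 * L + 1) * t <= (2 * L + 1) * 8) by (apply Rmult_le_compat_l; lra).
      destruct (Rle_lt_or_eq_dec _ _ H0) as [Hlt | ->]; [left; apply exp_increasing; auto | lra]. }
    assert (C * q * exp ((2 * L + 1) * t) <= C * q * exp ((2 * L + 1) * 8))
      by (apply Rmult_le_compat_l; auto).
    replace (C * exp ((2 * L + 1) * 8) * q) with (C * q * exp ((2 * L + 1) * 8)) by ring.
    lra.
Qed.

(** The reflection preserves cos sigma and changes the sign of sin sigma, which enters [rad] only
    through its square. It is used at T = 0 and at the period. *)
Lemma F_reflection h nu r T : (exists k, (1 - nu) * T = 2 * IZR k * PI) -> forall t x y,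
  F1 h nu r (T - t) x (- y) = - F1 h nu r t x y /\ F2 h nu r (T - t) x (- y) = F2 h nu r t x y.
Proof.
  intros [k Hk] t x y. unfold F1, F2, G1s, G2s, state_at; simpl. rewrite clamp_opp.
  assert (HPk : cos ((1 - nu) * (T - t)) = cos ((1 - nu) * t) /\
                sin ((1 - nu) * (T - t)) = - sin ((1 - nu) * t)).
  { rewrite Rmult_minus_distr_l, Hk, cos_minus, sin_minus.
    assert (C0 : sin (IZR k * PI) = 0) by (apply sin_eq_0_1; exists k; auto).
    replace (2 * IZR k * PI) with (2 * (IZR k * PI)) by ring.
    rewrite cos_2a_sin, sin_2a, C0. split; ring. }
  destruct HPk as [-> ->]. unfold G1, G2, rad. split; [ring|].
  replace (- clamp y * - clamp y) with (clamp y * clamp y) by ring.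
  match goal with |- _ * h (sqrt (_ + ?a ^ 2)) * _ - _ = _ * h (sqrt (_ + ?b ^ 2)) * _ - _ =>
    replace (a ^ 2) with (b ^ 2) by ring end.
  reflexivity.
Qed.

Lemma periodic_solution : exists C q1, 0 < C /\ 0 < q1 /\
  forall h nu q r0 r x y T, regime h nu q r0 r -> q <= q1 -> solves h nu r x y ->
  (1 - nu) * T = 2 * PI -> y (T / 2) = 0 ->
  (forall t, x (t + T) = x t) /\
  (forall t, Rabs (x t) <= 1/2 /\ Rabs (x t) <= C * q) /\
  (forall t, is_derive x t (G1s (state_at h nu r t (x t) (y t)))) /\
  (forall t, is_derive y t (G2s (state_at h nu r t (x t) (y t)))) /\
  (forall t, Rabs (G1s (state_at h nu r t (x t) (y t))) <= C * q) /\
  bl (fun _ => True) (fun s t => Rabs (s - t)) (C * q) (fun t => G3s (state_at h nu r t (x t) (y t))).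
Proof.
  destruct solution_small as (C1 & HC1 & S1). destruct F_growth as (C2 & L & HC2 & HL & H2).
  destruct (time_bl G3s usm_second_derivative) as (C3 & HC3 & S3).
  destruct F_lipschitz as [L' [HL' HLip]].
  (* D q bounds x, y and both their derivatives, and D >= 1 allows D q to replace q in [near_one].
     The threshold q1 = 1 / (2 D) gives D q <= 1/2, so that the clamp is inactive. *)
  set (D := 1 + C1 + (C2 + L * (C1 + C1))).
  assert (HD : 1 <= D) by (unfold D; assert (0 <= L * (C1 + C1)) by (apply Rmult_le_pos; lra); lra).
  assert (0 <= C3 * D) by (apply Rmult_le_pos; lra).
  exists (D + C3 * D), (1 / (2 * D)). split; [lra|]. split; [apply Rdiv_lt_0_compat; lra|].
  intros h nu q r0 r x y T A Hq Hs HT Hy.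
  assert (A' := A). destruct A' as (A1 & A2 & A3 & A4 & A5 & A6).
  assert (HDq : 0 <= D * q <= 1/2).
  { split; [nra|]. apply (Rmult_le_compat_l D) in Hq; [|lra].
    replace (D * (1 / (2 * D))) with (1/2) in Hq by (field; lra). exact Hq. }
  destruct (regime_lip3 _ _ _ _ _ L' A HLip) as ((LF1 & LF2) & _).
  assert (Hs' := Hs). destruct Hs' as (X0 & Y0 & DX & DY).
  assert (R0 : forall t, x (0 - t) = x t /\ y (0 - t) = - y t).
  { apply (ode_reflection (F1 h nu r) (F2 h nu r) L'); auto; try lra.
    - intros t u v. apply (F_reflection h nu r 0). exists 0%Z. simpl. ring.
    - intros t u v. apply (F_reflection h nu r 0). exists 0%Z. simpl. ring.
    - replace (0 / 2) with 0 by field. auto. }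
  assert (R1 : forall t, x (T - t) = x t /\ y (T - t) = - y t).
  { apply (ode_reflection (F1 h nu r) (F2 h nu r) L'); auto; try lra.
    - intros t u v. apply (F_reflection h nu r T). exists 1%Z. simpl. lra.
    - intros t u v. apply (F_reflection h nu r T). exists 1%Z. simpl. lra. }
  assert (Per : forall t, x (t + T) = x t /\ y (t + T) = y t).
  { intros t. destruct (R0 t) as [E1 E2]. destruct (R1 (0 - t)) as [E3 E4].
    replace (T - (0 - t)) with (t + T) in * by ring. rewrite E3, E4, E1, E2. split; ring. }
  assert (PI4 := PI_4). assert (PI0 := PI_RGT_0).
  assert (HTb : 0 < T <= 16) by (split; nra).
  assert (Bd : forall t, Rabs (x t) <= C1 * q /\ Rabs (y t) <= C1 * q).
  { apply (periodic_cover T (fun t => Rabs (x t) <= C1 * q /\ Rabs (y t) <= C1 * q)); [lra | | |].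
    - intros t Ht. apply (S1 h nu q r0 r x y A Hs). lra.
    - intros t. replace (- t) with (0 - t) by ring. destruct (R0 t) as [-> ->].
      rewrite Rabs_Ropp. auto.
    - intros t. destruct (Per t) as [-> ->]. auto. }
  assert (HC1q : C1 * q <= D * q) by (apply Rmult_le_compat_r; [lra|]; unfold D;
    assert (0 <= L * (C1 + C1)) by (apply Rmult_le_pos; lra); lra).
  assert (Ec : forall t, clamp (x t) = x t /\ clamp (y t) = y t).
  { intros t. specialize (Bd t). split; apply clamp_id; lra. }
  assert (DB : forall t, Rabs (F1 h nu r t (x t) (y t)) <= D * q /\ Rabs (F2 h nu r t (x t) (y t)) <= D * q).
  { intros t. specialize (Bd t). destruct (H2 h nu q r0 r A t (x t) (y t)) as [E1 E2].
    assert (L * (Rabs (x t) + Rabs (y t)) <= L * (C1 * q + C1 * q)) by (apply Rmult_le_compat_l; lra).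
    assert (C2 * q + L * (C1 * q + C1 * q) <= D * q) by (unfold D; nra). lra. }
  assert (EF : forall t, F1 h nu r t (x t) (y t) = G1s (state_at h nu r t (x t) (y t)) /\
                         F2 h nu r t (x t) (y t) = G2s (state_at h nu r t (x t) (y t))).
  { intros t. unfold F1, F2. destruct (Ec t) as [-> ->]. auto. }
  assert (bx : bl (fun _ => True) (fun s t => Rabs (s - t)) (D * q) x).
  { split; [intros t _; specialize (Bd t); lra|].
    apply (deriv_bounded_lipschitz x (fun t => F1 h nu r t (x t) (y t))); auto.
    intros t _. apply DB. }
  assert (bY : bl (fun _ => True) (fun s t => Rabs (s - t)) (D * q) y).
  { split; [intros t _; specialize (Bd t); lra|].
    apply (deriv_bounded_lipschitz y (fun t => F2 h nu r t (x t) (y t))); auto.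
    intros t _. apply DB. }
  assert (Hqq : D * q <= (D + C3 * D) * q) by nra.
  split; [intros t; apply Per|]. split; [|split; [|split; [|split]]].
  - intros t. specialize (Bd t). split; lra.
  - intros t. rewrite <- (proj1 (EF t)). auto.
  - intros t. rewrite <- (proj2 (EF t)). auto.
  - intros t. rewrite <- (proj1 (EF t)). specialize (DB t). lra.
  - apply bl_le with (C3 * (D * q)).
    + intros; apply Rabs_pos.
    + apply (S3 h nu (D * q) r0 r x y); auto; try lra.
      * apply near_one_le with q; auto. nra.
      * nra.
    + nra.
Qed.

(** * The drift over half a period *)

(** The second bound comes from vel^2 = (1 + e c)^2 + e^2 (1 - c^2). *)
Lemma vel_expansion c e : -1 <= c <= 1 -> 0 <= e <= 1/16 ->
  Rabs (vel c e - 1) <= 2 * e /\ Rabs (vel c e - 1 - e * c) <= e * e.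
Proof.
  intros Hc He. destruct (vel_bounds c e Hc ltac:(lra)) as [Hv Ev]. unfold vsq in Ev.
  set (v := vel c e) in *.
  assert (E1 : (v - 1) * (v + 1) = e * (2 * c + e)) by lra.
  assert (E2 : (v - 1 - e * c) * (v + 1 + e * c) = e * e * (1 - c * c)) by nra.
  assert (- e <= e * c <= e) by (split; nra).
  assert (0 <= c * c <= 1) by (split; nra).
  assert (0 <= e * e * (1 - c * c) <= e * e) by (split; nra).
  assert (- 3 * e <= e * (2 * c + e) <= 3 * e) by (split; nra).
  split; apply Rabs_le; split; nra.
Qed.

Lemma Rabs_of_mult_le x v B : 7/8 <= v -> 0 <= B -> Rabs (x * v) <= B -> Rabs x <= 8/7 * B.
Proof.
  intros Hv HB H. rewrite Rabs_mult, (Rabs_pos_eq v) in H by lra.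
  generalize (Rabs_pos x). nra.
Qed.

(** The first-order term - e c is opposite to that of [vel], so in vel - kap the two add up to 2 e
    c. *)
Lemma kap_expansion nu c e : 0 <= nu <= 1 -> -1 <= c <= 1 -> 0 <= e <= 1/16 ->
  Rabs (kap nu c e - 1) <= 2 * e /\ Rabs (kap nu c e - 1 + e * c) <= 2 * e * (4 * e + nu).
Proof.
  intros Hn Hc He. generalize (vsq_bounds c e Hc ltac:(lra)). intros Hv.
  assert (E1 : (kap nu c e - 1) * vsq c e = e * ((nu - 1) * (c + e)))
    by (unfold kap; unfold vsq in *; field; lra).
  assert (E2 : (kap nu c e - 1 + e * c) * vsq c e = e * (c * (2 * e * c + e * e) + nu * c - (1 - nu) * e)).
  { rewrite Rmult_plus_distr_r, E1. unfold vsq. ring. }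
  set (V := vsq c e) in *. set (k := kap nu c e) in *. clearbody V k.
  assert (B1 : -(17/16) <= (nu - 1) * (c + e) <= 17/16) by (split; nra).
  assert (-(17/16) * e <= e * ((nu - 1) * (c + e)) <= 17/16 * e) by (split; nra).
  assert (- e <= e * c <= e) by (split; nra).
  assert (-(3 * e) <= 2 * e * c + e * e <= 3 * e) by (split; nra).
  assert (-(3 * e) <= c * (2 * e * c + e * e) <= 3 * e) by (split; nra).
  assert (- nu <= nu * c <= nu) by (split; nra).
  assert (0 <= (1 - nu) * e <= e) by (split; nra).
  assert (B2 : -(4 * e + nu) <= c * (2 * e * c + e * e) + nu * c - (1 - nu) * e <= 4 * e + nu)
    by (split; lra).
  assert (- (e * (4 * e + nu)) <= e * (c * (2 * e * c + e * e) + nu * c - (1 - nu) * e) <= e * (4 * e + nu))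
    by (split; nra).
  assert (0 <= e * (4 * e + nu)) by nra.
  split.
  - apply Rle_trans with (8/7 * (17/16 * e)); [|lra].
    apply Rabs_of_mult_le with V; [lra | lra |]. rewrite E1. apply Rabs_le; lra.
  - apply Rle_trans with (8/7 * (e * (4 * e + nu))); [|lra].
    apply Rabs_of_mult_le with V; [lra | lra |]. rewrite E2. apply Rabs_le; lra.
Qed.

Lemma Rabs_mult_le a b A B : Rabs a <= A -> Rabs b <= B -> Rabs (a * b) <= A * B.
Proof.
  intros. rewrite Rabs_mult. apply Rmult_le_compat; auto; apply Rabs_pos.
Qed.

Lemma Rabs_plus_le a b A B : Rabs a <= A -> Rabs b <= B -> Rabs (a + b) <= A + B.
Proof. intros. eapply Rle_trans; [apply Rabs_triang|]. lra. Qed.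

Lemma Rabs_minus_le a b A B : Rabs a <= A -> Rabs b <= B -> Rabs (a - b) <= A + B.
Proof. intros. apply Rabs_plus_le; auto. rewrite Rabs_Ropp; auto. Qed.

(** Here sqrt ((r + c)^2 + s^2) is |U|, and rho stands for - h'(r). To leading order the system is
    f' = p, p' = - f + (h r - 1) + (2 e - rho) c. *)
Lemma rhs_expansion h nu q r0 r c s f p D rho eta :
  regime h nu q r0 r -> nu <= q -> -1 <= c <= 1 -> -1 <= s <= 1 ->
  1 <= D -> D * q <= 1/2 -> Rabs f <= D * q -> Rabs p <= D * q ->
  Rabs (h (sqrt ((r + c) ^ 2 + s ^ 2)) - h r + rho * c) <= eta ->
  let e := r * nu in
  Rabs (G1 nu c e f p - p) <= 4 * (D * q * (D * q)) /\
  Rabs (G2 h nu c s e r f p + f - (h r - 1) - (2 * e - rho) * c) <= 44 * (D * q * (D * q)) + eta.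
Proof.
  intros (A1 & A2 & A3 & A4 & A5 & A6) Hnq Hc Hs HD HDq Hf Hp Heta e.
  fold e in A5, A6.
  assert (He : 0 <= e <= 1/16) by (split; [apply Rmult_le_pos; lra | auto]).
  assert (Hq : q <= D * q) by nra. set (Q := D * q) in *.
  assert (HQ : 0 <= Q) by lra.
  destruct (vel_expansion c e Hc He) as [V1 V2].
  destruct (kap_expansion nu c e ltac:(lra) Hc He) as [K1 K2].
  destruct (vel_bounds c e Hc ltac:(lra)) as [V0 _].
  assert (K0 := kap_bounds nu c e ltac:(lra) Hc ltac:(lra)).
  assert (Hf' : -(1/2) <= f <= 1/2) by (apply Rabs_le_between; lra).
  assert (Hp' : -(1/2) <= p <= 1/2) by (apply Rabs_le_between; lra).
  assert (W0 := wid_bounds nu c e f ltac:(lra) Hc ltac:(lra) Hf').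
  assert (W1 : Rabs (wid nu c e f - 1) <= 4 * Q).
  { unfold wid. replace (vel c e - kap nu c e * f - 1) with ((vel c e - 1) - kap nu c e * f) by ring.
    apply Rle_trans with (2 * e + 5/4 * Q); [|lra].
    apply Rabs_minus_le; auto. apply Rabs_mult_le; auto. apply Rabs_le; lra. }
  assert (Hpp : 0 <= p * p <= Q * Q).
  { split; [nra|]. rewrite <- (Rabs_pos_eq (p * p)) by nra. apply Rabs_mult_le; auto. }
  assert (QQ : 0 <= Q * Q) by lra.
  split.
  { unfold G1. replace (wid nu c e f * p - p) with ((wid nu c e f - 1) * p) by ring.
    replace (4 * (Q * Q)) with (4 * Q * Q) by ring. apply Rabs_mult_le; auto. }
  set (H1 := h (rad c s e r f)). set (H0 := h (sqrt ((r + c) ^ 2 + s ^ 2))) in *.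
  assert (Lf : r0 / 2 <= rad c s e r f).
  { generalize (rad_lower c s e r f Hc ltac:(lra) Hf' ltac:(lra)). lra. }
  assert (E0 : rad c s e r 0 = sqrt ((r + c) ^ 2 + s ^ 2)).
  { unfold rad. f_equal. field. lra. }
  assert (L0 : r0 / 2 <= sqrt ((r + c) ^ 2 + s ^ 2)).
  { rewrite <- E0. generalize (rad_lower c s e r 0 Hc ltac:(lra) ltac:(lra) ltac:(lra)). lra. }
  destruct (A4 _ _ Lf L0) as [B1 B2]. destruct (A4 _ _ L0 L0) as [B3 _].
  fold H1 in B1, B2. fold H0 in B2, B3.
  assert (Hd : Rabs (rad c s e r f - sqrt ((r + c) ^ 2 + s ^ 2)) <= 6 * Q).
  { unfold rad. eapply Rle_trans; [apply norm_lipschitz|].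
    set (g := f / vel c e).
    assert (Hg : Rabs g <= 2 * Q).
    { unfold g, Rdiv. rewrite Rmult_comm. apply Rabs_mult_le; auto.
      rewrite Rabs_inv, Rabs_pos_eq by lra. replace 2 with (/ (1/2)) by field.
      apply Rinv_le_contravar; lra. }
    replace (r - e * g + (1 - g) * c - (r + c)) with ((- e - c) * g) by ring.
    replace ((1 - g) * s - s) with ((- s) * g) by ring.
    replace (6 * Q) with (2 * (2 * Q) + 1 * (2 * Q)) by ring.
    apply Rplus_le_compat; apply Rabs_mult_le; auto; apply Rabs_le; lra. }
  (* Moving from U to the graph changes the radius by O(Q), and h has Lipschitz constant q: the
     dependence of h on f is already quadratic. *)
  assert (B4 : Rabs (H1 - H0) <= Q * (6 * Q)).
  { eapply Rle_trans; [exact B2|]. apply Rmult_le_compat; auto; try lra. apply Rabs_pos. }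
  set (S := sqrt (1 + p * p)).
  assert (HS : S * S = 1 + p * p) by (apply sqrt_sqrt; lra).
  assert (HS0 : 0 <= S) by apply sqrt_pos.
  assert (HS2 : 1 <= S) by nra.
  assert (HS1 : 0 <= S - 1 <= p * p).
  { split; [lra|]. assert ((S - 1) * (S + 1) = p * p) by lra. nra. }
  assert (HS3 : 0 <= S * (1 + p * p) - 1 <= 3 * (Q * Q)).
  { assert (p * p <= 1/4) by nra.
    assert (0 <= (S - 1) * (1 + p * p) <= p * p * (5/4)) by (split; nra). split; lra. }
  unfold G2. fold S. fold H1.
  (* Every summand is quadratically small except the last, which is the error eta. The bounds T1 to
     T6 add up to 43 Q^2. *)
  replace (wid nu c e f * H1 * (S * (1 + p * p)) - kap nu c e * (1 + p * p) + f - (h r - 1) - (2 * e - rho) * c)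
    with (wid nu c e f * (H1 * (S * (1 + p * p) - 1)) + wid nu c e f * (H1 - H0)
      + (wid nu c e f - 1) * (H0 - 1) - (kap nu c e - 1) * f - kap nu c e * (p * p)
      + ((vel c e - 1 - e * c) - (kap nu c e - 1 + e * c)) + (H0 - h r + rho * c))
    by (unfold wid; ring).
  assert (HW : Rabs (wid nu c e f) <= 2) by (apply Rabs_le; lra).
  assert (HH : Rabs H1 <= 2) by (apply Rabs_le_between in B1; apply Rabs_le; lra).
  assert (HK : Rabs (kap nu c e) <= 2) by (apply Rabs_le; lra).
  assert (T1 : Rabs (wid nu c e f * (H1 * (S * (1 + p * p) - 1))) <= 2 * (2 * (3 * (Q * Q)))).
  { repeat apply Rabs_mult_le; auto. rewrite Rabs_pos_eq; lra. }
  assert (T2 : Rabs (wid nu c e f * (H1 - H0)) <= 2 * (Q * (6 * Q))) by (apply Rabs_mult_le; auto).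
  assert (T3 : Rabs ((wid nu c e f - 1) * (H0 - 1)) <= (4 * Q) * Q) by (apply Rabs_mult_le; auto; lra).
  assert (T4 : Rabs ((kap nu c e - 1) * f) <= (2 * Q) * Q) by (apply Rabs_mult_le; auto; lra).
  assert (T5 : Rabs (kap nu c e * (p * p)) <= 2 * (Q * Q)).
  { apply Rabs_mult_le; auto. rewrite Rabs_pos_eq; lra. }
  assert (T6 : Rabs ((vel c e - 1 - e * c) - (kap nu c e - 1 + e * c)) <= Q * Q + 2 * Q * (5 * Q)).
  { apply Rabs_minus_le.
    - eapply Rle_trans; [exact V2|]. apply Rmult_le_compat; lra.
    - eapply Rle_trans; [exact K2|]. apply Rmult_le_compat; lra. }
  apply Rle_trans with (2 * (2 * (3 * (Q * Q))) + 2 * (Q * (6 * Q)) + 4 * Q * Q + 2 * Q * Q + 2 * (Q * Q)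
     + (Q * Q + 2 * Q * (5 * Q)) + eta); [|lra].
  apply Rabs_plus_le; auto. apply Rabs_plus_le; auto. apply Rabs_minus_le; auto.
  apply Rabs_minus_le; auto. apply Rabs_plus_le; auto. apply Rabs_plus_le; auto.
Qed.

(* The linearised equation is tested against [cos sigma]: [Qf] below is
   [y cos sigma + x sin sigma] minus the primitive of its leading-order derivative. *)
Lemma endpoint_expansion : exists C q2, 0 < C /\ 0 < q2 /\
  forall h nu q r0 r x y T rho eta, regime h nu q r0 r -> q <= q2 -> nu <= q -> solves h nu r x y ->
  (1 - nu) * T = 2 * PI ->
  (forall c s, c ^ 2 + s ^ 2 = 1 -> Rabs (h (sqrt ((r + c) ^ 2 + s ^ 2)) - h r + rho * c) <= eta) ->
  Rabs (y (T / 2) + (2 * (r * nu) - rho) * (T / 4)) <= C * (q * q) + 8 * eta.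
Proof.
  destruct solution_small as (C1 & HC1 & S1). set (D := 1 + C1).
  exists (400 * D * D), (1 / (2 * D)). unfold D. split; [nra|].
  split; [apply Rdiv_lt_0_compat; lra|]. fold D.
  intros h nu q r0 r x y T rho eta A Hq Hnq Hs HT Heta.
  assert (A' := A). destruct A' as (A1 & A2 & _).
  assert (HD : 1 <= D) by (unfold D; lra).
  assert (HDq : D * q <= 1/2).
  { apply (Rmult_le_compat_l D) in Hq; [|lra].
    replace (D * (1 / (2 * D))) with (1/2) in Hq by (field; lra). exact Hq. }
  assert (Bd := S1 h nu q r0 r x y A Hs).
  destruct Hs as (X0 & Y0 & DX & DY).
  set (e := r * nu). set (k0 := h r - 1). set (m := 2 * e - rho).
  set (si := fun t => (1 - nu) * t). set (i := / (1 - nu)).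
  assert (Hi : i * (1 - nu) = 1) by (unfold i; field; lra).
  set (Qf := fun t => y t * cos (si t) + x t * sin (si t) - k0 * (i * sin (si t))
     - m * (i * (si t + sin (si t) * cos (si t)) / 2)).
  (* The terms with nu appear because sigma moves at speed 1 - nu instead of 1; they are O(q^2)
     thanks to nu <= q. The constant in M is 50 = 44 + 4 + 2, from the two bounds of [rhs_expansion]
     and from these terms. *)
  set (dQ := fun t => cos (si t) * (F2 h nu r t (x t) (y t) + x t - k0 - m * cos (si t))
     + sin (si t) * (F1 h nu r t (x t) (y t) - y t) + nu * (y t * sin (si t) - x t * cos (si t))).
  set (M := 50 * (D * q * (D * q)) + eta).
  assert (PI4 := PI_4). assert (PI0 := PI_RGT_0).
  assert (HTb : 0 < T <= 16) by (split; nra).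
  assert (HQ : Rabs (Qf (T / 2) - Qf 0) <= M * (T / 2) - M * 0).
  { apply (deriv_dominated Qf dQ (fun t => M * t) (fun _ => M)); [lra | | |].
    - intros t _. unfold Qf, dQ, si. specialize (DX t). specialize (DY t).
      auto_derive.
      + repeat split; try lra; eexists; eassumption.
      + rewrite (Derive_eta x _ _ DX), (Derive_eta y _ _ DY).
        assert (E : sin ((1 - nu) * t) * sin ((1 - nu) * t) = 1 - cos ((1 - nu) * t) * cos ((1 - nu) * t))
          by (generalize (sin2_cos2 ((1 - nu) * t)); unfold Rsqr; lra).
        set (S := sin ((1 - nu) * t)) in *. set (K := cos ((1 - nu) * t)) in *.
        set (V1 := F1 h nu r t (x t) (y t)). set (V2 := F2 h nu r t (x t) (y t)).
        clearbody S K V1 V2.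
        replace (i * ((1 - nu) * 1 + ((1 - nu) * 1 * K * K + S * ((1 - nu) * 1 * - S))) * / 2)
          with (i * (1 - nu) * (1 + K * K - S * S) / 2) by field.
        replace (i * ((1 - nu) * 1 * K)) with (i * (1 - nu) * K) by ring.
        rewrite Hi, E. field.
    - intros z _. auto_derive; auto; ring.
    - intros t Ht. destruct (Bd t ltac:(lra)) as [Bx By].
      assert (C0 := COS_bound (si t)). assert (S0 := SIN_bound (si t)).
      assert (HCD : C1 * q <= D * q) by (apply Rmult_le_compat_r; unfold D; lra).
      destruct (rhs_expansion h nu q r0 r (cos (si t)) (sin (si t)) (x t) (y t) D rho eta A Hnq
         ltac:(lra) ltac:(lra) HD HDq ltac:(lra) ltac:(lra)) as [R1 R2].
      { apply Heta. generalize (sin2_cos2 (si t)). unfold Rsqr. simpl. lra. }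
      fold e in R1, R2. fold k0 in R2. fold m in R2.
      unfold dQ, F1, F2, G1s, G2s, state_at; simpl. rewrite !clamp_id by lra. fold e. fold (si t).
      assert (AC : Rabs (cos (si t)) <= 1) by (apply Rabs_le; lra).
      assert (AS : Rabs (sin (si t)) <= 1) by (apply Rabs_le; lra).
      assert (Q0 : 0 <= q <= D * q) by nra.
      apply Rle_trans with (1 * (44 * (D * q * (D * q)) + eta) + 1 * (4 * (D * q * (D * q)))
         + q * (D * q * 1 + D * q * 1)).
      + apply Rabs_plus_le; [apply Rabs_plus_le|]; apply Rabs_mult_le; auto.
        * rewrite Rabs_pos_eq; lra.
        * apply Rabs_minus_le; apply Rabs_mult_le; auto; lra.
      + unfold M. assert (q * (D * q) <= D * q * (D * q)) by nra. lra. }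
  assert (E0 : Qf 0 = 0) by (unfold Qf, si; rewrite X0, Y0, Rmult_0_r, sin_0; field).
  assert (E1 : si (T / 2) = PI) by (unfold si; lra).
  (* At sigma = PI the sine vanishes, which removes x and the constant forcing k0; what survives of
     m is the integral of cos^2 sigma over half a period, T / 4. *)
  assert (E2 : Qf (T / 2) = - (y (T / 2) + m * (T / 4))).
  { unfold Qf. rewrite E1, cos_PI, sin_PI. replace (T / 4) with (i * (1 - nu) * T / 4) by (rewrite Hi; field).
    replace (i * (1 - nu) * T / 4) with (i * ((1 - nu) * T) / 4) by field. rewrite HT. field. }
  rewrite E0, E2, Rminus_0_r, Rabs_Ropp in HQ.
  eapply Rle_trans; [exact HQ|].
  assert (0 <= M).
  { unfold M. assert (0 <= eta). { eapply Rle_trans; [apply Rabs_pos | apply (Heta 1 0); ring]. } nra. }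
  assert (M * (T / 2) <= M * 8) by (apply Rmult_le_compat_l; lra).
  unfold M in *. nra.
Qed.

(** * Asymptotics of the profile h *)

Definition large (Q : R -> Prop) : Prop := exists S, 0 < S /\ forall s, S <= s -> Q s.

Lemma large_and (Q1 Q2 : R -> Prop) : large Q1 -> large Q2 -> large (fun s => Q1 s /\ Q2 s).
Proof.
  intros [S1 [P1 H1]] [S2 [P2 H2]]. exists (Rmax S1 S2).
  split; [apply Rlt_le_trans with S1; auto; apply Rmax_l|].
  intros s Hs. split; [apply H1 | apply H2]; eapply Rle_trans; eauto; [apply Rmax_l | apply Rmax_r].
Qed.

Lemma large_impl (Q1 Q2 : R -> Prop) : large Q1 -> (forall s, Q1 s -> Q2 s) -> large Q2.
Proof. intros [S [P H]] HQ. exists S. auto. Qed.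

Lemma large_ge M : large (fun s => M <= s).
Proof. exists (Rmax 1 M). split; [apply Rlt_le_trans with 1; [lra | apply Rmax_l]|].
  intros s Hs. eapply Rle_trans; eauto. apply Rmax_r. Qed.

Lemma large_half (Q : R -> Prop) : large Q -> large (fun r => forall s, r / 2 <= s -> Q s).
Proof. intros [S [P H]]. exists (2 * S). split; [lra|]. intros r Hr s Hs. apply H. lra. Qed.

Lemma Rpower_pos x a : 0 < Rpower x a.
Proof. apply exp_pos. Qed.

Lemma Rpower_neg_le s s' a : 0 < s -> s <= s' -> 0 <= a -> Rpower s' (- a) <= Rpower s (- a).
Proof.
  intros. rewrite !Rpower_Ropp. apply Rinv_le_contravar; [apply Rpower_pos|].
  apply Rle_Rpower_l; lra.
Qed.

Lemma Rpower_half r a : 0 < r -> Rpower (r / 2) (- a) = Rpower 2 a * Rpower r (- a).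
Proof.
  intros. unfold Rpower. rewrite <- exp_plus. f_equal.
  unfold Rdiv. rewrite ln_mult, ln_Rinv by lra. ring.
Qed.

Lemma large_power K a eta : 0 < a -> 0 < eta -> large (fun s => K * Rpower s (- a) <= eta).
Proof.
  intros Ha He. set (K' := Rmax K 1). assert (HK : 1 <= K') by apply Rmax_r.
  assert (Hek : 0 < eta / K') by (apply Rdiv_lt_0_compat; lra).
  exists (Rpower (eta / K') (- / a)). split; [apply Rpower_pos|]. intros s Hs.
  assert (P := Rpower_pos s (- a)).
  apply Rle_trans with (K' * Rpower s (- a)); [apply Rmult_le_compat_r; [lra | apply Rmax_l]|].
  apply Rle_trans with (K' * (eta / K')); [|right; field; lra].
  apply Rmult_le_compat_l; [lra|].
  apply Rle_trans with (Rpower (Rpower (eta / K') (- / a)) (- a)).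
  - apply Rpower_neg_le; auto; [apply Rpower_pos | lra].
  - rewrite Rpower_mult. replace (- / a * - a) with 1 by (field; lra). rewrite Rpower_1; lra.
Qed.

Lemma is_derive_Rpower a x : 0 < x -> is_derive (fun s => Rpower s a) x (a * Rpower x (a - 1)).
Proof. intros. apply is_derive_Reals, derivable_pt_lim_power; auto. Qed.

(** Puts the three ranges of beta in one form. For beta > 1 the correction is o(s^-(gamma+1)), so a
    = A and b = 0; for 0 < beta <= 1 its leading part B is kept as b with delta = beta; for beta = 0
    it has the same order as A, so a = A + B, positive because B > - A. When b = 0 the value delta =
    1 is a placeholder. *)
Lemma profile_expansion (h ht : R -> R) (A gamma beta : R) :
  0 < A -> 1 < gamma -> 0 <= beta ->
  (exists s0, 0 < s0 /\ forall s, s0 <= s ->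
     h s = 1 + A / Rpower s gamma + ht s / Rpower s (gamma + beta)) ->
  (1 < beta -> exists K, forall s, 0 < s -> Rabs (ht s) <= K) ->
  (0 < beta <= 1 -> exists B, is_lim (fun s => (ht s - B) / Rpower s (beta - 1)) p_infty 0) ->
  (beta = 0 -> exists B, - A < B /\ is_lim (fun s => (ht s - B) / Rpower s (-1)) p_infty 0) ->
  exists a b delta, 0 < a /\ 0 < delta /\ forall eta, 0 < eta -> large (fun s =>
    Rabs (h s - 1 - a * Rpower s (- gamma) - b * Rpower s (- (gamma + delta)))
    <= eta * Rpower s (- (gamma + 1))).
Proof.
  intros HA Hg Hb [s0 [Hs0 Hexp]] Hbig Hmid Hzero.
  assert (Hexp' : large (fun s => 0 < s /\ h s = 1 + A * Rpower s (- gamma) + ht s * Rpower s (- (gamma + beta)))).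
  { exists s0. split; auto. intros s Hs. split; [lra|]. rewrite Hexp by auto.
    unfold Rdiv. rewrite <- !Rpower_Ropp. reflexivity. }
  assert (Hlim : forall B, is_lim (fun s => (ht s - B) / Rpower s (beta - 1)) p_infty 0 ->
    forall eta, 0 < eta -> large (fun s => Rabs ((ht s - B) * Rpower s (- (gamma + beta)))
                                     <= eta * Rpower s (- (gamma + 1)))).
  { intros B HB eta He. apply is_lim_spec in HB. destruct (HB (mkposreal eta He)) as [M HM].
    apply large_impl with (fun s => M + 1 <= s); [apply large_ge|]. intros s Hs.
    specialize (HM s ltac:(lra)). simpl in HM. rewrite Rminus_0_r in HM.
    replace (Rpower s (- (gamma + beta))) with (/ Rpower s (beta - 1) * Rpower s (- (gamma + 1))).
    - rewrite <- Rmult_assoc, Rabs_mult, (Rabs_pos_eq (Rpower _ _)) by (left; apply Rpower_pos).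
      apply Rmult_le_compat_r; [left; apply Rpower_pos|]. left. exact HM.
    - rewrite <- Rpower_Ropp, <- Rpower_plus. f_equal. ring. }
  destruct (Rlt_dec 1 beta) as [H1 | H1].
  - destruct (Hbig H1) as [K HK]. exists A, 0, 1. split; auto. split; [lra|]. intros eta He.
    apply large_impl with (fun s => K * Rpower s (- (beta - 1)) <= eta /\
      (0 < s /\ h s = 1 + A * Rpower s (- gamma) + ht s * Rpower s (- (gamma + beta)))).
    + apply large_and; auto. apply large_power; lra.
    + intros s (E1 & E2 & ->). 
      replace (Rpower s (- (gamma + beta))) with (Rpower s (- (beta - 1)) * Rpower s (- (gamma + 1)))
        by (rewrite <- Rpower_plus; f_equal; ring).
      match goal with |- Rabs ?u <= _ => replace u with
        (ht s * Rpower s (- (beta - 1)) * Rpower s (- (gamma + 1))) by ring end.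
      assert (P1 := Rpower_pos s (- (beta - 1))). assert (P2 := Rpower_pos s (- (gamma + 1))).
      rewrite !Rabs_mult, !(Rabs_pos_eq (Rpower _ _)) by lra.
      apply Rmult_le_compat_r; [lra|]. specialize (HK s E2). nra.
  - destruct (Rle_lt_or_eq_dec 0 beta Hb) as [H2 | H2].
    + destruct (Hmid ltac:(lra)) as [B HB]. exists A, B, beta. split; auto. split; auto.
      intros eta He. eapply large_impl; [apply large_and; [exact Hexp' | apply (Hlim B HB eta He)]|].
      intros s ((E1 & ->) & E2). eapply Rle_trans; [|exact E2]. right. f_equal. ring.
    + destruct (Hzero (eq_sym H2)) as (B & HB1 & HB). exists (A + B), 0, 1.
      split; [lra|]. split; [lra|]. intros eta He.
      replace (-1) with (beta - 1) in HB by lra.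
      eapply large_impl; [apply large_and; [exact Hexp' | apply (Hlim B HB eta He)]|].
      intros s ((E1 & ->) & E2). eapply Rle_trans; [|exact E2]. right. f_equal.
      replace (gamma + beta) with gamma by lra. ring.
Qed.

(** On the positive half-axis h is the restriction of H to a line, from which it inherits two
    derivatives. *)
Lemma profile_derivatives (H : R -> R -> R) (h : R -> R) :
  C2_R2 H -> (forall x y, H x y = h (sqrt (x ^ 2 + y ^ 2))) ->
  forall s, 0 < s -> is_derive h s (Derive h s) /\ is_derive (Derive h) s (Derive_n h 2 s).
Proof.
  intros (C1 & C2 & _) Hr.
  assert (E : forall s, 0 < s -> h s = H s 0).
  { intros s Hs. rewrite Hr. f_equal. rewrite pow_i, Rplus_0_r, sqrt_pow2 by (lia || lra). reflexivity. }
  assert (Hloc : forall s, 0 < s -> locally s (fun u => 0 < u)).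
  { intros s Hs. apply (open_gt 0). exact Hs. }
  assert (D : forall s, 0 < s -> is_derive h s (D1 H s 0)).
  { intros s Hs. apply (is_derive_ext_loc (fun u => H u 0)).
    - generalize (Hloc s Hs). apply filter_imp. intros u Hu. symmetry; auto.
    - apply Derive_correct. exact (proj1 (proj1 C1 s 0)). }
  assert (D' : forall s, 0 < s -> Derive h s = D1 H s 0).
  { intros s Hs. apply is_derive_unique, D; auto. }
  intros s Hs. split; [rewrite D'; auto|].
  apply Derive_correct. apply (ex_derive_ext_loc (fun u => D1 H u 0)).
  - generalize (Hloc s Hs). apply filter_imp. intros u Hu. symmetry; auto.
  - exact (proj1 (proj1 C2 s 0)).
Qed.

(** The expansion of h cannot be differentiated termwise. Instead h' equals h (s + 1) - h s =
    O(s^-gamma) at some point of [s, s + 1], and the bound on h'' transports this to s. *)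
Lemma profile_decay (h : R -> R) (gamma m a b delta : R) :
  1 < gamma -> 0 <= m -> 0 < delta ->
  (forall s, 0 < s -> is_derive h s (Derive h s) /\ is_derive (Derive h) s (Derive_n h 2 s)) ->
  (exists C, 0 < C /\ exists s1, forall s, s1 <= s ->
     Rabs (Derive_n h 2 s) <= C * Rpower s (- (gamma + 1 + m))) ->
  (forall eta, 0 < eta -> large (fun s =>
    Rabs (h s - 1 - a * Rpower s (- gamma) - b * Rpower s (- (gamma + delta)))
    <= eta * Rpower s (- (gamma + 1)))) ->
  exists C, 0 < C /\ large (fun s => 1 <= s /\ Rabs (h s - 1) <= C * Rpower s (- gamma) /\
                        Rabs (Derive h s) <= C * Rpower s (- gamma)).
Proof.
  intros Hg Hm Hdelta Hd (C2 & HC2 & s1 & Hs1) Hexp.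
  assert (Hle : forall s u, 1 <= s -> 0 <= u -> Rpower s (- (gamma + u)) <= Rpower s (- gamma)).
  { intros s u Hs Hu. apply Rle_Rpower; lra. }
  set (C := Rabs a + Rabs b + 1).
  assert (HC : 1 <= C) by (unfold C; generalize (Rabs_pos a) (Rabs_pos b); lra).
  assert (L1 : large (fun s => 1 <= s /\ s1 <= s /\ Rabs (h s - 1) <= C * Rpower s (- gamma))).
  { eapply large_impl; [apply large_and; [apply (large_ge (Rmax 1 s1)) | apply (Hexp 1); lra]|].
    intros s (E1 & E2). assert (1 <= s) by (eapply Rle_trans; [apply Rmax_l | eauto]).
    split; auto. split; [eapply Rle_trans; [apply Rmax_r | eauto]|].
    assert (I1 := Hle s delta ltac:(lra) ltac:(lra)). assert (I2 := Hle s 1 ltac:(lra) ltac:(lra)).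
    assert (P0 := Rpower_pos s (- gamma)). assert (P1 := Rpower_pos s (- (gamma + delta))).
    replace (h s - 1) with ((h s - 1 - a * Rpower s (- gamma) - b * Rpower s (- (gamma + delta)))
       + a * Rpower s (- gamma) + b * Rpower s (- (gamma + delta))) by ring.
    replace (C * Rpower s (- gamma)) with (1 * Rpower s (- gamma) + Rabs a * Rpower s (- gamma)
      + Rabs b * Rpower s (- gamma)) by (unfold C; ring).
    apply Rabs_plus_le; [apply Rabs_plus_le|].
    - lra.
    - rewrite Rabs_mult, (Rabs_pos_eq (Rpower _ _)); lra.
    - rewrite Rabs_mult, (Rabs_pos_eq (Rpower _ _)) by lra.
      apply Rmult_le_compat_l; auto. apply Rabs_pos. }
  exists (2 * C + C2). split; [lra|]. destruct L1 as [S [HS L1]].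
  exists S. split; auto. intros s Hs. destruct (L1 s Hs) as (E1 & E2 & E3).
  assert (P0 := Rpower_pos s (- gamma)).
  split; auto. split; [nra|].
  destruct (MVT_gen h s (s + 1) (Derive h)) as [xi [Hxi Exi]].
  { intros x Hx. rewrite Rmin_left, Rmax_right in Hx by lra. exact (proj1 (Hd x ltac:(lra))). }
  { intros x Hx. rewrite Rmin_left, Rmax_right in Hx by lra.
    apply continuity_pt_filterlim, (ex_derive_continuous (V := R_NormedModule)).
    exists (Derive h x). exact (proj1 (Hd x ltac:(lra))). }
  rewrite Rmin_left, Rmax_right in Hxi by lra.
  assert (B : Rabs (Derive h s - Derive h xi) <= C2 * Rpower s (- gamma) * Rabs (s - xi)).
  { apply (deriv_bounded_lipschitz (Derive h) (Derive_n h 2) _ (fun x => s <= x)); try lra.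
    - intros x y z; lra.
    - intros x Hx. exact (proj2 (Hd x ltac:(lra))).
    - intros x Hx. eapply Rle_trans; [apply Hs1; lra|]. apply Rmult_le_compat_l; [lra|].
      replace (gamma + 1 + m) with (gamma + (1 + m)) by ring.
      eapply Rle_trans; [apply Hle; lra|]. apply Rpower_neg_le; lra. }
  destruct (L1 (s + 1) ltac:(lra)) as (_ & _ & E4).
  assert (E5 : Rpower (s + 1) (- gamma) <= Rpower s (- gamma)) by (apply Rpower_neg_le; lra).
  assert (E6 : Rabs (s - xi) <= 1) by (apply Rabs_le; lra).
  replace (Derive h s) with ((Derive h s - Derive h xi) + ((h (s + 1) - 1) - (h s - 1)))
    by (replace (h (s + 1) - 1 - (h s - 1)) with (h (s + 1) - h s) by ring; rewrite Exi; ring).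
  replace ((2 * C + C2) * Rpower s (- gamma)) with
    (C2 * Rpower s (- gamma) + (C * Rpower s (- gamma) + C * Rpower s (- gamma))) by ring.
  apply Rabs_plus_le; [|apply Rabs_minus_le; auto; nra].
  eapply Rle_trans; [exact B|]. assert (0 <= C2 * Rpower s (- gamma)) by nra. nra.
Qed.

Lemma profile_near_one (h : R -> R) (gamma C : R) :
  1 < gamma -> 0 < C ->
  (forall s, 0 < s -> is_derive h s (Derive h s)) ->
  large (fun s => 1 <= s /\ Rabs (h s - 1) <= C * Rpower s (- gamma) /\
                        Rabs (Derive h s) <= C * Rpower s (- gamma)) ->
  exists C', 0 < C' /\ large (fun r => near_one h (C' * Rpower r (- gamma)) r).
Proof.
  intros Hg HC Hd L. exists (C * Rpower 2 gamma).
  split; [apply Rmult_lt_0_compat; auto; apply Rpower_pos|].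
  eapply large_impl; [apply large_and; [apply (large_ge 2) | apply (large_half _ L)]|].
  intros r (Hr & Lr) s s' Hs Hs'.
  assert (Hb : forall u, r / 2 <= u -> C * Rpower u (- gamma) <= C * Rpower 2 gamma * Rpower r (- gamma)).
  { intros u Hu. rewrite Rmult_assoc, <- Rpower_half by lra. apply Rmult_le_compat_l; [lra|].
    apply Rpower_neg_le; lra. }
  split.
  - eapply Rle_trans; [apply (Lr s Hs) | apply Hb; auto].
  - apply (deriv_bounded_lipschitz h (Derive h) _ (fun x => r / 2 <= x)); auto; try lra.
    + intros x y z Hx Hy Hz; lra.
    + intros x Hx. apply Hd; lra.
    + intros x Hx. eapply Rle_trans; [apply (Lr x Hx) | apply Hb; auto].
Qed.

(** The remainder of the expansion is o(r^-(gamma+1)) at both |U| and r, so it needs no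
    differentiation; only the explicit powers are treated by the mean value theorem. *)
Lemma profile_gradient (h : R -> R) (gamma a b delta : R) :
  1 < gamma -> 0 < a -> 0 < delta ->
  (forall eta, 0 < eta -> large (fun s =>
    Rabs (h s - 1 - a * Rpower s (- gamma) - b * Rpower s (- (gamma + delta)))
    <= eta * Rpower s (- (gamma + 1)))) ->
  forall eta, 0 < eta -> large (fun r => forall c s, c ^ 2 + s ^ 2 = 1 ->
    Rabs (h (sqrt ((r + c) ^ 2 + s ^ 2)) - h r + a * gamma * Rpower r (- (gamma + 1)) * c)
    <= eta * Rpower r (- (gamma + 1))).
Proof.
  intros Hg Ha Hdelta Hexp eta He.
  set (p2 := Rpower 2 (gamma + 1)). assert (Hp2 : 0 < p2) by apply Rpower_pos.
  set (K1 := a * gamma * (2 * (gamma + 1) * Rpower 2 (gamma + 2))).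
  set (K2 := Rabs b * (gamma + delta) * Rpower 2 (gamma + 1 + delta)).
  (* The factor p2 pays for evaluating the remainder at z, known to be at least r / 2. Each error is
     allotted eta / 8; the difference of g uses four shares, as |z - r| <= 2, for a total of
     seven. *)
  set (eta' := eta / (8 * (p2 + 1))). assert (He' : 0 < eta') by (apply Rdiv_lt_0_compat; lra).
  eapply large_impl.
  { apply large_and; [apply (large_ge 10)|]. apply large_and; [apply (large_half _ (Hexp eta' He'))|].
    apply large_and; [apply (large_power K1 1 (eta / 8)); lra|].
    apply large_and; [apply (large_power K2 delta (eta / 8)); lra|].
    apply (large_power (a * gamma) 1 (eta / 8)); lra. }
  intros r (Hr & Hh & HK1 & HK2 & HK3) c s Hcs.
  set (z := sqrt ((r + c) ^ 2 + s ^ 2)). set (pr := Rpower r (- (gamma + 1))).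
  assert (Hpr : 0 < pr) by apply Rpower_pos.
  assert (Hc : -1 <= c <= 1) by (split; nra).
  assert (Hs2 : 0 <= s ^ 2 <= 1) by (split; nra).
  assert (Hz0 : 0 <= z) by apply sqrt_pos.
  assert (Hz2 : z * z = (r + c) ^ 2 + s ^ 2) by (apply sqrt_sqrt; nra).
  assert (Hz1 : r + c <= z) by nra.
  assert (Hr1 : Rpower r (- (1)) = / r) by (rewrite Rpower_Ropp, Rpower_1; lra).
  assert (Hir : 0 < / r <= 1/10).
  { split; [apply Rinv_0_lt_compat; lra|]. unfold Rdiv. rewrite Rmult_1_l. apply Rinv_le_contravar; lra. }
  assert (Hrr : r * / r = 1) by (field; lra).
  assert (Hz3 : 0 <= z - r - c <= / r).
  { split; [lra|]. assert ((z - r - c) * (z + (r + c)) = s ^ 2) by nra.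
    assert ((z - r - c) * r <= 1) by nra.
    apply Rmult_le_reg_r with r; [lra|]. rewrite (Rmult_comm (/ r)). lra. }
  (* The linear term cancels the derivative of a u^-gamma at u = r, so near r the derivative of g is
     o(pr): of relative order 1/r from the first power and r^-delta from the second. *)
  set (g := fun u => a * Rpower u (- gamma) + b * Rpower u (- (gamma + delta)) + a * gamma * pr * u).
  set (dg := fun u => a * (- gamma * Rpower u (- gamma - 1))
     + b * (- (gamma + delta) * Rpower u (- (gamma + delta) - 1)) + a * gamma * pr).
  assert (Hpow : forall u w, r / 2 <= u -> 0 <= w -> Rpower u (- w) <= Rpower 2 w * Rpower r (- w)).
  { intros u w Hu Hw. rewrite <- Rpower_half by lra. apply Rpower_neg_le; lra. }
  assert (G : Rabs (g z - g r) <= (eta / 8 * pr + eta / 8 * pr) * Rabs (z - r)).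
  { apply (deriv_bounded_lipschitz g dg _ (fun u => r - 2 <= u <= r + 2)).
    - intros x y u; lra.
    - intros u Hu. unfold g, dg.
      apply (is_derive_plus (V := R_NormedModule)); [apply (is_derive_plus (V := R_NormedModule))|].
      + apply is_derive_scal. apply is_derive_Rpower; lra.
      + apply is_derive_scal. apply is_derive_Rpower; lra.
      + auto_derive; auto; ring.
    - intros u Hu. unfold dg.
      replace (a * (- gamma * Rpower u (- gamma - 1)) + b * (- (gamma + delta) * Rpower u (- (gamma + delta) - 1))
         + a * gamma * pr) with (a * gamma * (pr - Rpower u (- gamma - 1))
         + - (b * (gamma + delta) * Rpower u (- (gamma + delta) - 1))) by ring.
      apply Rabs_plus_le.
      + assert (B : Rabs (Rpower r (- (gamma + 1)) - Rpower u (- (gamma + 1)))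
           <= ((gamma + 1) * (Rpower 2 (gamma + 2) * Rpower r (- (gamma + 2)))) * Rabs (r - u)).
        { apply (deriv_bounded_lipschitz (fun v => Rpower v (- (gamma + 1)))
            (fun v => - (gamma + 1) * Rpower v (- (gamma + 1) - 1)) _ (fun u => r / 2 <= u)); try lra.
          - intros v v' w; lra.
          - intros v Hv. apply is_derive_Rpower; lra.
          - intros v Hv. rewrite Rabs_mult, Rabs_Ropp, (Rabs_pos_eq (gamma + 1)), (Rabs_pos_eq (Rpower _ _))
              by (try lra; left; apply Rpower_pos).
            apply Rmult_le_compat_l; [lra|].
            replace (- (gamma + 1) - 1) with (- (gamma + 2)) by ring. apply Hpow; lra. }
        replace (- gamma - 1) with (- (gamma + 1)) by ring. fold pr in B.
        assert (Hru : Rabs (r - u) <= 2) by (apply Rabs_le; lra).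
        assert (E2 : Rpower r (- (gamma + 2)) = Rpower r (- (1)) * pr)
          by (unfold pr; rewrite <- Rpower_plus; f_equal; ring).
        rewrite Rabs_mult, (Rabs_pos_eq (a * gamma)) by nra.
        apply Rle_trans with (K1 * Rpower r (- (1)) * pr); [|apply Rmult_le_compat_r; lra].
        unfold K1. rewrite E2 in B.
        replace (a * gamma * (2 * (gamma + 1) * Rpower 2 (gamma + 2)) * Rpower r (- (1)) * pr)
          with (a * gamma * ((gamma + 1) * (Rpower 2 (gamma + 2) * (Rpower r (- (1)) * pr)) * 2)) by ring.
        apply Rmult_le_compat_l; [nra|]. eapply Rle_trans; [exact B|]. apply Rmult_le_compat_l; auto.
        apply Rmult_le_pos; [lra|]. apply Rmult_le_pos; [left; apply Rpower_pos|].
        apply Rmult_le_pos; [left; apply Rpower_pos | lra].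
      + rewrite Rabs_Ropp, !Rabs_mult, (Rabs_pos_eq (gamma + delta)), (Rabs_pos_eq (Rpower _ _))
          by (try lra; left; apply Rpower_pos).
        apply Rle_trans with (K2 * Rpower r (- delta) * pr); [|apply Rmult_le_compat_r; lra].
        unfold K2. rewrite !Rmult_assoc. apply Rmult_le_compat_l; [apply Rabs_pos|].
        apply Rmult_le_compat_l; [lra|]. unfold pr. rewrite <- Rpower_plus.
        replace (- (gamma + delta) - 1) with (- (gamma + 1 + delta)) by ring.
        replace (- delta + - (gamma + 1)) with (- (gamma + 1 + delta)) by ring. apply Hpow; lra.
    - lra.
    - lra. }
  assert (Hzr : Rabs (z - r) <= 2) by (apply Rabs_le; lra).
  assert (Ez : Rabs (h z - 1 - a * Rpower z (- gamma) - b * Rpower z (- (gamma + delta))) <= eta / 8 * pr).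
  { eapply Rle_trans; [apply Hh; lra|].
    assert (I1 := Hpow z (gamma + 1) ltac:(lra) ltac:(lra)). fold p2 pr in I1.
    apply Rle_trans with (eta' * (p2 * pr)); [apply Rmult_le_compat_l; lra|].
    rewrite <- Rmult_assoc. apply Rmult_le_compat_r; [lra|].
    apply Rle_trans with (eta' * (p2 + 1)); [apply Rmult_le_compat_l; lra|].
    right. unfold eta'. field. lra. }
  assert (Er : Rabs (h r - 1 - a * Rpower r (- gamma) - b * Rpower r (- (gamma + delta))) <= eta / 8 * pr).
  { eapply Rle_trans; [apply Hh; lra|]. fold pr. apply Rmult_le_compat_r; [lra|].
    apply Rle_trans with (eta' * (p2 + 1)); [nra|].
    right. unfold eta'. field. lra. }
  replace (h z - h r + a * gamma * pr * c) with
    ((h z - 1 - a * Rpower z (- gamma) - b * Rpower z (- (gamma + delta)))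
     - (h r - 1 - a * Rpower r (- gamma) - b * Rpower r (- (gamma + delta)))
     + (g z - g r) - a * gamma * (z - r - c) * pr) by (unfold g; ring).
  assert (E3 : Rabs (a * gamma * (z - r - c) * pr) <= eta / 8 * pr).
  { rewrite Rabs_mult, (Rabs_pos_eq pr) by lra. apply Rmult_le_compat_r; [lra|].
    rewrite Rabs_mult, !Rabs_pos_eq by nra. rewrite Hr1 in HK3.
    eapply Rle_trans; [|exact HK3]. apply Rmult_le_compat_l; [nra | lra]. }
  assert (E4 : Rabs (g z - g r) <= (eta / 8 * pr + eta / 8 * pr) * 2).
  { eapply Rle_trans; [exact G|]. apply Rmult_le_compat_l; auto. nra. }
  apply Rle_trans with (eta / 8 * pr + eta / 8 * pr + (eta / 8 * pr + eta / 8 * pr) * 2 + eta / 8 * pr); [|nra].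
  apply Rabs_minus_le; auto. apply Rabs_plus_le; auto. apply Rabs_minus_le; auto.
Qed.

(** * Curvature of the normal graph *)

(** With T = (T1, T2) and N = (- T2, T1), the equations T' = k N and N' = - k T give V' = w (T + p
    N) with w = v - k f. The derivative of w only multiplies the direction of V' and drops out,
    leaving w^2 (p' + k (1 + p^2)) as the numerator of the curvature. *)
Lemma curvature_normal_graph (x y T1 T2 v k dv dk f p dp : R -> R) :
  (forall t, is_derive x t (v t * T1 t)) -> (forall t, is_derive y t (v t * T2 t)) ->
  (forall t, is_derive T1 t (- (k t * T2 t))) -> (forall t, is_derive T2 t (k t * T1 t)) ->
  (forall t, T1 t * T1 t + T2 t * T2 t = 1) ->
  (forall t, is_derive v t (dv t)) -> (forall t, is_derive k t (dk t)) ->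
  (forall t, is_derive f t ((v t - k t * f t) * p t)) -> (forall t, is_derive p t (dp t)) ->
  (forall t, 0 < v t - k t * f t) ->
  let V1 := fun t => x t + f t * - T2 t in
  let V2 := fun t => y t + f t * T1 t in
  regular_C2 V1 V2 /\
  forall t, curvature V1 V2 t =
    (dp t + k t * (1 + p t * p t)) / ((v t - k t * f t) * (sqrt (1 + p t * p t) * (1 + p t * p t))).
Proof.
  intros Hx Hy HT1 HT2 HT Hv Hk Hf Hp Hw V1 V2.
  set (w := fun t => v t - k t * f t).
  set (dw := fun t => dv t - (dk t * f t + k t * (w t * p t))).
  assert (Dw : forall t, is_derive w t (dw t)).
  { intros t. unfold w, dw. apply (is_derive_minus (V := R_NormedModule)); auto.
    apply (is_derive_mult k f t); auto. intros; apply Rmult_comm. }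
  assert (D1 : forall t, is_derive V1 t (w t * (T1 t - p t * T2 t))).
  { intros t. unfold V1. specialize (Hx t). specialize (HT2 t). specialize (Hf t).
    auto_derive; [repeat split; eexists; eassumption|].
    rewrite (Derive_eta _ _ _ Hx), (Derive_eta _ _ _ HT2), (Derive_eta _ _ _ Hf). unfold w. ring. }
  assert (D2 : forall t, is_derive V2 t (w t * (T2 t + p t * T1 t))).
  { intros t. unfold V2. specialize (Hy t). specialize (HT1 t). specialize (Hf t).
    auto_derive; [repeat split; eexists; eassumption|].
    rewrite (Derive_eta _ _ _ Hy), (Derive_eta _ _ _ HT1), (Derive_eta _ _ _ Hf). unfold w. ring. }
  assert (E1 : Derive V1 = fun t => w t * (T1 t - p t * T2 t)).
  { extensionality t. apply is_derive_unique; auto. }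
  assert (E2 : Derive V2 = fun t => w t * (T2 t + p t * T1 t)).
  { extensionality t. apply is_derive_unique; auto. }
  assert (DD1 : forall t, is_derive (Derive V1) t
     (dw t * (T1 t - p t * T2 t) + w t * (- (k t * T2 t) - (dp t * T2 t + p t * (k t * T1 t))))).
  { intros t. rewrite E1. specialize (Dw t). specialize (HT1 t). specialize (HT2 t). specialize (Hp t).
    auto_derive; [repeat split; eexists; eassumption|].
    rewrite (Derive_eta _ _ _ Dw), (Derive_eta _ _ _ HT1), (Derive_eta _ _ _ HT2), (Derive_eta _ _ _ Hp).
    ring. }
  assert (DD2 : forall t, is_derive (Derive V2) t
     (dw t * (T2 t + p t * T1 t) + w t * (k t * T1 t + (dp t * T1 t + p t * - (k t * T2 t))))).
  { intros t. rewrite E2. specialize (Dw t). specialize (HT1 t). specialize (HT2 t). specialize (Hp t).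
    auto_derive; [repeat split; eexists; eassumption|].
    rewrite (Derive_eta _ _ _ Dw), (Derive_eta _ _ _ HT1), (Derive_eta _ _ _ HT2), (Derive_eta _ _ _ Hp).
    ring. }
  assert (Sq : forall t, Derive V1 t ^ 2 + Derive V2 t ^ 2 = w t * w t * (1 + p t * p t)).
  { intros t. rewrite E1, E2. 
    replace ((w t * (T1 t - p t * T2 t)) ^ 2 + (w t * (T2 t + p t * T1 t)) ^ 2)
      with (w t * w t * (1 + p t * p t) * (T1 t * T1 t + T2 t * T2 t)) by ring.
    rewrite HT. ring. }
  assert (Pp : forall t, 0 < 1 + p t * p t) by (intros t; nra).
  assert (Wp : forall t, 0 < w t) by (intros t; apply Hw).
  split.
  - intros t. split; [eexists; apply D1|]. split; [eexists; apply DD1|].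
    split; [eexists; apply D2|]. split; [eexists; apply DD2|].
    rewrite Sq. apply Rmult_lt_0_compat; auto. apply Rmult_lt_0_compat; auto.
  - intros t. unfold curvature, speed. rewrite Sq.
    assert (N1 : Derive_n V1 2 t = _) by (apply is_derive_unique, DD1).
    assert (N2 : Derive_n V2 2 t = _) by (apply is_derive_unique, DD2).
    rewrite N1, N2.
    rewrite E1, E2. fold (w t).
    rewrite sqrt_mult by (try left; auto; apply Rmult_lt_0_compat; auto).
    rewrite sqrt_square by (left; auto).
    assert (Sp : 0 < sqrt (1 + p t * p t)) by (apply sqrt_lt_R0; auto).
    assert (Ss : sqrt (1 + p t * p t) * sqrt (1 + p t * p t) = 1 + p t * p t)
      by (apply sqrt_sqrt; left; auto).
    specialize (Wp t). specialize (HT t).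
    set (S := sqrt (1 + p t * p t)) in *.
    match goal with |- ?num / _ = _ => replace num with
      (w t * w t * (dp t + k t * (1 + p t * p t)) * (T1 t * T1 t + T2 t * T2 t)) by ring end.
    rewrite HT, <- Ss. field. lra.
Qed.

(** * The moving frame of the curve U *)

Lemma kap_numerator nu c e : 0 < vsq c e ->
  kap nu c e * (vel c e * vel c e) = 1 + e * (1 + nu) * c + e * e * nu.
Proof. intros H. unfold vel, kap. rewrite sqrt_sqrt by lra. field. lra. Qed.

Lemma vel_derive nu e t : - (1/16) <= e <= 1/16 ->
  is_derive (fun t => vel (cos ((1 - nu) * t)) e) t
    (- ((1 - nu) * e * sin ((1 - nu) * t) / vel (cos ((1 - nu) * t)) e)).
Proof.
  intros He. assert (Hc := COS_bound ((1 - nu) * t)).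
  destruct (vel_bounds (cos ((1 - nu) * t)) e ltac:(lra) He) as [Hv _].
  assert (Hq := vsq_bounds (cos ((1 - nu) * t)) e ltac:(lra) He).
  unfold vel, vsq in *. auto_derive.
  - lra.
  - field. lra.
Qed.

Lemma kap_derive nu e t : - (1/16) <= e <= 1/16 ->
  is_derive (fun t => kap nu (cos ((1 - nu) * t)) e) t
    ((1 - nu) * (1 - nu) * e * sin ((1 - nu) * t) * (1 - e * e)
     / (vsq (cos ((1 - nu) * t)) e * vsq (cos ((1 - nu) * t)) e)).
Proof.
  intros He. assert (Hc := COS_bound ((1 - nu) * t)).
  assert (Hq := vsq_bounds (cos ((1 - nu) * t)) e ltac:(lra) He).
  unfold kap, vsq in *. auto_derive.
  - lra.
  - field. lra.
Qed.

(** [u1] and [u2] are the components of U' = i (e e^(i t/n) + e^(i t)) with e = r/n; factoring out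
    e^(i t/n) leaves e + e^(i sigma), hence the dependence on sigma alone. *)
Definition u1 (n : nat) (r t : R) : R := - (r * / INR n) * sin (t / INR n) - sin t.
Definition u2 (n : nat) (r t : R) : R := (r * / INR n) * cos (t / INR n) + cos t.

Section Frame.
Context (n : nat) (r : R).
Let nu := / INR n.
Let e := r * nu.
Let c t := cos ((1 - nu) * t).
Let s t := sin ((1 - nu) * t).
Context (Hn : 0 < INR n) (He : - (1/16) <= e <= 1/16).

Lemma U1_derive t : is_derive (U1 n r) t (u1 n r t).
Proof. unfold U1, u1. auto_derive; [lra | unfold Rdiv; ring]. Qed.

Lemma U2_derive t : is_derive (U2 n r) t (u2 n r t).
Proof. unfold U2, u2. auto_derive; [lra | unfold Rdiv; ring]. Qed.

Lemma frame_angles t :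
  cos (t / INR n) * cos t + sin (t / INR n) * sin t = c t /\
  sin t * cos (t / INR n) - cos t * sin (t / INR n) = s t.
Proof.
  unfold c, s. replace ((1 - nu) * t) with (t - t / INR n) by (unfold nu; field; lra).
  rewrite cos_minus, sin_minus. split; ring.
Qed.

Lemma u_norm t : u1 n r t * u1 n r t + u2 n r t * u2 n r t = vsq (c t) e.
Proof.
  destruct (frame_angles t) as [<- _]. unfold u1, u2, vsq. fold nu. fold e.
  assert (A := sin2_cos2 t). assert (B := sin2_cos2 (t / INR n)). unfold Rsqr in *.
  set (X := cos (t / INR n)) in *. set (Y := sin (t / INR n)) in *.
  set (C := cos t) in *. set (S := sin t) in *.
  replace ((- e * Y - S) * (- e * Y - S) + (e * X + C) * (e * X + C)) with
    (e * e * (Y * Y + X * X) + (S * S + C * C) + 2 * e * (X * C + Y * S)) by ring.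
  rewrite A, B. ring.
Qed.

Lemma vel_pos t : 15/16 <= vel (c t) e /\ vel (c t) e * vel (c t) e = vsq (c t) e.
Proof.
  assert (Hc := COS_bound ((1 - nu) * t)). fold (c t) in Hc.
  destruct (vel_bounds (c t) e ltac:(lra) He). split; auto; lra.
Qed.

Lemma normal_eq t : N1 n r t = - (u2 n r t / vel (c t) e) /\ N2 n r t = u1 n r t / vel (c t) e.
Proof.
  unfold N1, N2, speed.
  rewrite (is_derive_unique _ _ _ (U1_derive t)), (is_derive_unique _ _ _ (U2_derive t)).
  replace (u1 n r t ^ 2 + u2 n r t ^ 2) with (vsq (c t) e) by (rewrite <- u_norm; ring).
  fold (vel (c t) e). destruct (vel_pos t). split; [field; lra | auto].
Qed.

Lemma tangent_derive t :
  is_derive (fun t => u1 n r t / vel (c t) e) t (- (kap nu (c t) e * (u2 n r t / vel (c t) e))) /\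
  is_derive (fun t => u2 n r t / vel (c t) e) t (kap nu (c t) e * (u1 n r t / vel (c t) e)).
Proof.
  destruct (vel_pos t) as [Hv Hvv].
  assert (Dv : is_derive (fun t => vel (c t) e) t (- ((1 - nu) * e * s t / vel (c t) e)))
    by (apply vel_derive; auto).
  assert (D1 : is_derive (u1 n r) t (- (e * nu * cos (t / INR n) + cos t))).
  { unfold u1, e, nu. auto_derive; [lra | unfold Rdiv; ring]. }
  assert (D2 : is_derive (u2 n r) t (- (e * nu * sin (t / INR n) + sin t))).
  { unfold u2, e, nu. auto_derive; [lra | unfold Rdiv; ring]. }
  destruct (frame_angles t) as [Ec Es].
  assert (A := sin2_cos2 t). assert (B := sin2_cos2 (t / INR n)). unfold Rsqr in *.
  assert (Hk := kap_numerator nu (c t) e ltac:(nra)).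
  set (X := cos (t / INR n)) in *. set (Y := sin (t / INR n)) in *.
  set (C := cos t) in *. set (S := sin t) in *.
  (* R1 to R4 are addition formulas for t = t/n + sigma. They eliminate sin sigma, after which both
     sides are polynomials in the same quantities. *)
  assert (R1 : Y * s t = X * c t - C).
  { rewrite <- Ec, <- Es. replace (Y * (S * X - C * Y)) with (S * X * Y - C * (Y * Y)) by ring.
    replace (Y * Y) with (1 - X * X) by lra. ring. }
  assert (R2 : S * s t = X - C * c t).
  { rewrite <- Ec, <- Es. replace (S * (S * X - C * Y)) with ((S * S) * X - S * C * Y) by ring.
    replace (S * S) with (1 - C * C) by lra. ring. }
  assert (R3 : X * s t = S - Y * c t).
  { rewrite <- Ec, <- Es. replace (X * (S * X - C * Y)) with (S * (X * X) - C * X * Y) by ring.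
    replace (X * X) with (1 - Y * Y) by lra. ring. }
  assert (R4 : C * s t = S * c t - Y).
  { rewrite <- Ec, <- Es. replace (C * (S * X - C * Y)) with (S * C * X - (C * C) * Y) by ring.
    replace (C * C) with (1 - S * S) by lra. ring. }
  assert (E1 : u1 n r t = - e * Y - S) by reflexivity.
  assert (E2 : u2 n r t = e * X + C) by reflexivity.
  set (v := vel (c t) e) in *. set (k := kap nu (c t) e) in *.
  assert (v3 : 0 < v * v * v) by (repeat apply Rmult_lt_0_compat; lra).
  unfold vsq in Hvv.
  split.
  - assert (L : is_derive (fun t => u1 n r t / vel (c t) e) t
       ((- (e * nu * X + C) * v - u1 n r t * - ((1 - nu) * e * s t / v)) / v ^ 2)).
    { apply is_derive_div; auto. fold v. lra. }
    replace (- (k * (u2 n r t / v))) with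
      ((- (e * nu * X + C) * v - u1 n r t * - ((1 - nu) * e * s t / v)) / v ^ 2); auto.
    apply Rmult_eq_reg_r with (v * v * v); [|lra].
    replace (- (k * (u2 n r t / v)) * (v * v * v)) with (- (k * (v * v)) * u2 n r t) by (field; lra).
    replace ((- (e * nu * X + C) * v - u1 n r t * - ((1 - nu) * e * s t / v)) / v ^ 2 * (v * v * v))
      with (- (e * nu * X + C) * (v * v) - - u1 n r t * ((1 - nu) * e * s t)) by (field; lra).
    rewrite Hk, Hvv, E1, E2.
    replace (- (- e * Y - S) * ((1 - nu) * e * s t)) with ((1 - nu) * e * (e * (Y * s t) + S * s t)) by ring.
    rewrite R1, R2. ring.
  - assert (L : is_derive (fun t => u2 n r t / vel (c t) e) t
       ((- (e * nu * Y + S) * v - u2 n r t * - ((1 - nu) * e * s t / v)) / v ^ 2)).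
    { apply is_derive_div; auto. fold v. lra. }
    replace (k * (u1 n r t / v)) with
      ((- (e * nu * Y + S) * v - u2 n r t * - ((1 - nu) * e * s t / v)) / v ^ 2); auto.
    apply Rmult_eq_reg_r with (v * v * v); [|lra].
    replace (k * (u1 n r t / v) * (v * v * v)) with (k * (v * v) * u1 n r t) by (field; lra).
    replace ((- (e * nu * Y + S) * v - u2 n r t * - ((1 - nu) * e * s t / v)) / v ^ 2 * (v * v * v))
      with (- (e * nu * Y + S) * (v * v) + u2 n r t * ((1 - nu) * e * s t)) by (field; lra).
    rewrite Hk, Hvv, E1, E2.
    replace ((e * X + C) * ((1 - nu) * e * s t)) with ((1 - nu) * e * (e * (X * s t) + C * s t)) by ring.
    rewrite R3, R4. ring.
Qed.

(** With g = f / vel, the normal is N = - (e e^(i t/n) + e^(i t)) / vel, so U + f N = (r - e g) e^(i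
    t/n) + (1 - g) e^(i t); rotating by - t/n gives the formula in [rad]. *)
Lemma graph_norm f t :
  sqrt ((U1 n r t + f * N1 n r t) ^ 2 + (U2 n r t + f * N2 n r t) ^ 2) = rad (c t) (s t) e r f.
Proof.
  destruct (vel_pos t) as [Hv _]. destruct (normal_eq t) as [-> ->]. unfold rad. f_equal.
  set (v := vel (c t) e) in *. clearbody v. set (g := f / v).
  assert (Hs : (s t) ^ 2 = 1 - (c t) ^ 2)
    by (generalize (sin2_cos2 ((1 - nu) * t)); fold (c t) (s t); unfold Rsqr; simpl; lra).
  replace ((r - e * g + (1 - g) * c t) ^ 2 + ((1 - g) * s t) ^ 2) with
    ((r - e * g) ^ 2 + 2 * (r - e * g) * (1 - g) * c t + (1 - g) ^ 2 * ((c t) ^ 2 + (s t) ^ 2)) by ring.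
  rewrite Hs. destruct (frame_angles t) as [<- _].
  unfold U1, U2, u1, u2. fold nu. fold e.
  assert (A := sin2_cos2 t). assert (B := sin2_cos2 (t / INR n)). unfold Rsqr in *.
  set (X := cos (t / INR n)) in *. set (Y := sin (t / INR n)) in *.
  set (C := cos t) in *. set (S := sin t) in *.
  replace (r * X + C + f * - ((e * X + C) / v)) with ((r - e * g) * X + (1 - g) * C)
    by (unfold g; field; lra).
  replace (r * Y + S + f * ((- e * Y - S) / v)) with ((r - e * g) * Y + (1 - g) * S)
    by (unfold g; field; lra).
  replace (((r - e * g) * X + (1 - g) * C) ^ 2 + ((r - e * g) * Y + (1 - g) * S) ^ 2) with
    ((r - e * g) ^ 2 * (Y * Y + X * X) + 2 * (r - e * g) * (1 - g) * (X * C + Y * S)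
     + (1 - g) ^ 2 * (S * S + C * C)) by ring.
  rewrite A, B. ring.
Qed.

Lemma graph_solves (H : R -> R -> R) (h f p : R -> R) :
  0 <= nu <= 1 ->
  (forall x y, H x y = h (sqrt (x ^ 2 + y ^ 2))) ->
  (forall t, Rabs (f t) <= 1/2) ->
  (forall t, is_derive f t (G1s (state_at h nu r t (f t) (p t)))) ->
  (forall t, is_derive p t (G2s (state_at h nu r t (f t) (p t)))) ->
  let V1 := fun t => U1 n r t + f t * N1 n r t in
  let V2 := fun t => U2 n r t + f t * N2 n r t in
  regular_C2 V1 V2 /\ (forall t, curvature V1 V2 t = H (V1 t) (V2 t)) /\
  (forall t, is_derive (Derive f) t (G3s (state_at h nu r t (f t) (p t)))).
Proof.
  intros Hnu HH Hf Df Dp V1 V2.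
  assert (Hw : forall t, 0 < wid nu (c t) e (f t)).
  { intros t. assert (Hc := COS_bound ((1 - nu) * t)). fold (c t) in Hc.
    specialize (Hf t). apply Rabs_le_between in Hf.
    generalize (wid_bounds nu (c t) e (f t) Hnu ltac:(lra) He ltac:(lra)). lra. }
  assert (E1 : V1 = fun t => U1 n r t + f t * - (u2 n r t / vel (c t) e)).
  { extensionality t. unfold V1. destruct (normal_eq t) as [-> _]. reflexivity. }
  assert (E2 : V2 = fun t => U2 n r t + f t * (u1 n r t / vel (c t) e)).
  { extensionality t. unfold V2. destruct (normal_eq t) as [_ ->]. reflexivity. }
  destruct (curvature_normal_graph (U1 n r) (U2 n r) (fun t => u1 n r t / vel (c t) e)
    (fun t => u2 n r t / vel (c t) e) (fun t => vel (c t) e) (fun t => kap nu (c t) e)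
    (fun t => - ((1 - nu) * e * s t / vel (c t) e))
    (fun t => (1 - nu) * (1 - nu) * e * s t * (1 - e * e) / (vsq (c t) e * vsq (c t) e))
    f p (fun t => G2s (state_at h nu r t (f t) (p t)))) as [B1 B2].
  - intros t. destruct (vel_pos t). replace (vel (c t) e * (u1 n r t / vel (c t) e)) with (u1 n r t)
      by (field; lra). apply U1_derive.
  - intros t. destruct (vel_pos t). replace (vel (c t) e * (u2 n r t / vel (c t) e)) with (u2 n r t)
      by (field; lra). apply U2_derive.
  - intros t. apply tangent_derive.
  - intros t. apply tangent_derive.
  - intros t. destruct (vel_pos t) as [P1 P2].
    replace (u1 n r t / vel (c t) e * (u1 n r t / vel (c t) e) + u2 n r t / vel (c t) e * (u2 n r t / vel (c t) e))
      with ((u1 n r t * u1 n r t + u2 n r t * u2 n r t) / (vel (c t) e * vel (c t) e)) by (field; lra).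
    rewrite u_norm, P2. field. nra.
  - intros t. apply vel_derive; auto.
  - intros t. apply kap_derive; auto.
  - exact Df.
  - exact Dp.
  - exact Hw.
  - rewrite <- E1, <- E2 in B1. split; [exact B1|]. split.
    + intros t. rewrite HH. unfold V1 at 2, V2 at 2. rewrite graph_norm.
      rewrite E1, E2. rewrite B2. unfold G2s, state_at, G2; simpl.
      fold e. fold (c t) (s t).
      specialize (Hw t). unfold wid in *.
      assert (Sp : 0 < sqrt (1 + p t * p t)) by (apply sqrt_lt_R0; nra).
      field. repeat split; nra.
    + intros t.
      assert (Ed : Derive f = fun t => (vel (c t) e - kap nu (c t) e * f t) * p t).
      { extensionality u. apply is_derive_unique, Df. }
      rewrite Ed. specialize (Df t). specialize (Dp t).
      assert (Dv := vel_derive nu e t He). assert (Dk := kap_derive nu e t He).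
      fold (s t) in Dv, Dk.
      change (is_derive (fun t => vel (c t) e) t (- ((1 - nu) * e * s t / vel (c t) e))) in Dv.
      change (is_derive (fun t => kap nu (c t) e) t
        ((1 - nu) * (1 - nu) * e * s t * (1 - e * e) / (vsq (c t) e * vsq (c t) e))) in Dk.
      assert (L := is_derive_mult (fun t => vel (c t) e - kap nu (c t) e * f t) p t _ _
        (is_derive_minus (V := R_NormedModule) _ _ _ _ _ Dv
          (is_derive_mult _ _ _ _ _ Dk Df Rmult_comm)) Dp Rmult_comm).
      match type of L with is_derive _ _ ?l =>
        replace (G3s (state_at h nu r t (f t) (p t))) with l; [exact L|] end.
      unfold minus, plus, opp, mult; simpl.
      unfold G3s, G1s, dwid, G1, wid; simpl. fold e. fold (c t) (s t).
      set (g2 := G2s _). unfold Rdiv. ring.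
Qed.
End Frame.

(** The number 16 bounds the period, hence all distances within one period. *)
Lemma holder_of_lipschitz (u alpha : R) : 0 < alpha < 1 -> 0 < u <= 16 -> u <= 16 * Rpower u alpha.
Proof.
  intros Ha Hu. destruct (Rle_dec u 1) as [H1 | H1].
  - assert (u <= Rpower u alpha); [|generalize (Rpower_pos u alpha); lra].
    rewrite <- (Rpower_1 u) at 1 by lra. unfold Rpower.
    assert (ln u <= 0).
    { destruct (Req_dec u 1) as [-> | N]; [rewrite ln_1; lra|]. rewrite <- ln_1. left. apply ln_increasing; lra. }
    destruct (Req_dec (1 * ln u) (alpha * ln u)) as [-> | N]; [lra|].
    left. apply exp_increasing. nra.
  - assert (1 <= Rpower u alpha); [|nra].
    rewrite <- (Rpower_O u) by lra. apply Rle_Rpower; lra.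
Qed.

(** The constant is 19 = 3 + 16: three sup norms and the Hoelder seminorm. [C2alpha] asks for a
    Hoelder bound on the whole line; at distances beyond 16 it follows from the sup bound on the
    second derivative. *)
Lemma C2alpha_bounds (alpha B T : R) (f : R -> R) : 0 < alpha < 1 -> 0 < T <= 16 ->
  (forall t, ex_derive f t) -> (forall t, ex_derive (Derive f) t) ->
  (forall t, Rabs (f t) <= B) -> (forall t, Rabs (Derive f t) <= B) ->
  bl (fun _ => True) (fun s t => Rabs (s - t)) B (Derive_n f 2) ->
  C2alpha alpha f /\ Rbar_le (C2alpha_norm T alpha f) (Finite (19 * B)).
Proof.
  intros Ha HT D1 D2 B0 B1 [B2 B3].
  assert (HB : 0 <= B) by (eapply Rle_trans; [apply Rabs_pos | apply (B0 0)]).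
  split.
  - split.
    + intros t. split; auto. split; auto. apply continuous_of_lipschitz with B. auto.
    + exists (16 * B). intros x y.
      destruct (Req_dec x y) as [-> | N].
      { rewrite Rminus_diag, Rabs_R0. apply Rmult_le_pos; [lra | left; apply Rpower_pos]. }
      assert (Hp : 0 < Rabs (x - y)) by (apply Rabs_pos_lt; lra).
      assert (Hr := Rpower_pos (Rabs (x - y)) alpha).
      destruct (Rle_dec (Rabs (x - y)) 16) as [H16 | H16].
      * eapply Rle_trans; [apply B3; auto|].
        assert (Hh := holder_of_lipschitz _ alpha Ha (conj Hp H16)). nra.
      * assert (1 <= Rpower (Rabs (x - y)) alpha).
        { rewrite <- (Rpower_O (Rabs (x - y))) by lra. apply Rle_Rpower; lra. }
        apply Rle_trans with (B + B); [apply Rabs_minus_le; auto|]. nra.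
  - replace (19 * B) with (B + B + B + 16 * B) by ring.
    assert (Hlub : forall E M, (forall v, E v -> v <= M) -> Rbar_le (Lub_Rbar E) (Finite M)).
    { intros E M HE. apply (proj2 (Lub_Rbar_correct E)). intros v Hv. apply HE, Hv. }
    assert (Hsup : forall g, (forall t, Rabs (g t) <= B) -> Rbar_le (sup_period T g) (Finite B)).
    { intros g Hg. apply Hlub. intros v (x & _ & ->). auto. }
    unfold C2alpha_norm.
    change (Finite (B + B + B + 16 * B)) with
      (Rbar_plus (Rbar_plus (Rbar_plus (Finite B) (Finite B)) (Finite B)) (Finite (16 * B))).
    apply Rbar_plus_le_compat; [apply Rbar_plus_le_compat; [apply Rbar_plus_le_compat|]|]; auto.
    apply Hlub. intros v (x & z & Hx & Hz & N & ->).
    assert (Hp : 0 < Rabs (x - z)) by (apply Rabs_pos_lt; lra).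
    assert (H16 : Rabs (x - z) <= 16) by (apply Rabs_le; lra).
    assert (Hr := Rpower_pos (Rabs (x - z)) alpha).
    apply Rmult_le_reg_r with (Rpower (Rabs (x - z)) alpha); auto.
    unfold Rdiv. rewrite Rmult_assoc, Rinv_l, Rmult_1_r by lra.
    eapply Rle_trans; [apply B3; auto|].
    assert (Hh := holder_of_lipschitz _ alpha Ha (conj Hp H16)). nra.
Qed.

(** * Shooting in R *)

Lemma large_tail (Q : R -> Prop) : large Q -> large (fun r => forall s, r <= s -> Q s).
Proof. intros [S [P H]]. exists S. split; auto. intros r Hr s Hs. apply H. lra. Qed.

(** The conclusion of [endpoint_expansion] enters as a hypothesis so that C2 and q2 are fixed before
    rlo. The radii rlo and rhi correspond to r_n = g/4 and r_n = g, on either side of the zero g/2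
    of the drift. The constant C' + g makes q dominate both the deviation of h from 1 and r nu. *)
Lemma shooting (h : R -> R) (gamma g C' C2 q2 nu rlo rhi : R) (Cq := C' + g) (q := Cq * Rpower rlo (- gamma)) :
  1 < gamma -> 0 < g -> 0 < C' -> 0 < nu <= 1/2 ->
  (forall h nu q r0 r x y T rho eta, regime h nu q r0 r -> q <= q2 -> nu <= q -> solves h nu r x y ->
    (1 - nu) * T = 2 * PI ->
    (forall c s, c ^ 2 + s ^ 2 = 1 -> Rabs (h (sqrt ((r + c) ^ 2 + s ^ 2)) - h r + rho * c) <= eta) ->
    Rabs (y (T / 2) + (2 * (r * nu) - rho) * (T / 4)) <= C2 * (q * q) + 8 * eta) ->
  10 <= rlo -> 16 * g <= rlo -> rlo < rhi ->
  Rpower rlo (gamma + 2) * nu = g / 4 -> Rpower rhi (gamma + 2) * nu = g ->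
  near_one h (C' * Rpower rlo (- gamma)) rlo ->
  (forall r, rlo <= r -> forall c s, c ^ 2 + s ^ 2 = 1 ->
    Rabs (h (sqrt ((r + c) ^ 2 + s ^ 2)) - h r + g * Rpower r (- (gamma + 1)) * c)
    <= g / 512 * Rpower r (- (gamma + 1))) ->
  q <= 1/2 -> q <= q2 -> C2 * (Cq * Cq) * Rpower rlo (- (gamma - 1)) <= g / 64 ->
  forall T, (1 - nu) * T = 2 * PI ->
  exists r x y, rlo <= r <= rhi /\ regime h nu q rlo r /\ solves h nu r x y /\ y (T / 2) = 0.
Proof.
  intros Hg Hg0 HC' Hnu Hend Hr10 Hr16 Hlh Elo Ehi Hone Hgrad Hq2 Hqq2 HC2 T HT.
  assert (Hdrift : forall r, 0 < r -> r * nu = Rpower r (gamma + 2) * nu * Rpower r (- (gamma + 1))).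
  { intros r Hr. replace (Rpower r (gamma + 2) * nu * Rpower r (- (gamma + 1)))
      with (Rpower r (gamma + 2) * Rpower r (- (gamma + 1)) * nu) by ring.
    rewrite <- Rpower_plus. replace (gamma + 2 + - (gamma + 1)) with 1 by ring.
    rewrite Rpower_1; auto. }
  assert (P0 := Rpower_pos rlo (- gamma)).
  assert (Hsmall : forall r, rlo <= r <= rhi -> r * nu <= 1/16 /\ r * nu <= q).
  { intros r Hr.
    assert (I1 : r * nu <= g * Rpower rlo (- (gamma + 1))).
    { rewrite Hdrift by lra. apply Rmult_le_compat; try (left; apply Rpower_pos).
      - apply Rmult_le_pos; [left; apply Rpower_pos | lra].
      - rewrite <- Ehi. apply Rmult_le_compat_r; [lra|]. apply Rle_Rpower_l; lra.
      - apply Rpower_neg_le; lra. }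
    assert (I2 : Rpower rlo (- (gamma + 1)) <= / rlo).
    { rewrite <- (Rpower_1 rlo) at 2 by lra. rewrite <- Rpower_Ropp. apply Rle_Rpower; lra. }
    assert (I3 : Rpower rlo (- (gamma + 1)) <= Rpower rlo (- gamma)) by (apply Rle_Rpower; lra).
    assert (g * / rlo <= 1/16).
    { apply Rmult_le_reg_r with rlo; [lra|]. rewrite Rmult_assoc, Rinv_l; lra. }
    split.
    - eapply Rle_trans; [exact I1|]. eapply Rle_trans; [|exact H]. apply Rmult_le_compat_l; lra.
    - eapply Rle_trans; [exact I1|]. unfold q, Cq. nra. }
  assert (Hreg : forall r, rlo <= r <= rhi -> regime h nu q rlo r).
  { intros r Hr. destruct (Hsmall r Hr). split; auto. split; [split; [|auto]|].
    - unfold q, Cq. apply Rmult_le_pos; lra.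
    - split; [lra|]. split; auto. apply near_one_le with (C' * Rpower rlo (- gamma)); auto.
      unfold q, Cq. nra. }
  (* Clamping the parameter gives a solution for every real r and a shooting function continuous on
     all of R, as [IVT] requires. *)
  set (cl := fun r => Rmax rlo (Rmin r rhi)).
  assert (Hcl : forall r, rlo <= cl r <= rhi).
  { intros r. unfold cl, Rmax, Rmin. repeat destruct Rle_dec; lra. }
  assert (Hcl_id : forall r, rlo <= r <= rhi -> cl r = r).
  { intros r Hr. unfold cl, Rmax, Rmin. repeat destruct Rle_dec; lra. }
  assert (Hcl_lip : forall r r', Rabs (cl r - cl r') <= Rabs (r - r')).
  { intros r r'. unfold cl, Rmax, Rmin, Rabs. repeat destruct Rle_dec; repeat destruct Rcase_abs; lra. }
  destruct (functional_choice (fun r xy => solves h nu (cl r) (fst xy) (snd xy))) as [sol Hsol].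
  { intros r. apply (solution_exists h nu q rlo). auto. }
  (* The sign makes F negative at rlo and positive at rhi. The solutions are picked by choice, but
     [solution_depends_continuously] holds for any of them. *)
  set (F := fun r => - snd (sol r) (T / 2)).
  assert (PI2 := PI2_1). assert (PI4 := PI_4).
  assert (HTb : 4 <= T) by nra.
  assert (Fc : continuity F).
  { destruct (solution_depends_continuously h nu q rlo) as (K & HK & Hdep).
    intros r. apply continuity_pt_filterlim.
    apply (continuous_of_lipschitz F (K * exp (K * (T / 2)))). intros r1 r2. unfold F.
    rewrite <- Rabs_Ropp. replace (- (- snd (sol r1) (T / 2) - - snd (sol r2) (T / 2)))
      with (snd (sol r1) (T / 2) - snd (sol r2) (T / 2)) by ring.
    eapply Rle_trans; [apply (Hdep (cl r1) (cl r2) (fst (sol r1)) _ (fst (sol r2))); auto; lra|].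
    apply Rmult_le_compat_l; auto. apply Rmult_le_pos; auto. left; apply exp_pos. }
  set (plo := Rpower rlo (- (gamma + 1))). set (phi := Rpower rhi (- (gamma + 1))).
  assert (Plo : 0 < plo) by apply Rpower_pos. assert (Phi : 0 < phi) by apply Rpower_pos.
  assert (Dlo : rlo * nu = g / 4 * plo) by (rewrite Hdrift, Elo by lra; reflexivity).
  assert (Dhi : rhi * nu = g * phi) by (rewrite Hdrift, Ehi by lra; reflexivity).
  (* The parameter q is attached to rlo, so the error at rhi is partly measured in plo; this
     converts it. *)
  assert (Hlohi : plo <= 4 * phi).
  { assert (rlo * nu <= rhi * nu) by (apply Rmult_le_compat_r; lra).
    apply Rmult_le_reg_l with g; lra. }
  assert (Hqq : C2 * (q * q) <= g / 64 * plo).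
  { replace (C2 * (q * q)) with (C2 * (Cq * Cq) * Rpower rlo (- (gamma - 1)) * plo).
    - apply Rmult_le_compat_r; lra.
    - unfold q, plo. rewrite Rmult_assoc, <- Rpower_plus.
      replace (- (gamma - 1) + - (gamma + 1)) with (- gamma + - gamma) by ring.
      rewrite Rpower_plus. ring. }
  assert (Hnuq : nu <= q).
  { destruct (Hsmall rlo ltac:(lra)) as [_ H]. nra. }
  assert (Hx : forall r, rlo <= r <= rhi ->
    Rabs (- F r + (2 * (r * nu) - g * Rpower r (- (gamma + 1))) * (T / 4))
    <= C2 * (q * q) + 8 * (g / 512 * Rpower r (- (gamma + 1)))).
  { intros r Hr. unfold F. rewrite Ropp_involutive.
    apply (Hend h nu q rlo r (fst (sol r))); auto.
    - rewrite <- (Hcl_id r Hr) at 1. apply Hsol.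
    - apply Hgrad; lra. }
  (* As T / 4 >= 1, the drift at rlo is at least (g/2) plo in size against errors (g/64 + 8 g/512)
     plo; at rhi it is at least g phi against (4 g/64 + 8 g/512) phi. *)
  destruct (IVT F rlo rhi Fc Hlh) as [r [Hr Hr0]].
  - specialize (Hx rlo ltac:(lra)). fold plo in Hx. rewrite Dlo in Hx.
    apply Rabs_le_between in Hx.
    assert (g * plo * (T / 4) >= g * plo) by (assert (0 < g * plo) by nra; nra).
    assert (0 < g * plo) by nra. lra.
  - specialize (Hx rhi ltac:(lra)). fold phi in Hx. rewrite Dhi in Hx.
    apply Rabs_le_between in Hx.
    assert (0 < g * phi) by nra.
    assert (g * phi * (T / 4) >= g * phi) by nra.
    assert (g * plo <= 4 * (g * phi)) by nra. lra.
  - exists r, (fst (sol r)), (snd (sol r)). split; auto. split; [auto|].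
    split; [rewrite <- (Hcl_id r Hr) at 1; apply Hsol|].
    unfold F in Hr0. lra.
Qed.

Theorem theorem1p3p1
  (alpha : R) (H : R -> R -> R) (h ht : R -> R) (A gamma beta : R)
  (Halpha : 0 < alpha < 1)
  (HC2 : C2_R2 H)
  (Hradial : forall x y, H x y = h (sqrt (x ^ 2 + y ^ 2)))
  (HA : 0 < A) (Hgamma : 1 < gamma) (Hbeta : 0 <= beta)
  (Hht : C2_pos ht)
  (Hexp : exists s0, 0 < s0 /\ forall s, s0 <= s ->
            h s = 1 + A / Rpower s gamma + ht s / Rpower s (gamma + beta))
  (Hbig : 1 < beta -> exists K, forall s, 0 < s -> Rabs (ht s) <= K)
  (Hmid : 0 < beta <= 1 -> exists B,
            is_lim (fun s => (ht s - B) / Rpower s (beta - 1)) p_infty 0)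
  (Hzero : beta = 0 -> exists B, -A < B /\
            is_lim (fun s => (ht s - B) / Rpower s (-1)) p_infty 0)
  (Hh2 : exists C, 0 < C /\ exists s1, forall s, s1 <= s ->
            Rabs (Derive_n h 2 s) <= C * Rpower s (- (gamma + 1 + Rmin 1 beta))) :
  exists (nbar : nat) (Mbar r0 r1 : R) (Rn : nat -> R) (phi : nat -> R -> R),
    (2 <= nbar)%nat /\ 0 < Mbar /\ 0 < r0 < r1 /\
    forall n : nat, (nbar <= n)%nat ->
      let T := 2 * PI * (INR n / (INR n - 1)) in
      let V1 := fun t => U1 n (Rn n) t + phi n t * N1 n (Rn n) t in
      let V2 := fun t => U2 n (Rn n) t + phi n t * N2 n (Rn n) t in
      (exists rn, r0 < rn < r1 /\ Rn n = Rpower (rn * INR n) (1 / (gamma + 2))) /\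
      C2alpha alpha (phi n) /\ periodic T (phi n) /\
      Rbar_le (C2alpha_norm T alpha (phi n))
              (Finite (Mbar * Rpower (INR n) (- (gamma / (gamma + 2))))) /\
      regular_C2 V1 V2 /\
      forall t : R, curvature V1 V2 t = H (V1 t) (V2 t).
Proof.
  destruct (profile_expansion h ht A gamma beta HA Hgamma Hbeta Hexp Hbig Hmid Hzero)
    as (a & b & delta & Ha & Hdelta & Hprof).
  assert (Hder := profile_derivatives H h HC2 Hradial).
  destruct (profile_decay h gamma (Rmin 1 beta) a b delta Hgamma) as (C0 & HC0 & Hdecay); auto.
  { apply Rmin_glb; lra. }
  destruct (profile_near_one h gamma C0 Hgamma HC0 (fun s Hs => proj1 (Hder s Hs)) Hdecay)
    as (C' & HC' & Hnear).
  set (g := a * gamma). assert (Hg : 0 < g) by (unfold g; nra).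
  assert (Hgrad := profile_gradient h gamma a b delta Hgamma Ha Hdelta Hprof (g / 512) ltac:(lra)).
  fold g in Hgrad.
  destruct endpoint_expansion as (C2 & q2 & HC2' & Hq2 & Hend).
  destruct periodic_solution as (C1 & q1 & HC1 & Hq1 & Hper).
  set (Cq := C' + g).
  set (qm := Rmin (1/2) (Rmin q1 q2)).
  assert (Hqm : 0 < qm) by (unfold qm; repeat apply Rmin_pos; lra).
  assert (Hqm' : qm <= 1/2 /\ qm <= q1 /\ qm <= q2).
  { unfold qm. generalize (Rmin_l (1/2) (Rmin q1 q2)) (Rmin_r (1/2) (Rmin q1 q2)) (Rmin_l q1 q2) (Rmin_r q1 q2). lra. }
  destruct (large_and _ _ (large_and _ _ (large_ge 10) (large_ge (16 * g)))
    (large_and _ _ (large_and _ _ Hnear (large_tail _ Hgrad))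
      (large_and _ _ (large_power Cq gamma qm ltac:(lra) Hqm)
        (large_power (C2 * (Cq * Cq)) (gamma - 1) (g / 64) ltac:(lra) ltac:(lra)))))
    as (S & HS & Hlarge).
  (* For n >= n0 this gives (g/4) n >= S^(gamma+2), that is, [rlo n] >= S. *)
  destruct (INR_unbounded (4 / g * Rpower S (gamma + 2))) as [n0 Hn0].
  set (rlo := fun n => Rpower (g / 4 * INR n) (1 / (gamma + 2))).
  (* 19 comes from [C2alpha_bounds] and C1 from [periodic_solution]; the rest is q = Cq (rlo
     n)^-gamma with the power of n split off. *)
  set (Mbar := 19 * (C1 * Cq * Rpower (g / 4) (- (gamma / (gamma + 2))))).
  assert (HMbar : 0 < Mbar).
  { unfold Mbar. apply Rmult_lt_0_compat; [lra|]. apply Rmult_lt_0_compat; [|apply Rpower_pos].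
    apply Rmult_lt_0_compat; unfold Cq; lra. }
  assert (Hall : forall n : nat, exists rf : R * (R -> R), (n0 + 2 <= n)%nat ->
      let T := 2 * PI * (INR n / (INR n - 1)) in
      let V1 := fun t => U1 n (fst rf) t + snd rf t * N1 n (fst rf) t in
      let V2 := fun t => U2 n (fst rf) t + snd rf t * N2 n (fst rf) t in
      (exists rn, g / 8 < rn < 2 * g /\ fst rf = Rpower (rn * INR n) (1 / (gamma + 2))) /\
      C2alpha alpha (snd rf) /\ periodic T (snd rf) /\
      Rbar_le (C2alpha_norm T alpha (snd rf))
              (Finite (Mbar * Rpower (INR n) (- (gamma / (gamma + 2))))) /\
      regular_C2 V1 V2 /\
      forall t : R, curvature V1 V2 t = H (V1 t) (V2 t)).
  { intros n. destruct (Compare_dec.le_dec (n0 + 2) n) as [Hn | Hn].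
    (* Dummy values below the threshold, since choice needs a pair for every n. *)
    2:{ exists (0, fun _ => 0). intros; contradiction. }
    assert (Hn2 : 2 <= INR n) by (apply (le_INR 2); lia).
    assert (Hnn : INR n0 <= INR n) by (apply le_INR; lia).
    set (nu := / INR n). set (T := 2 * PI * (INR n / (INR n - 1))).
    assert (Hnn1 : nu * INR n = 1) by (unfold nu; field; lra).
    assert (Hnu : 0 < nu <= 1/2).
    { split; [apply Rinv_0_lt_compat; lra|]. unfold Rdiv. rewrite Rmult_1_l.
      apply Rinv_le_contravar; lra. }
    assert (HT : (1 - nu) * T = 2 * PI) by (unfold T, nu; field; lra).
    set (rhi := Rpower (g * INR n) (1 / (gamma + 2))).
    assert (Hroot : forall u, 0 < u -> Rpower (Rpower u (1 / (gamma + 2))) (gamma + 2) = u).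
    { intros u Hu. rewrite Rpower_mult. replace (1 / (gamma + 2) * (gamma + 2)) with 1 by (field; lra).
      apply Rpower_1; auto. }
    assert (Hroot' : forall u, 0 < u -> Rpower (Rpower u (gamma + 2)) (1 / (gamma + 2)) = u).
    { intros u Hu. rewrite Rpower_mult. replace ((gamma + 2) * (1 / (gamma + 2))) with 1 by (field; lra).
      apply Rpower_1; auto. }
    assert (Hgn : 0 < g * INR n) by (apply Rmult_lt_0_compat; lra).
    assert (Hi : 0 < 1 / (gamma + 2)) by (apply Rdiv_lt_0_compat; lra).
    assert (HSlo : S <= rlo n).
    { rewrite <- (Hroot' S) by auto. unfold rlo. apply Rle_Rpower_l; [lra|].
      split; [apply Rpower_pos|].
      apply Rmult_le_reg_l with (4 / g); [apply Rdiv_lt_0_compat; lra|].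
      replace (4 / g * (g / 4 * INR n)) with (INR n) by (field; lra). lra. }
    destruct (Hlarge (rlo n) HSlo) as ((L1 & L2) & (L3 & L4) & L5 & L6).
    destruct (shooting h gamma g C' C2 q2 nu (rlo n) rhi) with (T := T)
      as (r & x & y & Hr & Hreg & Hsol & Hy0); auto; try lra.
    - unfold rlo, rhi. apply Rlt_Rpower_l; [auto | split; lra].
    - unfold rlo. rewrite Hroot by lra.
      replace (g / 4 * INR n * nu) with (g / 4 * (nu * INR n)) by ring. rewrite Hnn1. ring.
    - unfold rhi. rewrite Hroot by lra.
      replace (g * INR n * nu) with (g * (nu * INR n)) by ring. rewrite Hnn1. ring.
    - fold Cq. lra.
    - fold Cq. lra.
    - fold Cq in Hreg. set (q := Cq * Rpower (rlo n) (- gamma)) in *.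
      destruct (Hper h nu q (rlo n) r x y T Hreg ltac:(lra) Hsol HT Hy0)
        as (X1 & X2 & X3 & X4 & X5 & X6).
      assert (Hre := Hreg). destruct Hre as (_ & Hq & Hrr & _ & He & _).
      assert (Hrn : 0 <= r * nu) by (apply Rmult_le_pos; lra).
      destruct (graph_solves n r ltac:(lra) ltac:(fold nu; lra) H h x y ltac:(fold nu; lra) Hradial
        (fun t => proj1 (X2 t)) X3 X4) as (Y1 & Y2 & Y3).
      fold nu in Y3.
      assert (Dx : forall t, Derive x t = G1s (state_at h nu r t (x t) (y t))).
      { intros t. apply is_derive_unique, X3. }
      assert (PI0 := PI_RGT_0). assert (PI4 := PI_4).
      destruct (C2alpha_bounds alpha (C1 * q) T x Halpha) as (Z1 & Z2).
      + clear - Hnu HT PI0 PI4. split; nra.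
      + intros t. eexists. apply X3.
      + intros t. eexists. apply Y3.
      + intros t. apply X2.
      + intros t. rewrite Dx. apply X5.
      + apply bl_ext with (2 := fun t _ => eq_sym (is_derive_unique _ _ _ (Y3 t))). exact X6.
      + exists (r, x). intros _. simpl fst. simpl snd. split; [|split; [|split; [|split; [|split]]]]; auto.
        * exists (Rpower r (gamma + 2) * nu).
          assert (Rpower (rlo n) (gamma + 2) <= Rpower r (gamma + 2)) by (apply Rle_Rpower_l; lra).
          assert (Rpower r (gamma + 2) <= Rpower rhi (gamma + 2)) by (apply Rle_Rpower_l; lra).
          unfold rlo in H0. unfold rhi in H1. rewrite Hroot in H0, H1 by lra.
          split.
          -- assert (g / 4 * INR n * nu <= Rpower r (gamma + 2) * nu) by (apply Rmult_le_compat_r; lra).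
             assert (Rpower r (gamma + 2) * nu <= g * INR n * nu) by (apply Rmult_le_compat_r; lra).
             replace (g / 4 * INR n * nu) with (g / 4 * (nu * INR n)) in * by ring.
             replace (g * INR n * nu) with (g * (nu * INR n)) in * by ring.
             rewrite Hnn1 in *. lra.
          -- rewrite Rmult_assoc, Hnn1, Rmult_1_r. symmetry. apply Hroot'. lra.
        * fold T. replace (Mbar * Rpower (INR n) (- (gamma / (gamma + 2)))) with (19 * (C1 * q)); auto.
          unfold Mbar, q, rlo. rewrite Rpower_mult.
          replace (1 / (gamma + 2) * - gamma) with (- (gamma / (gamma + 2))) by (field; lra).
          rewrite <- Rpower_mult_distr by lra. ring. }
  destruct (functional_choice _ Hall) as [rf Hrf].
  (* The r_n found lie in the closed interval [g/4, g]; g/8 and 2 g make the inequalities strict.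
     The added 2 ensures nu <= 1/2. *)
  exists (n0 + 2)%nat, Mbar, (g / 8), (2 * g), (fun n => fst (rf n)), (fun n => snd (rf n)).
  split; [lia|]. split; [auto|]. split; [lra|]. intros n Hn. exact (Hrf n Hn).
Qed.
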